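(* Let $k$ be a perfect field with algebraic closure $\bar k$. Let $f\in k[x^{\pm1},y^{\pm1}]$ be such that $C_0:f=0$ is a geometrically connected smooth curve in $\mathbb G_{m,k}^2$, and let $C$ be the smooth completion of $C_0$. Let $P$ be the finite indexed set of polynomials associated with $f$ (defined in the context), with its action of $\mathrm{Gal}(\bar k/k)$ written $\sigma\cdot f_\ell=f_{\sigma(\ell)}$. Then there is a natural bijection $$C(\bar k)\setminus C_0(\bar k)\ \longleftrightarrow\ \bigsqcup_{f_\ell\in P}\{\text{simple roots of } f|_\ell \text{ in }\bar k^\times\}$$ that preserves the $\mathrm{Gal}(\bar k/k)$-action, where $\sigma\in\mathrm{Gal}(\bar k/k)$ takes a simple root $r\in\bar k^\times$ of $f|_\ell$ to the simple root $\sigma(r)\in\bar k^\times$ of $f|_{\sigma(\ell)}$.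
   Context: The smooth completion of a smooth affine curve $U$ is the unique (up to isomorphism) smooth projective curve birational to $U$. Normal vectors: for an edge $\ell$ of an integral polygon $\mathcal P$, the normal vector of $\ell$ is the primitive $(a,b)\in\mathbb Z^2$ for which there is $c\in\mathbb Z$ such that $ai+bj+c$ vanishes on $\ell$ and is $\ge 0$ on $\mathcal P$. If $\mathcal P$ is a segment, it is considered to have two edges, both equal to $\mathcal P$, with opposite normal vectors. For each primitive $\beta=(\beta_1,\beta_2)\in\mathbb Z^2$ fix once and for all $\delta_\beta=(\delta_1,\delta_2)\in\mathbb Z^2$ with $\delta_1\beta_2-\delta_2\beta_1=1$. For a nonzero Laurent polynomial $h(x,y)$ over $\bar k$ and an edge $\ell$ of its Newton polygon with normal vector $\beta$, let $h_\ell\in\bar k[X,Y]$ be the polynomial with $X\nmid h_\ell$, $Y\nmid h_\ell$ such that, via $x=X^{\delta_1}Y^{\beta_1}$, $y=X^{\delta_2}Y^{\beta_2}$, one has $h(x,y)=X^{n_X}Y^{n_Y}h_\ell(X,Y)$ for some $n_X,n_Y\in\mathbb Z$. Definition of $P$. $P_1$ is the indexed set $\bigsqcup_\ell\{f_\ell\}$, $\ell$ running over all edges of the Newton polygon of $f$. For a polynomial $f_\ell$ in any $P_n$ put $f|_\ell(X)=f_\ell(X,0)\in\bar k[X]$. Given $P_n$, for every $f_\ell\in P_n$ and every multiple root $a\in\bar k^\times$ of $f|_\ell$: put $f_{\ell,a}(x,y)=f_\ell(x+a,y)$ (the variables $X,Y$ of $f_\ell$ being renamed $x,y$), let $\Delta_{\ell,a}$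 be the Newton polygon of $f_{\ell,a}$, and let $P_{\ell,a}=\bigsqcup_{\ell'}\{f_{\ell'}\}$ where $\ell'$ runs over the edges of $\Delta_{\ell,a}$ with normal vector in $\mathbb Z_+^2$ (both coordinates positive) and $f_{\ell'}:=(f_{\ell,a})_{\ell'}$. Set $P_{n+1}=\bigsqcup_{f_\ell,a}P_{\ell,a}$ (disjoint union over all $f_\ell\in P_n$ and all multiple roots $a\in\bar k^\times$ of $f|_\ell$; thus elements are indexed by $\ell'$ together with $f_\ell$ and $a$). This is iterated until $P_{n+1}=\varnothing$, i.e. until no $f|_\ell$ with $f_\ell\in P_n$ has multiple roots in $\bar k^\times$ (the procedure terminates), and $P=P_1\sqcup\cdots\sqcup P_n$. Galois action on $P$. For $\sigma\in\mathrm{Gal}(\bar k/k)$: if $f_\ell\in P_1$, $\sigma\cdot f_\ell=f_\ell$. If $f_{\ell'}=(f_{\ell,a})_{\ell'}\in P_{n+1}$ with $f_\ell\in P_n$ and $a$ a multiple root of $f|_\ell$, and $\sigma\cdot f_\ell=f_{\sigma(\ell)}\in P_n$, then $\sigma(a)$ is a multiple root of $f|_{\sigma(\ell)}$ and $f_{\sigma(\ell),\sigma(a)}=f_{\ell,a}^\sigma$ (apply $\sigma$ to coefficients), so $\Delta_{\sigma(\ell),\sigma(a)}=\Delta_{\ell,a}$; let $\sigma(\ell')$ be the edge of $\Delta_{\sigma(\ell),\sigma(a)}$ with the same normal vector as $\ell'$ and define $\sigma\cdot f_{\ell'}=f_{\sigma(\ell')}:=(f_{\sigma(\ell),\sigma(a)})_{\sigma(\ell')}\in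 P_{n+1}$. *)

(* Defs.v *)
From HB Require Import structures.
From mathcomp Require Import all_boot all_order all_algebra all_field.
From mathcomp Require Import finmap mpoly.

Set Implicit Arguments.
Unset Strict Implicit.
Unset Printing Implicit Defensive.

Import GRing.Theory.
Local Open Scope ring_scope.

Definition perfect (k : fieldType) : Prop :=
  forall p : {poly k}, irreducible_poly p -> separable_poly p.

(** * Laurent polynomials in x, y and curves in the torus *)

(* [f (i, j)] is the coefficient of x^i y^j. *)
Definition laurent (R : nzRingType) := {fsfun (int * int)%type -> R with 0}.

Definition lmap (R S : nzRingType) (phi : {rmorphism R -> S}) (f : laurent R)
  : laurent S := [fsfun m in finsupp f => phi (f m) | 0].

Lemma lmapE (R S : nzRingType) (phi : {rmorphism R -> S}) (f : laurent R) m :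
  lmap phi f m = phi (f m).
Proof. by rewrite fsfunE; case: finsuppP => //; rewrite rmorph0. Qed.

Section Torus.
Variable K : fieldType.
Implicit Types (f : laurent K) (p : K * K) (X Z : K * K -> Prop).

Definition leval f p : K :=
  \sum_(m <- finsupp f) f m * p.1 ^ m.1 * p.2 ^ m.2.

Definition ldx f p : K :=
  \sum_(m <- finsupp f) f m *~ m.1 * p.1 ^ (m.1 - 1) * p.2 ^ m.2.

Definition ldy f p : K :=
  \sum_(m <- finsupp f) f m *~ m.2 * p.1 ^ m.1 * p.2 ^ (m.2 - 1).

Definition in_torus p : Prop := p.1 != 0 /\ p.2 != 0.

Definition torus_curve f p : Prop := in_torus p /\ leval f p = 0.

Definition torus_closed Z : Prop :=
  exists S : laurent K -> Prop,
    forall p, Z p <-> in_torus p /\ forall h, S h -> leval h p = 0.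

Definition torus_connected X : Prop :=
  (exists p, X p) /\
  forall Z1 Z2, torus_closed Z1 -> torus_closed Z2 ->
    (forall p, X p -> Z1 p \/ Z2 p) ->
    (forall p, X p -> ~ (Z1 p /\ Z2 p)) ->
    (forall p, X p -> Z1 p) \/ (forall p, X p -> Z2 p).

(* Jacobian criterion at all geometric points; f = 0 does not satisfy it. *)
Definition torus_smooth f : Prop :=
  forall p, torus_curve f p -> ldx f p != 0 \/ ldy f p != 0.

End Torus.

(** * Smooth projective curves *)

Section Projective.
Variables (K : fieldType) (N : nat).
Implicit Types (v w : 'rV[K]_N.+1) (Z : 'rV[K]_N.+1 -> Prop).

(* A point of P^N(K) is represented by its unique vector of homogeneous
   coordinates whose first nonzero entry is 1.  Field automorphisms, applied
   entrywise, preserve such vectors. *)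
Definition proj_point v : Prop :=
  exists i, v 0 i = 1 /\ forall j : 'I_N.+1, (j < i)%N -> v 0 j = 0.

(* [w] is a vector of homogeneous coordinates of the point [v]. *)
Definition coords_of w v : Prop := exists2 c : K, c != 0 & w = c *: v.

Definition peval (P : {mpoly K[N.+1]}) v : K := P.@[fun i => v 0 i].

Definition proj_closed Z : Prop :=
  exists S : {mpoly K[N.+1]} -> Prop,
    (forall P, S P -> exists d, P \is d.-homog) /\
    forall v, Z v <-> proj_point v /\ forall P, S P -> peval P v = 0.

Definition proj_irreducible_closed Z : Prop :=
  [/\ proj_closed Z, exists v, Z v &
      forall Z1 Z2, proj_closed Z1 -> proj_closed Z2 ->
        (forall v, Z v -> Z1 v \/ Z2 v) ->
        (forall v, Z v -> Z1 v) \/ (forall v, Z v -> Z2 v)].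

Definition proper_subset Z1 Z2 : Prop :=
  (forall v, Z1 v -> Z2 v) /\ exists2 v, Z2 v & ~ Z1 v.

(* Irreducible of Krull dimension 1. *)
Definition proj_curve Z : Prop :=
  [/\ proj_irreducible_closed Z,
      exists2 Z1, proj_irreducible_closed Z1 & proper_subset Z1 Z &
      ~ exists Z0 Z1, [/\ proj_irreducible_closed Z0,
          proj_irreducible_closed Z1, proper_subset Z0 Z1 &
          proper_subset Z1 Z]].

Section Equations.
Variables (m : nat) (G : 'I_m -> {mpoly K[N.+1]}).

Definition proj_zeros v : Prop :=
  proj_point v /\ forall i, peval (G i) v = 0.

Definition jacobian v : 'M[K]_(m, N.+1) :=
  \matrix_(i, j) peval (mderiv j (G i)) v.

(* Jacobian criterion: codimension N - 1. *)
Definition smooth_proj_curve : Prop :=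
  [/\ forall i, exists d, G i \is d.-homog,
      proj_curve proj_zeros &
      forall v, proj_zeros v -> (\rank (jacobian v)).+1 = N].

End Equations.
End Projective.

(** * Smooth completion *)

Section Completion.
Variables (k K : fieldType) (iota : {rmorphism k -> K}) (f : laurent k).
Variables (N m : nat) (G : 'I_m -> {mpoly k[N.+1]}) (g : 'I_N.+1 -> laurent k).

Let C0 := torus_curve (lmap iota f).
Let GK i := map_mpoly iota (G i).
Let C := proj_zeros GK.

Definition tuple_eval (h : 'I_N.+1 -> laurent K) (p : K * K) : 'rV[K]_N.+1 :=
  \row_i leval (h i) p.

Definition map_eval : K * K -> 'rV[K]_N.+1 :=
  tuple_eval (fun i => lmap iota (g i)).

(* The tuple [g] defines a rational map [g_0 : ... : g_N] from C_0 to C over k.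
   Its inverse is given over k by x = A / D, y = B / D on the open subset
   A B D != 0 of C. *)
Definition birational_map : Prop :=
  (forall p, C0 p -> map_eval p != 0 -> exists2 q, C q & coords_of (map_eval p) q)
  /\ exists (d : nat) (A B D : {mpoly k[N.+1]}),
    let A' := peval (map_mpoly iota A) in
    let B' := peval (map_mpoly iota B) in
    let D' := peval (map_mpoly iota D) in
    let dom v := [/\ A' v != 0, B' v != 0 & D' v != 0] in
    let inv v := (A' v / D' v, B' v / D' v) in
    [/\ [/\ A \is d.-homog, B \is d.-homog & D \is d.-homog],
        forall q, C q -> dom q -> C0 (inv q),
        (exists p, [/\ C0 p, map_eval p != 0 & dom (map_eval p)]) /\
        (forall p, C0 p -> map_eval p != 0 -> dom (map_eval p) ->
           inv (map_eval p) = p) &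
        (exists q, [/\ C q, dom q & map_eval (inv q) != 0]) /\
        (forall q, C q -> dom q -> map_eval (inv q) != 0 ->
           coords_of (map_eval (inv q)) q)].

Definition smooth_completion : Prop := smooth_proj_curve GK /\ birational_map.

(* The rational map given by [g] is regular at [p] with value [q]: near [p] it
   is also given by a tuple [h] that does not vanish at [p]. *)
Definition map_value (p : K * K) (q : 'rV[K]_N.+1) : Prop :=
  exists h : 'I_N.+1 -> laurent K,
    (forall p', C0 p' -> forall i j,
       tuple_eval h p' 0 i * map_eval p' 0 j
         = tuple_eval h p' 0 j * map_eval p' 0 i) /\
    coords_of (tuple_eval h p) q.

(* C(K) minus C_0(K), where C_0 is embedded in C by the extension of the
   birational map to a morphism. *)
Definition point_at_infinity (q : 'rV[K]_N.+1) : Prop :=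
  C q /\ ~ exists2 p, C0 p & map_value p q.

End Completion.

(** * The indexed set P *)

Section EdgePolynomials.
Variable K : fieldType.
Implicit Types (c : int * int -> K) (h : {poly {poly K}}) (beta : int * int).

(* In {poly {poly K}} the outer variable 'X is the first one (X or x) and the
   inner one 'X%:P is the second one (Y or y). *)
Definition bicoef h (e : int * int) : K :=
  match e with (Posz i, Posz j) => h`_i`_j | _ => 0 end.

(* Its rational points; [c] is the coefficient function. *)
Definition newton_polygon c (z : rat * rat) : Prop :=
  exists (n : nat) (s : 'I_n -> int * int) (w : 'I_n -> rat),
    [/\ forall i, c (s i) != 0, forall i, 0 <= w i, \sum_i w i = 1 &
        z = (\sum_i w i * (s i).1%:~R, \sum_i w i * (s i).2%:~R)].

(* [beta] is the normal vector of an edge.  Edges are indexed by their normal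
   vectors, which determine them; a segment gives two opposite ones. *)
Definition edge_normal (Delta : rat * rat -> Prop) beta : Prop :=
  coprimez beta.1 beta.2 /\
  exists c : int,
    let aff (z : rat * rat) := beta.1%:~R * z.1 + beta.2%:~R * z.2 + c%:~R in
    (forall z, Delta z -> 0 <= aff z) /\
    exists z1 z2, [/\ z1 != z2, Delta z1, Delta z2, aff z1 = 0 & aff z2 = 0].

Variable delta : int * int -> int * int.

(* [hl] is the polynomial attached to the edge with normal vector [beta]: x^i y^j
   is X^(delta_1 i + delta_2 j) Y^(beta_1 i + beta_2 j). *)
Definition edge_poly beta c (hl : {poly {poly K}}) : Prop :=
  [/\ forall u, hl <> 'X * u, forall u, hl <> 'X%:P * u &
      exists nX nY : int, forall i j : int,
        c (i, j) = bicoef hl ((delta beta).1 * i + (delta beta).2 * j - nX,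
                              beta.1 * i + beta.2 * j - nY)].

(* f|_l (X) = f_l (X, 0) *)
Definition restr h : {poly K} := map_poly (horner_eval 0) h.

Definition simple_root (p : {poly K}) (r : K) : Prop := mup r p = 1%N.
Definition multiple_root (p : {poly K}) (a : K) : Prop := (1 < mup a p)%N.

(* h (x + a, y) *)
Definition translate h (a : K) : {poly {poly K}} := h \Po ('X + a%:P%:P).

Inductive edge_index : Type :=
| First of int * int
| Next of edge_index & K & int * int.

(* [in_P f l h]: [l] is an index of P and its polynomial f_l is [h].  The set P_n
   consists of the indices with n - 1 occurrences of [Next]. *)
Inductive in_P (f : laurent K) : edge_index -> {poly {poly K}} -> Prop :=
| in_P_first beta h :
    edge_normal (newton_polygon f) beta ->
    edge_poly beta f h ->
    in_P f (First beta) h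
| in_P_next l h a beta h' :
    in_P f l h ->
    a != 0 -> multiple_root (restr h) a ->
    0 < beta.1 -> 0 < beta.2 ->
    edge_normal (newton_polygon (bicoef (translate h a))) beta ->
    edge_poly beta (bicoef (translate h a)) h' ->
    in_P f (Next l a beta) h'.

Definition root_at_infinity (f : laurent K) (t : edge_index * K) : Prop :=
  exists h, [/\ in_P f t.1 h, t.2 != 0 & simple_root (restr h) t.2].

Fixpoint gal_index (sigma : K -> K) (l : edge_index) : edge_index :=
  match l with
  | First beta => First beta
  | Next l' a beta => Next (gal_index sigma l') (sigma a) beta
  end.

Definition monomial_subst beta (P : K * K) : K * K :=
  (P.1 ^ (delta beta).1 * P.2 ^ beta.1, P.1 ^ (delta beta).2 * P.2 ^ beta.2).

(* [P] = (X, Y) are the values at the torus point [p] of the variables of f_l,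
   as rational functions of x and y. *)
Fixpoint chart (l : edge_index) (p P : K * K) : Prop :=
  in_torus P /\
  match l with
  | First beta => p = monomial_subst beta P
  | Next l' a beta =>
      exists Q, chart l' p Q /\ (Q.1 - a, Q.2) = monomial_subst beta P
  end.

End EdgePolynomials.

(** * Naturality *)

(* The variables X, Y of f_l, as rational functions on C (here given by U / H and
   V / H), are regular at [q] with values [r] and 0.  As a simple root, (r, 0) is
   a point of f_l = 0 through which only one branch passes, so this determines
   [q] from [l] and [r]. *)
Definition centred_at (k K : fieldType) (iota : {rmorphism k -> K})
    (delta : int * int -> int * int) (f : laurent k) (N : nat)
    (g : 'I_N.+1 -> laurent k) (q : 'rV[K]_N.+1) (l : edge_index K) (r : K) : Prop :=
  exists (d : nat) (U V H : {mpoly K[N.+1]}),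
    [/\ [/\ U \is d.-homog, V \is d.-homog & H \is d.-homog],
        [/\ peval H q != 0, peval U q = r * peval H q & peval V q = 0] &
        forall p P, torus_curve (lmap iota f) p -> map_eval iota g p != 0 ->
          chart delta l p P ->
          peval U (map_eval iota g p) = P.1 * peval H (map_eval iota g p) /\
          peval V (map_eval iota g p) = P.2 * peval H (map_eval iota g p)].

(* Main.v *)
(* Let F be the function field of C_0 and x, y its coordinates.  A K-rational place
   of F is a partial map from F to K (its residue map).  Both sides of the bijection
   are the discrete places at which x and y are not both units.

   For a point q of C, the local ring at q is a discrete valuation ring by the
   Jacobian criterion; the point is in C_0 iff x and y are units there.  For a
   simple root r of f|_l, the values X, Y in F of the variables of f_l satisfy
   f_l(X, Y) = 0, and (r, 0) is a smooth point of this plane curve, again with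
   function field F.  Since valuation rings are maximal for domination, a point q and
   a pair (l, r) give the same place iff X and Y are regular at q with values r and 0.

   Conversely, at a place where x and y are not both units, the valuations of x and y
   are proportional to the normal vector of a unique edge, which gives X and Y with X
   a unit and Y of positive valuation.  If the residue of X is a multiple root of
   f|_l, one translates and repeats.  The minimum of the valuations of the logarithmic
   derivatives of f_l decreases, so this ends with a simple root. *)
Require Import Defs.
From HB Require Import structures.
From mathcomp Require Import all_boot all_order all_algebra all_field.
From mathcomp Require Import finmap mpoly.
From mathcomp Require Import ring zify.
From Stdlib Require Import Classical ClassicalEpsilon.
Set Implicit Arguments.
Unset Strict Implicit.
Unset Printing Implicit Defensive.
Import GRing.Theory Order.TTheory Num.Theory.
Local Open Scope ring_scope.

(** * Evaluation and edge polynomials *)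

(** The field F is the fraction field of K[X, Y] modulo the polynomials that vanish on C_0.
    Smoothness and connectedness together make this ideal prime and generated by the equation: a
    factorisation would cut C_0 into two closed sets, disjoint because both logarithmic derivatives
    vanish at a common zero. The Jacobian criterion only makes the maximal ideal principal. That no
    nonzero element is infinitely divisible comes from the algebraic dependence of any two elements
    of F, which takes the place of a noetherian argument. The data speak of values at K-points, the
    argument of identities in F. The bridge is that a nonzero element of F has a nonzero value at
    some point of C_0. In the descent, a monomial substitution acts on the two logarithmic
    derivatives by a unimodular matrix and divides out X^nX Y^nY. The translation by a costs the
    valuation e b_1 of X - a, where e is the valuation of the next Y. A multiple root forces nY >
    b_1, hence a strict gain in every characteristic. Both derivatives are followed because either
    may vanish on all of C_0; smoothness only excludes that both do. *)

Lemma fun_choice (A B : Type) (R : A -> B -> Prop) :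
  (forall a, exists b, R a b) -> exists u : A -> B, forall a, R a (u a).
Proof.
move=> H; exists (fun a => proj1_sig (constructive_indefinite_description _ (H a))).
by move=> a; case: constructive_indefinite_description.
Qed.

Lemma eq_big_support (R : nmodType) (T : eqType) (s t : seq T) (F : T -> R) :
  uniq s -> uniq t -> (forall m, F m != 0 -> m \in s) ->
  (forall m, F m != 0 -> m \in t) -> \sum_(m <- s) F m = \sum_(m <- t) F m.
Proof.
move=> us ut hs ht.
have E (r : seq T) : \sum_(m <- r) F m = \sum_(m <- [seq m <- r | F m != 0]) F m.
  rewrite big_filter [RHS]big_mkcond; apply: eq_bigr => m _.
  by case: ifP => // /negbFE/eqP.
rewrite (E s) (E t); apply: perm_big; apply: uniq_perm; rewrite ?filter_uniq //.
move=> m; rewrite !mem_filter; case: eqP => //= /eqP Fm.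
by rewrite hs // ht.
Qed.

Lemma bipoly_ind (R : nzRingType) (P : {poly {poly R}} -> Prop) :
  (forall c, P c%:P%:P) -> P 'X -> P 'X%:P ->
  (forall a b, P a -> P b -> P (a + b)) ->
  (forall a b, P a -> P b -> P (a * b)) -> forall h, P h.
Proof.
move=> PC PX PY PD PM.
have PP (p : {poly R}) : P p%:P.
  elim/poly_ind: p => [|p c IH]; first exact: PC.
  by rewrite polyCD polyCM; apply: PD => //; apply: PM.
elim/poly_ind => [|h p IH]; first exact: PP.
by apply: PD => //; apply: PM.
Qed.

Section Evaluation.
Variables (K L : fieldType) (phi : {rmorphism K -> L}).
Implicit Types (h : {poly {poly K}}) (X Y : L).

Definition ev1 Y : {rmorphism {poly K} -> L} :=
  horner_morph (fun c => mulrC Y (phi c)).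

Definition ev2 X Y : {rmorphism {poly {poly K}} -> L} :=
  horner_morph (fun p => mulrC X (ev1 Y p)).

Lemma ev1E Y p : ev1 Y p = (map_poly phi p).[Y].
Proof. by []. Qed.

Lemma ev2C X Y c : ev2 X Y c%:P%:P = phi c.
Proof. by rewrite /ev2 /= horner_morphC /= /ev1 /= horner_morphC. Qed.

Lemma ev2X X Y : ev2 X Y 'X = X.
Proof. by rewrite /ev2 /= horner_morphX. Qed.

Lemma ev2P X Y p : ev2 X Y p%:P = ev1 Y p.
Proof. by rewrite /ev2 /= horner_morphC. Qed.

Lemma ev2Y X Y : ev2 X Y 'X%:P = Y.
Proof. by rewrite ev2P /ev1 /= horner_morphX. Qed.

Lemma ev2_coef X Y h N : (size h <= N)%N -> (forall i, size (h`_i)%R <= N)%N ->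
  ev2 X Y h =
    \sum_(i <- iota 0 N) \sum_(j <- iota 0 N) phi h`_i`_j * X ^+ i * Y ^+ j.
Proof.
move=> sh sc; rewrite -[in LHS](@coefK _ h) poly_def rmorph_sum /=.
have E : forall F : nat -> L, \sum_(i <- iota 0 N) F i = \sum_(i < N) F i.
  by move=> F; rewrite -[N in iota _ N]subn0 big_mkord.
rewrite E (big_ord_widen N (fun i => ev2 X Y (h`_i *: 'X^i)) sh) big_mkcond /=.
apply: eq_bigr => i _; rewrite E.
have -> : (if (i < size h)%N then ev2 X Y (h`_i *: 'X^i) else 0)
    = ev2 X Y (h`_i *: 'X^i).
  by case: ltnP => // le; rewrite nth_default // scale0r rmorph0.
rewrite -mul_polyC rmorphM rmorphXn ev2X ev2P ev1E.
rewrite (@horner_coef_wide _ N); last by rewrite size_map_poly.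
rewrite mulr_suml; apply: eq_bigr => j _; rewrite coef_map /=.
by rewrite -!mulrA [_ * X ^+ _]mulrC.
Qed.

Lemma bicoef_support h :
  exists N : nat, [/\ (size h <= N)%N, (forall i, size (h`_i)%R <= N)%N &
  forall m, bicoef h m != 0 ->
    m \in [seq (Posz i, Posz j) | i <- iota 0 N, j <- iota 0 N]].
Proof.
pose N := (size h + \max_(i < size h) size (h`_i)%R)%N; exists N.
have sc i : (size (h`_i)%R <= N)%N.
  case: (ltnP i (size h)) => li; last by rewrite nth_default // size_poly0.
  apply: leq_trans (leq_addl _ _).
  by apply: (@leq_bigmax_cond _ _ (fun i : 'I_(size h) => size (h`_i)%R) (Ordinal li)).
have sN : (size h <= N)%N by exact: leq_addr.
split => // -[[i|i] [j|j]] /=; rewrite ?eqxx // => nz.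
apply: allpairs_f; rewrite mem_iota /= add0n.
- apply: leq_trans sN; rewrite ltnNge; apply: contra nz => le.
  by rewrite (nth_default _ le) coef0.
- by apply: leq_trans (sc i); rewrite ltnNge; apply: contra nz => le; rewrite nth_default.
Qed.

Lemma uniq_square N :
  uniq [seq (Posz i, Posz j) | i <- iota 0 N, j <- iota 0 N].
Proof. by apply: allpairs_uniq; rewrite ?iota_uniq // => -[? ?] [? ?] _ _ [-> ->]. Qed.

(* Negative exponents only occur with a zero coefficient, so this also holds
   when [X] or [Y] vanishes. *)
Lemma ev2_support X Y h (s : seq (int * int)) : uniq s ->
  (forall m, bicoef h m != 0 -> m \in s) ->
  ev2 X Y h = \sum_(m <- s) phi (bicoef h m) * X ^ m.1 * Y ^ m.2.
Proof.
move=> us hs; have [N [sN sc hN]] := bicoef_support h.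
have nz m : phi (bicoef h m) * X ^ m.1 * Y ^ m.2 != 0 -> bicoef h m != 0.
  by apply: contraNneq => ->; rewrite rmorph0 !mul0r.
rewrite (ev2_coef _ _ sN sc) (@eq_big_support _ _ s _ _ us (uniq_square N)).
- by rewrite big_allpairs_dep.
- by move=> m /nz/hs.
- by move=> m /nz/hN.
Qed.

End Evaluation.
Arguments ev1 : simpl never.
Arguments ev2 : simpl never.

Lemma ev2_comp (K L L' : fieldType) (phi : {rmorphism K -> L})
  (psi : {rmorphism L -> L'}) (phi' : {rmorphism K -> L'}) X Y h :
  (forall c, psi (phi c) = phi' c) ->
  psi (ev2 phi X Y h) = ev2 phi' (psi X) (psi Y) h.
Proof.
move=> E; elim/bipoly_ind: h => [c|||a b Ha Hb|a b Ha Hb].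
- by rewrite !ev2C.
- by rewrite !ev2X.
- by rewrite !ev2Y.
- by rewrite !rmorphD Ha Hb.
- by rewrite !rmorphM Ha Hb.
Qed.

Lemma bicoef_inj (R : fieldType) (h h' : {poly {poly R}}) :
  (forall m, bicoef h m = bicoef h' m) -> h = h'.
Proof.
by move=> E; apply/polyP=> i; apply/polyP=> j; apply: (E (Posz i, Posz j)).
Qed.

Lemma bicoef0 (R : fieldType) m : bicoef (0 : {poly {poly R}}) m = 0.
Proof. by case: m => [[i|i] [j|j]] /=; rewrite ?coef0. Qed.

Lemma bicoef_nonneg (R : fieldType) (h : {poly {poly R}}) i j :
  bicoef h (i, j) != 0 -> 0 <= i /\ 0 <= j.
Proof. by case: i j => i [] j //=; rewrite eqxx. Qed.

(* The logarithmic derivatives [X d/dX] and [Y d/dY]. *)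
Definition logdX (R : nzRingType) (h : {poly {poly R}}) : {poly {poly R}} :=
  'X * h^`().
Definition logdY (R : nzRingType) (h : {poly {poly R}}) : {poly {poly R}} :=
  'X%:P * map_poly (@deriv R) h.

Lemma bicoef_logdX (R : fieldType) (h : {poly {poly R}}) m :
  bicoef (logdX h) m = m.1%:~R * bicoef h m.
Proof.
case: m => [[[|i]|i] [j|j]] /=; rewrite ?mulr0 // /logdX coefXM /= ?coef0 ?mul0r //.
by rewrite coef_deriv coefMn mulr_natl.
Qed.

Lemma bicoef_logdY (R : fieldType) (h : {poly {poly R}}) m :
  bicoef (logdY h) m = m.2%:~R * bicoef h m.
Proof.
case: m => [[i|i] [[|j]|j]] /=; rewrite ?mulr0 // /logdY coefCM coefXM /= ?mul0r //.
by rewrite coef_map_id0 ?linear0 // coef_deriv mulr_natl.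
Qed.

Lemma biX_ndvd (R : fieldType) (h : {poly {poly R}}) :
  (forall u, h <> 'X * u) <-> exists j : nat, bicoef h (0, Posz j) != 0.
Proof.
split => [H|[j nz] u E].
  apply: NNPP => N; apply: (H (\poly_(i < size h) h`_i.+1)); apply/polyP => i.
  rewrite coefXM coef_poly; case: i => [|i] /=.
    apply/polyP => j; rewrite coef0; apply/eqP; apply/negPn/negP => nz.
    by apply: N; exists j.
  by case: ltnP => // le; rewrite nth_default // ltnW.
by move: nz; rewrite E /= coefXM coef0 eqxx.
Qed.

Lemma biY_ndvd (R : fieldType) (h : {poly {poly R}}) :
  (forall u, h <> 'X%:P * u) <-> exists i : nat, bicoef h (Posz i, 0) != 0.
Proof.
split => [H|[j nz] u E]; last by move: nz; rewrite E /= coefCM coefXM /= eqxx.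
apply: NNPP => N; pose d (p : {poly R}) := \poly_(i < size p) p`_i.+1.
have d0 : d 0 = 0 by rewrite /d size_poly0; apply/polyP => i; rewrite coef_poly ltn0 coef0.
apply: (H (map_poly d h)); apply/polyP => i.
rewrite coefCM coef_map_id0 //; apply/polyP => j; rewrite coefXM coef_poly.
case: j => [|j] /=.
  by apply/eqP; apply/negPn/negP => nz; apply: N; exists i.
by case: ltnP => // le; rewrite nth_default // ltnW.
Qed.

Lemma seq_argmin (T : eqType) (f : T -> int) (s : seq T) (x0 : T) : x0 \in s ->
  exists2 m, m \in s & forall m', m' \in s -> f m <= f m'.
Proof.
elim: s x0 => // y s IH x0 _; case: s IH => [|z s] IH.
  by exists y; rewrite ?mem_head // => m'; rewrite inE => /eqP ->.
have [m ms hm] := IH z (mem_head _ _).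
have [le|/ltW le] := leP (f y) (f m).
  exists y; rewrite ?mem_head // => m'; rewrite inE => /orP[/eqP -> //|/hm].
  exact: le_trans.
exists m; first by rewrite in_cons ms orbT.
by move=> m'; rewrite inE => /orP[/eqP -> //|/hm //].
Qed.

Definition dot (b m : int * int) : int := b.1 * m.1 + b.2 * m.2.

Definition unimodular (d b : int * int) := d.1 * b.2 - d.2 * b.1 = 1.

(** The effect on exponents of x = X^d.1 Y^b.1, y = X^d.2 Y^b.2, followed by division by X^n.1
    Y^n.2. Edge substitutions and mere changes of origin of the exponents are both of this form. *)
Definition shear (d b n m : int * int) : int * int :=
  (dot d m - n.1, dot b m - n.2).

Lemma shear_surj d b n u : unimodular d b ->
  shear d b n (b.2 * (u.1 + n.1) - d.2 * (u.2 + n.2),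
               d.1 * (u.2 + n.2) - b.1 * (u.1 + n.1)) = u.
Proof.
case: u => u1 u2; rewrite /unimodular /shear /dot /= => E; congr (_, _).
  transitivity ((d.1 * b.2 - d.2 * b.1) * (u1 + n.1) - n.1); first by ring.
  by rewrite E; ring.
transitivity ((d.1 * b.2 - d.2 * b.1) * (u2 + n.2) - n.2); first by ring.
by rewrite E; ring.
Qed.

Lemma shear_inj d b n : unimodular d b -> injective (shear d b n).
Proof.
move=> E; apply: (can_inj (g := fun u => (b.2 * (u.1 + n.1) - d.2 * (u.2 + n.2),
               d.1 * (u.2 + n.2) - b.1 * (u.1 + n.1)))) => -[m1 m2].
rewrite /shear /dot /=; move: E; rewrite /unimodular => E; congr (_, _).
  transitivity ((d.1 * b.2 - d.2 * b.1) * m1); first by ring.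
  by rewrite E mul1r.
transitivity ((d.1 * b.2 - d.2 * b.1) * m2); first by ring.
by rewrite E mul1r.
Qed.

(** Only a coefficient function [e] is compared with [h], so that the same computation serves
    Laurent polynomials, ordinary polynomials and combinations of their derivatives. *)
Lemma shear_sum (K L : fieldType) (phi : {rmorphism K -> L}) d b n
    (e : int * int -> K) (s : seq (int * int)) (h : {poly {poly K}}) (X Y : L) :
  unimodular d b -> X != 0 -> Y != 0 -> uniq s ->
  (forall m, e m != 0 -> m \in s) ->
  (forall m, e m = bicoef h (shear d b n m)) ->
  X ^ n.1 * Y ^ n.2 * ev2 phi X Y h =
    \sum_(m <- s) phi (e m) * (X ^ d.1 * Y ^ b.1) ^ m.1 * (X ^ d.2 * Y ^ b.2) ^ m.2.
Proof.
move=> uni X0 Y0 us hs E.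
rewrite (@ev2_support _ _ phi X Y h (map (shear d b n) s)); first last.
- move=> m nz; rewrite -(shear_surj n m uni); apply: map_f; apply: hs.
  by rewrite E shear_surj.
- by rewrite map_inj_uniq //; apply: shear_inj.
rewrite big_map mulr_sumr; apply: eq_bigr => m _.
rewrite -E /shear /dot /= !expfzDr // -!invr_expz !expfzMl !exprz_exp.
have := expfz_neq0 n.1 X0; have := expfz_neq0 n.2 Y0.
move: (X ^ n.1) (Y ^ n.2) => u v v0 u0; field; by rewrite u0 v0.
Qed.

(** Two candidates differ by a translation of exponents. Not being divisible by X or Y means that
    the support, which lies in the quadrant, touches both axes; this leaves only the trivial
    translation. *)
Lemma edge_poly_unique (K : fieldType) delta beta c (h h' : {poly {poly K}}) :
  unimodular (delta beta) beta ->
  edge_poly delta beta c h -> edge_poly delta beta c h' -> h = h'.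
Proof.
move=> uni [/biX_ndvd[j hj] /biY_ndvd[i hi] [nX [nY E]]].
move=> [/biX_ndvd[j' hj'] /biY_ndvd[i' hi'] [nX' [nY' E']]].
have S u : bicoef h u = bicoef h' (u.1 + (nX - nX'), u.2 + (nY - nY')).
  have [m Em] : exists m, shear (delta beta) beta (nX, nY) m = u.
    by eexists; apply: (shear_surj (nX, nY) u uni).
  move: (E m.1 m.2); rewrite E' -[(_ - nX, _)]/(shear (delta beta) beta (nX, nY) m) Em.
  move=> <-; congr (bicoef _ (_, _)); rewrite -Em /shear /dot /=; ring.
have Si u : bicoef h' u = bicoef h (u.1 - (nX - nX'), u.2 - (nY - nY')).
  by case: u => a b; rewrite S /= !subrK.
have e1 : nX - nX' = 0.
  have := hj'; rewrite Si => /bicoef_nonneg[] /=; have := hj; rewrite S => /bicoef_nonneg[] /=.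
  lia.
have e2 : nY - nY' = 0.
  have := hi'; rewrite Si => /bicoef_nonneg[] /=; have := hi; rewrite S => /bicoef_nonneg[] /=.
  lia.
by apply: bicoef_inj => -[a b]; rewrite S e1 e2 /= !addr0.
Qed.

Definition monom2 (R : nzRingType) (c : R) (i j : nat) : {poly {poly R}} :=
  (c *: 'X^j) *: 'X^i.

Lemma bicoef_monom2 (K : fieldType) (c : K) i j u :
  bicoef (monom2 c i j) u = if u == (Posz i, Posz j) then c else 0.
Proof.
case: u => [[a|a] [b|b]] //=; last by rewrite xpair_eqE andbF.
rewrite /monom2 coefZ coefXn.
rewrite xpair_eqE; change (Posz a == Posz i) with (a == i).
change (Posz b == Posz j) with (b == j).
case: (a == i); rewrite ?mulr0 ?coef0 //= mulr1 coefZ coefXn.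
by case: (b == j); rewrite ?mulr1 ?mulr0.
Qed.

Lemma bicoef_sum (K : fieldType) (I : Type) (r : seq I) (F : I -> {poly {poly K}}) u :
  bicoef (\sum_(i <- r) F i) u = \sum_(i <- r) bicoef (F i) u.
Proof.
by case: u => [[a|a] [b|b]] /=; [rewrite !coef_sum | rewrite big1 ..].
Qed.

Lemma edge_poly_exists (K : fieldType) (delta : int * int -> int * int) beta
    (c : int * int -> K) (s : seq (int * int)) (m0 : int * int) :
  unimodular (delta beta) beta -> (forall m, c m != 0 -> m \in s) ->
  c m0 != 0 -> exists h, edge_poly delta beta c h.
Proof.
move=> uni; wlog: s / uniq s /\ forall m, m \in s -> c m != 0.
  move=> W hs; apply: (W (undup [seq m <- s | c m != 0])).
    split; first exact: undup_uniq.
    by move=> m; rewrite mem_undup mem_filter => /andP[].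
  by move=> m cm; rewrite mem_undup mem_filter cm hs.
move=> [us sc] hs c0; have s0 := hs _ c0.
set d := delta beta.
have [m1 m1s h1] := seq_argmin (dot d) s0.
have [m2 m2s h2] := seq_argmin (dot beta) s0.
(* The removed exponents are the minima of the two linear forms on the support: smaller ones would
   leave a factor X or Y, larger ones a negative exponent. *)
pose n := (dot d m1, dot beta m2); pose T := shear d beta n.
have absT m : m \in s -> (Posz `|(T m).1|%N, Posz `|(T m).2|%N) = T m.
  move=> ms; have := h1 _ ms; have := h2 _ ms; rewrite /T /shear /=.
  by move=> a b; rewrite !gez0_abs ?subr_ge0.
pose h := \sum_(m <- s) monom2 (c m) `|(T m).1|%N `|(T m).2|%N.
have E m : c m = bicoef h (T m).
  rewrite bicoef_sum.
  under eq_big_seq => m' ms' do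
    rewrite bicoef_monom2 absT // (inj_eq (@shear_inj d beta n uni)).
  have [ms|nms] := boolP (m \in s).
    rewrite (bigD1_seq m) //= eqxx big1 ?addr0 // => m' /negbTE.
    by rewrite eq_sym => ->.
  rewrite big_seq big1; first by apply/eqP/negPn; apply: contra nms; apply: hs.
  by move=> m' ms'; case: eqP => // e; rewrite e ms' in nms.
exists h; split.
- apply/biX_ndvd; exists `|(T m1).2|%N.
  have <- : T m1 = (0, Posz `|(T m1).2|%N); last by rewrite -E sc.
  by rewrite -[LHS]absT //; congr (Posz _, _); rewrite /T /shear /= subrr.
- apply/biY_ndvd; exists `|(T m2).1|%N.
  have <- : T m2 = (Posz `|(T m2).1|%N, 0); last by rewrite -E sc.
  by rewrite -[LHS]absT //; congr (_, Posz _); rewrite /T /shear /= subrr.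
- by exists n.1, n.2 => i j; rewrite (E (i, j)).
Qed.

(** An affine form that is nonnegative on the support vanishes at a convex combination only if it
    vanishes at every point of positive weight. Two distinct points of the polygon on the edge
    therefore yield two distinct support points on it, and rational points can be dispensed with. *)
Lemma edge_normalP (K : fieldType) (c : int * int -> K) (b : int * int) :
  edge_normal (newton_polygon c) b <->
  coprimez b.1 b.2 /\ exists m1 m2, [/\ m1 != m2, c m1 != 0, c m2 != 0,
    dot b m1 = dot b m2 & forall m, c m != 0 -> dot b m1 <= dot b m].
Proof.
pose pt (m : int * int) : rat * rat := (m.1%:~R, m.2%:~R).
have vertex m : c m != 0 -> newton_polygon c (pt m).
  move=> cm; exists 1%N, (fun=> m), (fun=> 1); split=> //.
  - by rewrite big_ord1.
  - by rewrite !big_ord1 !mul1r.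
have affE c0 m : b.1%:~R * (pt m).1 + b.2%:~R * (pt m).2 + c0%:~R =
    (dot b m + c0)%:~R :> rat by rewrite /dot /= !rmorphD !rmorphM.
have affsum c0 n (s : 'I_n -> int * int) (w : 'I_n -> rat) : \sum_i w i = 1 ->
    b.1%:~R * (\sum_i w i * (s i).1%:~R) + b.2%:~R * (\sum_i w i * (s i).2%:~R)
    + c0%:~R = \sum_i w i * (dot b (s i) + c0)%:~R.
  move=> w1; have -> : c0%:~R = \sum_i w i * c0%:~R by rewrite -mulr_suml w1 mul1r.
  rewrite !mulr_sumr -!big_split /=.
  by apply: eq_bigr => i _;  rewrite /dot !intrD !intrM; ring.
split=> [[cop [c0 [pos [z1 [z2 [z12 D1 D2 a1 a2]]]]]]|[cop [m1 [m2 [m12 c1 c2 e hm]]]]];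
  split=> //.
  have pos' m : c m != 0 -> 0 <= dot b m + c0.
    by move=> /vertex/pos; rewrite affE ler0z.
  pose supp0 m := c m != 0 /\ dot b m + c0 = 0.
  have inz z : newton_polygon c z ->
      b.1%:~R * z.1 + b.2%:~R * z.2 + c0%:~R = 0 ->
      (exists m, supp0 m) /\
      forall m0, (forall m, supp0 m -> m = m0) -> z = pt m0.
    move=> [n [s [w [cs w0 w1 ->]]]] /=; rewrite affsum //.
    move=> /eqP; rewrite psumr_eq0; last first.
      by move=> i _; rewrite mulr_ge0 // ler0z pos'.
    move=> /allP H.
    have sup i : w i != 0 -> supp0 (s i).
      move=> wi; split=> //; have := H i (mem_index_enum i).
      by rewrite mulf_eq0 (negbTE wi) /= intr_eq0 => /eqP.
    split.
      apply: NNPP => N; have /eqP := w1; rewrite big1 ?[0 == _]eq_sym ?oner_eq0 //.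
      by move=> i _; apply/eqP/negPn/negP => /sup ?; apply: N; exists (s i).
    move=> m0 hm0; rewrite /pt; congr (_, _).
      transitivity (\sum_i w i * m0.1%:~R); last by rewrite -mulr_suml w1 mul1r.
      apply: eq_bigr => i _; case: (eqVneq (w i) 0) => [->|/sup/hm0 -> //].
      by rewrite !mul0r.
    transitivity (\sum_i w i * m0.2%:~R); last by rewrite -mulr_suml w1 mul1r.
    apply: eq_bigr => i _; case: (eqVneq (w i) 0) => [->|/sup/hm0 -> //].
    by rewrite !mul0r.
  have [[m1 s1] u1] := inz _ D1 a1; have [_ u2] := inz _ D2 a2.
  have [m2 [s2 ne]] : exists m2, supp0 m2 /\ m2 <> m1.
    apply: NNPP => N; have uq m : supp0 m -> m = m1.
      by move=> sm; apply: NNPP => ne; apply: N; exists m.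
    by move: z12; rewrite (u1 _ uq) (u2 _ uq) eqxx.
  exists m1, m2; case: s1 => n1 e1; case: s2 => n2 e2; split=> //.
  - by rewrite eq_sym; apply/eqP.
  - by apply: (addIr c0); rewrite e1 e2.
  - by move=> m /pos'; rewrite -e1 lerD2r.
exists (- dot b m1) => aff; split.
  move=> z [n [s [w [cs w0 w1 ->]]]]; rewrite /aff /= affsum //.
  by apply: sumr_ge0 => i _; rewrite mulr_ge0 // ler0z subr_ge0 hm.
exists (pt m1), (pt m2); split; try exact: vertex.
- apply: contra m12 => /eqP[/eqP + /eqP]; rewrite !eqr_int => /eqP E1 /eqP E2.
  by rewrite [m1]surjective_pairing [m2]surjective_pairing E1 E2.
- by rewrite /aff affE subrr.
- by rewrite /aff affE -e subrr.
Qed.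

Section Laurent.
Variables (K L : fieldType) (phi : {rmorphism K -> L}).

Lemma finsupp_lmap (f : laurent K) : finsupp (lmap phi f) = finsupp f.
Proof.
by apply/fsetP => m; rewrite !mem_finsupp lmapE fmorph_eq0.
Qed.

Lemma leval_lmap (f : laurent K) p : leval (lmap phi f) p =
  \sum_(m <- finsupp f) phi (f m) * p.1 ^ m.1 * p.2 ^ m.2.
Proof. by rewrite /leval finsupp_lmap; apply: eq_bigr => m _; rewrite lmapE. Qed.

(* With [d = (1, 0)] and [b = (0, 1)] the substitution is the identity. *)
Lemma laurent_shift (f : laurent K) n (h : {poly {poly K}}) (x y : L) :
  x != 0 -> y != 0 ->
  (forall m, f m = bicoef h (shear (1, 0) (0, 1) n m)) ->
  leval (lmap phi f) (x, y) = x ^ n.1 * y ^ n.2 * ev2 phi x y h.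
Proof.
move=> x0 y0 E; rewrite (@shear_sum _ _ phi (1, 0) (0, 1) n f (finsupp f)) //.
- rewrite leval_lmap; apply: eq_bigr => m _ /=.
  by rewrite !expr1z !expr0z mulr1 mul1r.
- by rewrite fset_uniq.
- by move=> m; rewrite mem_finsupp.
Qed.

(** The Laurent polynomial is chosen before the field, so that one choice can be evaluated both at
    points over K and at the generic point over F. *)
Lemma bipoly_laurent (h : {poly {poly K}}) :
  exists g : laurent K, forall (L' : fieldType) (psi : {rmorphism K -> L'}) x y,
    leval (lmap psi g) (x, y) = ev2 psi x y h.
Proof.
have [N [_ _]] := bicoef_support h.
set s := [seq (Posz i, Posz j) | i <- iota 0 N, j <- iota 0 N] => hN.
exists [fsfun m in seq_fset tt s => bicoef h m | 0] => L' psi x y.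
have E m : [fsfun m in seq_fset tt s => bicoef h m | 0] m = bicoef h m.
  rewrite fsfunE seq_fsetE; case: ifP => // /negbT ns; apply/esym/eqP/negPn.
  by apply: contra ns => /hN.
rewrite /leval (@ev2_support _ _ psi x y h s (uniq_square N) hN).
rewrite [RHS](@eq_big_support _ _ s (finsupp (lmap psi
  [fsfun m in seq_fset tt s => bicoef h m | 0]))) ?uniq_square ?fset_uniq //.
- by apply: eq_bigr => m _; rewrite lmapE E.
- by move=> m nz; apply: hN; apply: contra nz => /eqP ->; rewrite rmorph0 !mul0r.
- move=> m nz; rewrite mem_finsupp lmapE E; apply: contra nz => /eqP ->.
  by rewrite !mul0r.
Qed.

End Laurent.

Lemma lmap_id (K : fieldType) (f : laurent K) : lmap idfun f = f.
Proof. by apply/fsfunP => m; rewrite lmapE. Qed.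

Section EdgeEvaluation.
Variables (K L : fieldType) (phi : {rmorphism K -> L}).
Variables (d b n : int * int) (h h' : {poly {poly K}}) (X Y : L).
Hypotheses (uni : unimodular d b) (X0 : X != 0) (Y0 : Y != 0).
Hypothesis hh' : forall m, bicoef h m = bicoef h' (shear d b n m).

Let x := X ^ d.1 * Y ^ b.1.
Let y := X ^ d.2 * Y ^ b.2.

Let sum_ev g : (forall m, bicoef h m = 0 -> bicoef g m = 0) ->
  exists s, [/\ uniq s, forall m, bicoef h m != 0 -> m \in s &
    ev2 phi x y g = \sum_(m <- s) phi (bicoef g m) * x ^ m.1 * y ^ m.2].
Proof.
move=> hg; have [N [_ _ hN]] := bicoef_support h.
eexists; split; [exact: uniq_square N|exact: hN|].
apply: ev2_support; first exact: uniq_square.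
by move=> m nz; apply: hN; apply: contra nz => /eqP/hg ->.
Qed.

Lemma edge_ev2 : ev2 phi x y h = X ^ n.1 * Y ^ n.2 * ev2 phi X Y h'.
Proof.
have [|s [us hs ->]] := @sum_ev h => //.
by rewrite (@shear_sum _ _ phi d b n (bicoef h) s).
Qed.

(** Logarithmic derivatives multiply a coefficient by its exponent, and [shear] is affine in the
    exponent. Those of [h'] thus correspond to integral combinations of those of [h], minus a
    multiple of [h] for the removed monomial; the last term disappears where [h] vanishes. *)
Let comb u v w := u%:~R%:P%:P * logdX h + v%:~R%:P%:P * logdY h - w%:~R%:P%:P * h.

Let bicoefD (g g' : {poly {poly K}}) m : bicoef (g + g') m = bicoef g m + bicoef g' m.
Proof. by case: m => [[i|i] [j|j]] /=; rewrite ?coefD ?addr0. Qed.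

Let bicoefN (g : {poly {poly K}}) m : bicoef (- g) m = - bicoef g m.
Proof. by case: m => [[i|i] [j|j]] /=; rewrite ?coefN ?oppr0. Qed.

Let bicoefZ c (g : {poly {poly K}}) m : bicoef (c%:P%:P * g) m = c * bicoef g m.
Proof. by case: m => [[i|i] [j|j]] /=; rewrite ?coefCM ?mulr0. Qed.

Let bicoef_comb u v w m :
  bicoef (comb u v w) m = (u * m.1 + v * m.2 - w)%:~R * bicoef h m.
Proof.
rewrite /comb !(bicoefD, bicoefN, bicoefZ) bicoef_logdX bicoef_logdY.
by rewrite !rmorphB !rmorphD !rmorphM /=; ring.
Qed.

Let ev2_comb u v w : ev2 phi x y h = 0 ->
  ev2 phi x y (comb u v w) =
    u%:~R * ev2 phi x y (logdX h) + v%:~R * ev2 phi x y (logdY h).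
Proof.
move=> h0; rewrite /comb rmorphB rmorphD !rmorphM h0 mulr0 subr0 !ev2C.
by rewrite !rmorph_int.
Qed.

Lemma edge_logdX : ev2 phi x y h = 0 ->
  X ^ n.1 * Y ^ n.2 * ev2 phi X Y (logdX h') =
    d.1%:~R * ev2 phi x y (logdX h) + d.2%:~R * ev2 phi x y (logdY h).
Proof.
move=> h0; rewrite -(ev2_comb _ _ n.1 h0).
have [m e|s [us hs ->]] := @sum_ev (comb d.1 d.2 n.1).
  by rewrite bicoef_comb e mulr0.
rewrite (@shear_sum _ _ phi d b n (bicoef (comb d.1 d.2 n.1)) s) //.
- by move=> m; rewrite bicoef_comb => nz; apply: hs; apply: contra nz => /eqP ->; rewrite mulr0.
- by move=> m; rewrite bicoef_comb bicoef_logdX -hh'.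
Qed.

Lemma edge_logdY : ev2 phi x y h = 0 ->
  X ^ n.1 * Y ^ n.2 * ev2 phi X Y (logdY h') =
    b.1%:~R * ev2 phi x y (logdX h) + b.2%:~R * ev2 phi x y (logdY h).
Proof.
move=> h0; rewrite -(ev2_comb _ _ n.2 h0).
have [m e|s [us hs ->]] := @sum_ev (comb b.1 b.2 n.2).
  by rewrite bicoef_comb e mulr0.
rewrite (@shear_sum _ _ phi d b n (bicoef (comb b.1 b.2 n.2)) s) //.
- by move=> m; rewrite bicoef_comb => nz; apply: hs; apply: contra nz => /eqP ->; rewrite mulr0.
- by move=> m; rewrite bicoef_comb bicoef_logdY -hh'.
Qed.

End EdgeEvaluation.

(** * Discrete places *)

(* A subring of [F] together with a homomorphism to [K] whose nonzero values
   are taken at units, given by the graph of the homomorphism. *)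
Record place (K F : fieldType) (phi : {rmorphism K -> F}) (P : F -> K -> Prop)
    : Prop := Place {
  place_uniq : forall s c c', P s c -> P s c' -> c = c';
  placeC : forall c, P (phi c) c;
  placeD : forall s s' c c', P s c -> P s' c' -> P (s + s') (c + c');
  placeM : forall s s' c c', P s c -> P s' c' -> P (s * s') (c * c');
  placeV : forall s c, c != 0 -> P s c -> P s^-1 c^-1 }.

Section Place.
Variables (K F : fieldType) (phi : {rmorphism K -> F}) (P : F -> K -> Prop).
Hypothesis pl : place phi P.

Lemma place0 : P 0 0. Proof. by rewrite -{1}(rmorph0 phi); apply: (placeC pl). Qed.

Lemma place1 : P 1 1. Proof. by rewrite -{1}(rmorph1 phi); apply: (placeC pl). Qed.

Lemma place_neq0 s c : c != 0 -> P s c -> s != 0.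
Proof.
move=> c0 Ps; apply: contra c0 => /eqP s0; rewrite s0 in Ps.
by apply/eqP/(place_uniq pl Ps place0).
Qed.

Lemma placeN s c : P s c -> P (- s) (- c).
Proof.
move=> h; rewrite -mulN1r -[- c]mulN1r; apply: (placeM pl) h.
by have := placeC pl (-1); rewrite rmorphN1.
Qed.

Lemma placeB s s' c c' : P s c -> P s' c' -> P (s - s') (c - c').
Proof. by move=> h /placeN; apply: (placeD pl). Qed.

Lemma placeX s c n : P s c -> P (s ^+ n) (c ^+ n).
Proof.
move=> h; elim: n => [|n IH]; first by rewrite !expr0; apply: place1.
by rewrite !exprS; apply: (placeM pl).
Qed.

Lemma placeXz s c (n : int) : c != 0 -> P s c -> P (s ^ n) (c ^ n).
Proof.
move=> c0 h; case: n => n; first exact: placeX.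
by rewrite !NegzE -!invr_expz; apply: (placeV pl); [rewrite expf_neq0|apply: placeX].
Qed.

Lemma place_sum (I : Type) (r : seq I) (G : I -> F) (H : I -> K) :
  (forall i, P (G i) (H i)) -> P (\sum_(i <- r) G i) (\sum_(i <- r) H i).
Proof.
move=> h; elim: r => [|i r IH]; first by rewrite !big_nil; apply: place0.
by rewrite !big_cons; apply: (placeD pl).
Qed.

Lemma place_prod (I : Type) (r : seq I) (G : I -> F) (H : I -> K) :
  (forall i, P (G i) (H i)) -> P (\prod_(i <- r) G i) (\prod_(i <- r) H i).
Proof.
move=> h; elim: r => [|i r IH]; first by rewrite !big_nil; apply: place1.
by rewrite !big_cons; apply: (placeM pl).
Qed.

Lemma place_ev2 X Y r s h :
  P X r -> P Y s -> P (ev2 phi X Y h) (ev2 idfun r s h).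
Proof.
move=> HX HY; elim/bipoly_ind: h => [c|||a b Ha Hb|a b Ha Hb].
- by rewrite !ev2C; apply: (placeC pl).
- by rewrite !ev2X.
- by rewrite !ev2Y.
- by rewrite !rmorphD; apply: (placeD pl).
- by rewrite !rmorphM; apply: (placeM pl).
Qed.

Lemma place_mmap n (z : 'I_n -> F) (q : 'I_n -> K) p :
  (forall i, P (z i) (q i)) -> P (mmap phi z p) p.@[q].
Proof.
move=> h; rewrite mevalE /mmap; apply: place_sum => m.
apply: (placeM pl); first exact: (placeC pl).
by apply: place_prod => i; apply: placeX.
Qed.

Lemma place_leval (f : laurent K) x y r s : r != 0 -> s != 0 ->
  P x r -> P y s -> P (leval (lmap phi f) (x, y)) (leval f (r, s)).
Proof.
move=> r0 s0 hx hy; rewrite leval_lmap /leval; apply: place_sum => m /=.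
apply: (placeM pl); last exact: placeXz.
by apply: (placeM pl); [apply: (placeC pl)|apply: placeXz].
Qed.

Definition discrete (t : F) : Prop :=
  [/\ t != 0, P t 0 & forall s, s != 0 ->
    exists n : int, exists2 c, c != 0 & P (s * t ^ (- n)) c].

(** Valuation at least n, respectively exactly n, for the uniformizer [t]. As relations they need no
    convention at 0, where the first holds for all n and the second for none. *)
Definition vge t (n : int) s : Prop := exists c, P (s * t ^ (- n)) c.
Definition vex t (n : int) s : Prop := exists2 c, c != 0 & P (s * t ^ (- n)) c.

Section Valuation.
Variable t : F.
Hypothesis dv : discrete t.

Let t0 : t != 0. Proof. by case: dv. Qed.
Let Pt : P t 0. Proof. by case: dv. Qed.

Lemma vexP s : s != 0 -> exists n, vex t n s.
Proof. by case: dv => _ _; apply. Qed.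

Lemma vex_vge n s : vex t n s -> vge t n s.
Proof. by case=> c _ h; exists c. Qed.

Lemma vge0 n : vge t n 0.
Proof. by exists 0; rewrite mul0r; apply: place0. Qed.

Lemma vge_place s c : P s c -> vge t 0 s.
Proof. by exists c; rewrite expr0z mulr1. Qed.

Lemma vge_placeW s : vge t 0 s -> exists c, P s c.
Proof. by case=> c; rewrite expr0z mulr1; exists c. Qed.

Lemma vgeD n s s' : vge t n s -> vge t n s' -> vge t n (s + s').
Proof.
by case=> c h [c' h']; exists (c + c'); rewrite mulrDl; apply: (placeD pl).
Qed.

Lemma expz_split (n m : int) : t ^ (- (n + m)) = t ^ (- n) * t ^ (- m).
Proof. by rewrite opprD expfzDr. Qed.

Lemma vgeM n m s s' : vge t n s -> vge t m s' -> vge t (n + m) (s * s').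
Proof.
case=> c h [c' h']; exists (c * c'); rewrite expz_split mulrACA.
exact: (placeM pl).
Qed.

Lemma vexM n m s s' : vex t n s -> vex t m s' -> vex t (n + m) (s * s').
Proof.
case=> c c0 h [c' c'0 h']; exists (c * c'); first by rewrite mulf_neq0.
by rewrite expz_split mulrACA; apply: (placeM pl).
Qed.

Lemma vexV n s : vex t n s -> vex t (- n) s^-1.
Proof.
case=> c c0 h; exists c^-1; first by rewrite invr_eq0.
by rewrite -invr_expz -invfM; apply: (placeV pl).
Qed.

Lemma vex1 : vex t 0 1.
Proof. by exists 1; rewrite ?oner_eq0 // mul1r oppr0 expr0z; apply: place1. Qed.

Lemma vexX n s (k : nat) : vex t n s -> vex t (n * k) (s ^+ k).
Proof.
move=> h; elim: k => [|k IH]; first by rewrite mulr0 expr0; apply: vex1.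
by rewrite exprS -addn1 PoszD mulrDr mulr1 addrC; apply: vexM.
Qed.

Lemma vexXz n s (k : int) : vex t n s -> vex t (n * k) (s ^ k).
Proof.
move=> h; case: k => k; first exact: vexX.
by rewrite NegzE mulrN -invr_expz; apply: vexV; apply: vexX.
Qed.

Lemma vex_neq0 n s : vex t n s -> s != 0.
Proof.
by case=> c c0 /(place_neq0 c0); rewrite mulf_eq0 negb_or => /andP[].
Qed.

Lemma vex_unit s c : c != 0 -> P s c -> vex t 0 s.
Proof. by move=> c0 h; exists c => //; rewrite oppr0 expr0z mulr1. Qed.

Lemma vexC c : c != 0 -> vex t 0 (phi c).
Proof. by move=> c0; apply: vex_unit c0 _; apply: (placeC pl). Qed.

Lemma vge_le m n s : m <= n -> vge t n s -> vge t m s.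
Proof.
rewrite -subr_ge0 => le [c h]; exists (c * 0 ^+ `|n - m|%N).
have -> : t ^ (- m) = t ^ (- n) * t ^+ `|n - m|%N.
  by rewrite exprnP gez0_abs // -expfzDr //; congr (_ ^ _); lia.
by rewrite mulrA; apply: (placeM pl) h _; apply: placeX.
Qed.

Lemma vge_place0 n s : 0 < n -> vge t n s -> P s 0.
Proof.
case: n => [[|n]|n] // _ [c h].
have -> : s = s * t ^ (- Posz n.+1) * t ^+ n.+1.
  by rewrite -mulrA -(invr_expz t n.+1) mulVf ?mulr1 ?expf_neq0.
rewrite -(mulr0 c); apply: (placeM pl) h _.
by have := placeX n.+1 Pt; rewrite expr0n.
Qed.

Lemma vge_pos s : P s 0 -> vge t 1 s.
Proof.
move=> h; have [->|s0] := eqVneq s 0; first exact: vge0.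
have [n sn] := vexP s0; case: (ltP 0 n) => [lt|le].
  by apply: vge_le (vex_vge sn); rewrite -gtz0_ge1.
have /vge_placeW[c hc] : vge t 0 s^-1.
  by apply: vge_le (vex_vge (vexV sn)); rewrite oppr_ge0.
have := placeM pl h hc; rewrite mulfV // mul0r => /(place_uniq pl place1)/eqP.
by rewrite oner_eq0.
Qed.

Lemma vge_div n m s s' : vex t n s -> vge t m (s * s') -> vge t (m - n) s'.
Proof.
move=> sn h; have s0 := vex_neq0 sn.
by rewrite -(mulKf s0 s') addrC; apply: vgeM h; apply/vex_vge/vexV.
Qed.

Lemma vex_le n m s : vex t n s -> vge t m s -> m <= n.
Proof.
move=> sn; rewrite -[s in vge _ _ s]mulr1 => /(vge_div sn) h; rewrite leNgt.
apply/negP => lt; have h0 : P 1 0 by apply: (@vge_place0 (m - n)); rewrite ?subr_gt0.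
by have /eqP := place_uniq pl place1 h0; rewrite oner_eq0.
Qed.

Lemma vex_uniq n m s : vex t n s -> vex t m s -> n = m.
Proof.
move=> hn hm; apply/eqP; rewrite eq_le.
by rewrite (vex_le hm (vex_vge hn)) (vex_le hn (vex_vge hm)).
Qed.

Lemma vge_vex n s : s != 0 -> vge t n s -> exists2 m, n <= m & vex t m s.
Proof. by move=> /vexP[m hm] /(vex_le hm) le; exists m. Qed.

Lemma vex0_unit s : vex t 0 s -> exists2 c, c != 0 & P s c.
Proof. by case=> c c0; rewrite oppr0 expr0z mulr1; exists c. Qed.

Lemma place_valuation s : (exists c, P s c) \/ P s^-1 0.
Proof.
have [->|s0] := eqVneq s 0; first by left; exists 0; apply: place0.
have [n sn] := vexP s0; case: (leP 0 n) => [le|lt].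
  by left; apply: vge_placeW; apply: vge_le (vex_vge sn).
by right; apply: vge_place0 (vex_vge (vexV sn)); rewrite oppr_gt0.
Qed.

End Valuation.
End Place.

(** * Local rings of points as discrete valuation rings *)

Section LocalRing.
Variables (A : comNzRingType) (K F : fieldType) (phi : {rmorphism K -> F}).
Variables (cst : {rmorphism K -> A}) (psi : {rmorphism A -> F}).
Variable ev : {rmorphism A -> K}.
Hypothesis psi_cst : forall c, psi (cst c) = phi c.
Hypothesis ev_cst : forall c, ev (cst c) = c.
Hypothesis well_defined : forall a, psi a = 0 -> ev a = 0.

(** In the applications [A] is a polynomial ring, mapped to F by a generic point and to K by a point
    of the curve. The map to F is not injective, which is why fractions and their values are given
    by cross-multiplied equations. *)
Definition localization s c : Prop :=
  exists a b, [/\ ev b != 0, s * psi b = psi a & c * ev b = ev a].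

Let psi_neq0 b : ev b != 0 -> psi b != 0.
Proof. by apply: contra => /eqP/well_defined ->. Qed.

Lemma localization_ev a : localization (psi a) (ev a).
Proof. by exists a, 1; rewrite !rmorph1 !mulr1 oner_eq0. Qed.

Lemma localization_place : place phi localization.
Proof.
split.
- move=> s c c' [a [b [b0 e1 e2]]] [a' [b' [b'0 e1' e2']]].
  have /well_defined/eqP : psi (a * b' - a' * b) = 0.
    by rewrite rmorphB !rmorphM -e1 -e1' /=; ring.
  rewrite rmorphB !rmorphM -e2 -e2' subr_eq0 => /eqP e.
  apply: (mulIf b0); apply: (mulIf b'0); rewrite e; ring.
- by move=> c; rewrite -psi_cst -[c in localization _ c]ev_cst; apply: localization_ev.
- move=> s s' c c' [a [b [b0 e1 e2]]] [a' [b' [b'0 e1' e2']]].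
  exists (a * b' + a' * b), (b * b'); rewrite !rmorphD !rmorphM mulf_neq0 //.
  by split=> //; rewrite -?e1 -?e1' -?e2 -?e2' /=; ring.
- move=> s s' c c' [a [b [b0 e1 e2]]] [a' [b' [b'0 e1' e2']]].
  exists (a * a'), (b * b'); rewrite !rmorphM mulf_neq0 //.
  by split=> //; rewrite -?e1 -?e1' -?e2 -?e2' /=; ring.
- move=> s c c0 [a [b [b0 e1 e2]]]; exists b, a; split.
  + by rewrite -e2 mulf_neq0.
  + rewrite -e1 mulrA mulVf ?mul1r //.
    have : psi a != 0 by apply: psi_neq0; rewrite -e2 mulf_neq0.
    by rewrite -e1 mulf_eq0 negb_or => /andP[].
  + by rewrite -e2 mulrA mulVf ?mul1r.
Qed.

Hypothesis fractions : forall s, exists a b, psi b != 0 /\ s * psi b = psi a.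
Hypothesis dependent : forall s t : F, exists2 Q, Q != 0 & ev2 phi s t Q = 0.
Variable tau : A.
Hypothesis tau0 : psi tau != 0.
Hypothesis ev_tau : ev tau = 0.
Hypothesis principal : forall a, ev a = 0 ->
  exists s c, localization s c /\ psi a = psi tau * s.

Let pl := localization_place.

Lemma factor_X (R : nzRingType) (p : {poly R}) : p != 0 ->
  exists k q, p = q * 'X^k /\ q`_0 != 0.
Proof.
elim/poly_ind: p => [|p c IH]; first by rewrite eqxx.
have [-> |c0 _] := eqVneq c 0.
  rewrite addr0 => nz; have [|k [q [-> q0]]] := IH.
    by apply: contra nz => /eqP ->; rewrite mul0r.
  by exists k.+1, q; rewrite exprSr mulrA.
by exists 0%N, (p * 'X + c%:P); rewrite mulr1 coefD coefMX coefC /= add0r.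
Qed.

(* If [psi a] were divisible by every power of [psi tau], then so would be a
   nonzero polynomial in [psi tau], by an algebraic relation between the two. *)
Lemma localization_order a : psi a != 0 ->
  exists n : nat, exists s, exists2 c, c != 0 &
    localization s c /\ psi a = psi tau ^+ n * s.
Proof.
move=> a0; apply: NNPP => N.
have divisible n : exists s c, localization s c /\ psi a = psi tau ^+ n * s.
  elim: n => [|n [s [c [hs e]]]].
    by exists (psi a), (ev a); rewrite mul1r; split=> //; apply: localization_ev.
  have c0 : c = 0.
    apply/eqP/negPn/negP => c0; apply: N; exists n, s; exists c => //.
  case: hs => a' [b [b0 e1]]; rewrite c0 mul0r => /esym/principal[s' [c' [hs' e']]].
  exists (s' / psi b), (c' / ev b); split.
    apply: (placeM pl) hs' _; apply: (placeV pl) b0 _; exact: localization_ev.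
  rewrite e exprSr -!mulrA; congr (_ * _); rewrite mulrA -e' -e1.
  by rewrite mulfK // psi_neq0.
have [Q Q0 eQ] := dependent (psi a) (psi tau).
(* Powers of the first variable are removed from the relation, so that its constant term is Y^e
   c1(Y) with c1(0) nonzero. Since [psi a] is divisible by the power e + 1 of [psi tau], division by
   the e-th power shows that c1 has residue 0 at [psi tau], whereas the residue is c1(0). *)
have [k [Q1 [eQ1 q0]]] := factor_X Q0.
have [e [c1 [ec1 c10]]] := factor_X q0.
move/eqP: eQ; rewrite eQ1 rmorphM rmorphXn ev2X mulf_eq0.
rewrite expf_eq0 (negbTE a0) andbF orbF => /eqP eQ.
have EQ1 : Q1 = (Q1`_0)%:P + 'X * (\poly_(i < size Q1) Q1`_i.+1).
  apply/polyP => i; rewrite coefD coefC coefXM; case: i => [|i] /=.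
    by rewrite addr0.
  rewrite add0r coef_poly; case: ltnP => // le.
  by rewrite nth_default // ltnW.
move: eQ; rewrite EQ1 rmorphD rmorphM ev2X ev2P ec1 rmorphM rmorphXn.
set Q2 := \poly_(i < _) _; rewrite [ev1 _ _ 'X]/= horner_morphX.
have [s [c [hs es]]] := divisible e.+1.
rewrite {1}es exprS => eQ.
have t0 : psi tau ^+ e != 0 by rewrite expf_neq0.
have {eQ} : ev1 phi (psi tau) c1 = - (psi tau * s * ev2 phi (psi a) (psi tau) Q2).
  apply: (mulIf t0); apply/eqP; rewrite -subr_eq0 mulNr opprK; apply/eqP.
  by rewrite -[RHS]eQ; ring.
rewrite -(ev2P _ 0) => eQ.
have ht : localization (psi tau) 0 by rewrite -ev_tau; apply: localization_ev.
have h1 := place_ev2 pl c1%:P (place0 pl) ht.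
have h2 := placeN pl (placeM pl (placeM pl ht hs)
  (place_ev2 pl Q2 (localization_ev a) ht)).
move: h1; rewrite eQ => /(place_uniq pl h2)/eqP.
rewrite !mul0r oppr0 ev2P ev1E map_poly_id // horner_coef0 eq_sym.
by rewrite (negbTE c10).
Qed.

Lemma localization_discrete : discrete localization (psi tau).
Proof.
split=> //; first by rewrite -ev_tau; apply: localization_ev.
move=> s s0; have [a [b [b0 e]]] := fractions s.
have a0 : psi a != 0 by rewrite -e mulf_neq0.
have [n [u [c c0 [hu eu]]]] := localization_order a0.
have [m [v [d d0 [hv ev']]]] := localization_order b0.
exists (Posz n - Posz m), (c / d); first by rewrite mulf_neq0 ?invr_eq0.
have v0 := place_neq0 pl d0 hv.
have -> : s * psi tau ^ (- (Posz n - Posz m)) = u / v.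
  have -> : s = psi a / psi b by rewrite -e mulfK.
  rewrite eu ev' opprB expfzDr // -invr_expz -!exprnP.
  by field; rewrite v0 !expf_neq0.
by apply: (placeM pl) hu _; apply: (placeV pl).
Qed.

End LocalRing.

(** * Fraction fields of residue rings of prime ideals *)

Section InverseRing.
Variable R : comNzRingType.
Hypothesis integral : forall x y : R, x * y = 0 -> (x == 0) || (y == 0).

Let unit_pred (x : R) : bool :=
  if excluded_middle_informative (exists y, y * x = 1) then true else false.
Let inverse (x : R) : R :=
  match excluded_middle_informative (exists y, y * x = 1) with
  | left e => proj1_sig (constructive_indefinite_description _ e)
  | right _ => x
  end.

(** Invertibility is decided and inverses are chosen classically; the copy keeps these structures
    apart from those that [R] itself carries. *)
Definition domain_copy : Type := R.
HB.instance Definition _ := GRing.ComNzRing.copy domain_copy R.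

Lemma domain_mulVx : {in unit_pred, left_inverse (1 : domain_copy) inverse *%R}.
Proof.
move=> x; rewrite unfold_in /unit_pred /inverse.
by case: excluded_middle_informative => // e _; case: constructive_indefinite_description.
Qed.

Lemma domain_unitPl (x y : domain_copy) : y * x = 1 -> unit_pred x.
Proof.
by move=> e; rewrite /unit_pred; case: excluded_middle_informative => // -[]; exists y.
Qed.

Lemma domain_invr_out : {in [predC unit_pred], inverse =1 id}.
Proof.
move=> x; rewrite inE unfold_in /unit_pred /inverse.
by case: excluded_middle_informative.
Qed.

HB.instance Definition _ := GRing.ComNzRing_hasMulInverse.Build domain_copy
  domain_mulVx domain_unitPl domain_invr_out.
HB.instance Definition _ :=
  GRing.ComUnitRing_isIntegral.Build domain_copy integral.

Let to_copy (x : R) : domain_copy := x.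
Let to_copy_zmod : zmod_morphism to_copy. Proof. by []. Qed.
Let to_copy_monoid : monoid_morphism to_copy. Proof. by []. Qed.
HB.instance Definition _ :=
  GRing.isZmodMorphism.Build R domain_copy to_copy to_copy_zmod.
HB.instance Definition _ :=
  GRing.isMonoidMorphism.Build R domain_copy to_copy to_copy_monoid.

Lemma domain_fractions : exists (F : fieldType) (psi : {rmorphism R -> F}),
  injective psi /\ forall s, exists a b, psi b != 0 /\ s * psi b = psi a.
Proof.
exists {fraction domain_copy}, (@FracField.tofrac domain_copy \o to_copy).
split; first by move=> a b /eqP; rewrite /= tofrac_eq => /eqP.
elim/quotW => r; exists (frac r).1, (frac r).2; split.
  by rewrite /= tofrac_eq0 denom_ratioP.
rewrite /= /to_copy; unlock FracField.tofrac.
rewrite -[LHS]FracField.pi_mul; apply/eqmodP; rewrite /= FracField.equivfE.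
rewrite /FracField.mulf !numden_Ratio ?oner_eq0 ?mulr1 ?denom_ratioP //.
by rewrite mulrC.
Qed.
End InverseRing.

Section PrimeIdealField.
Variables (R : comNzRingType) (I : R -> Prop).
Hypotheses (I0 : I 0) (I1 : ~ I 1).
Hypothesis Ilin : forall a u v, I u -> I v -> I (a * u + v).
Hypothesis Iprime : forall u v, I (u * v) -> I u \/ I v.

Definition decide (P : Prop) : bool :=
  if excluded_middle_informative P then true else false.

Lemma decideP P : reflect P (decide P).
Proof. by rewrite /decide; case: excluded_middle_informative => ?; constructor. Qed.

Let ideal : R -> bool := fun a => decide (I a).

Let ideal_closed : idealr_closed ideal.
Proof.
split; rewrite ?unfold_in; first exact/decideP.
  by apply/decideP.
by move=> a u v /decideP hu /decideP hv; apply/decideP/Ilin.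
Qed.
Let ideal_prime : prime_idealr_closed ideal.
Proof.
by move=> u v /decideP/Iprime[h|h]; apply/orP; [left|right]; apply/decideP.
Qed.
HB.instance Definition _ := isIdealr.Build R ideal ideal_closed.
HB.instance Definition _ := isPrimeIdealrClosed.Build R ideal ideal_prime.

Lemma prime_residue_field : exists (F : fieldType) (psi : {rmorphism R -> F}),
  (forall a, psi a = 0 <-> I a) /\
  forall s, exists a b, psi b != 0 /\ s * psi b = psi a.
Proof.
pose S : prime_idealr R := ideal.
have [F [psi [inj fr]]] := domain_fractions (@Quotient.rquot_IdomainAxiom R S).
pose pi : {rmorphism R -> {ideal_quot S}} := \pi_({ideal_quot S})%qT.
exists F, (psi \o pi); split.
  move=> a; rewrite /= -(rmorph0 psi); split.
    move/inj/eqP; rewrite -(rmorph0 pi) => /eqP/eqP.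
    by rewrite /pi -Quotient.idealrBE subr0 => /decideP.
  move=> /decideP Ia; congr (psi _); rewrite -(rmorph0 pi); apply/eqP.
  by rewrite /pi -Quotient.idealrBE subr0.
move=> s; have [a [b [b0 e]]] := fr s.
by exists (repr a), (repr b); rewrite /= /pi !reprK.
Qed.

End PrimeIdealField.

(** * The function field of the curve *)

Lemma map_derivD (R : nzRingType) (A B : {poly {poly R}}) :
  map_poly (@deriv R) (A + B) = map_poly (@deriv R) A + map_poly (@deriv R) B.
Proof.
by apply/polyP => i; rewrite coefD !coef_map_id0 ?linear0 // coefD derivD.
Qed.

Lemma map_derivC (R : nzRingType) (p : {poly R}) :
  map_poly (@deriv R) p%:P = p^`()%:P.
Proof.
by apply/polyP => i; rewrite coef_map_id0 ?linear0 // !coefC; case: ifP; rewrite ?linear0.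
Qed.

Lemma map_derivX (R : nzRingType) : map_poly (@deriv R) 'X = 0.
Proof.
apply/polyP => i; rewrite coef_map_id0 ?linear0 // coefX coef0.
by case: (i == 1)%N; rewrite ?derivC.
Qed.

Lemma map_derivM (R : comNzRingType) (A B : {poly {poly R}}) :
  map_poly (@deriv R) (A * B) =
    map_poly (@deriv R) A * B + A * map_poly (@deriv R) B.
Proof.
apply/polyP => i; have d0 : (0 : {poly R})^`() = 0 by rewrite linear0.
rewrite coefD !coefM coef_map_id0 // coefM raddf_sum -big_split /=.
by apply: eq_bigr => j _; rewrite derivM !coef_map_id0.
Qed.

Lemma logdXM (R : comNzRingType) (A B : {poly {poly R}}) :
  logdX (A * B) = logdX A * B + A * logdX B.
Proof. by rewrite /logdX derivM; ring. Qed.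

Lemma logdYM (R : comNzRingType) (A B : {poly {poly R}}) :
  logdY (A * B) = logdY A * B + A * logdY B.
Proof. by rewrite /logdY map_derivM; ring. Qed.

(** * Irreducible equations and the ideal of a curve in the torus *)

Section ClosedField.
Variable K : closedFieldType.

(** At a root y of p X + 1 the product p(y) y equals -1, so both factors are nonzero at once. *)
Lemma nonroot_neq0 (p : {poly K}) : p != 0 -> exists2 y, y != 0 & p.[y] != 0.
Proof.
move=> p0; have : size (p * 'X + 1%:P) != 1.
  rewrite size_MXaddC (negbTE p0) /= eqSS size_poly_eq0 //.
case/closed_rootP => y /rootP; rewrite !hornerE => e.
have : p.[y] * y != 0 by apply: contra_eq_neq e => ->; rewrite add0r oner_neq0.
by rewrite mulf_eq0 negb_or => /andP[]; exists y.
Qed.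

Lemma root_neq0 (p : {poly K}) i j : i != j -> p`_i != 0 -> p`_j != 0 ->
  exists2 x, x != 0 & p.[x] = 0.
Proof.
move=> ij pi pj; have p0 : p != 0 by apply: contraNneq pi => ->; rewrite coef0.
have [k [q [e q0]]] := factor_X p0.
have : size q != 1.
  apply/negP => /size_poly1P[c c0 eq].
  have H m : p`_m != 0 -> m = k.
    by rewrite e eq coefCM coefXn; case: (eqVneq m k); rewrite // mulr0 eqxx.
  by move: ij; rewrite (H _ pi) (H _ pj) eqxx.
case/closed_rootP => x /rootP ex; exists x; last by rewrite e hornerM ex mul0r.
by apply: contra q0 => /eqP x0; rewrite x0 horner_coef0 in ex; rewrite ex.
Qed.

Notation ev := (ev2 (idfun : {rmorphism K -> K})).

Lemma evE x y (h : {poly {poly K}}) : ev x y h = (map_poly (horner_eval y) h).[x].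
Proof.
rewrite /ev2 /=; congr (_.[_]); apply: eq_map_poly => p.
by rewrite ev1E map_poly_id.
Qed.

Lemma evP x y (p : {poly K}) : ev x y p%:P = p.[y].
Proof. by rewrite ev2P ev1E map_poly_id. Qed.

(** If two powers of X occur, a value y that keeps both coefficients nonzero leaves a polynomial in
    x with at least two terms, hence with a nonzero root. Otherwise the only coefficient, a
    polynomial in Y, is treated in the same way. *)
Lemma torus_zero_or_monom (B : {poly {poly K}}) : B != 0 ->
  (exists x y, [/\ x != 0, y != 0 & ev x y B = 0]) \/
  exists c i j, c != 0 /\ B = monom2 c i j.
Proof.
move=> B0; have [i Bi] : exists i, B`_i != 0.
  by exists (size B).-1; rewrite -lead_coefE lead_coef_eq0.
have [[i' [ii' Bi']]|N] := classic (exists i', i != i' /\ B`_i' != 0).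
  have [y y0] := nonroot_neq0 (mulf_neq0 Bi Bi').
  rewrite hornerM mulf_eq0 negb_or => /andP[n1 n2].
  have [||x x0 ex] := @root_neq0 (map_poly (horner_eval y) B) _ _ ii'.
  - by rewrite coef_map.
  - by rewrite coef_map.
  by left; exists x, y; rewrite evE.
have [j Bij] : exists j, B`_i`_j != 0.
  by exists (size B`_i).-1; rewrite -lead_coefE lead_coef_eq0.
have zero i' : i != i' -> B`_i' = 0.
  by move=> ii'; apply/eqP/negPn/negP => nz; apply: N; exists i'.
have EB : B = B`_i *: 'X^i.
  apply/polyP => i'; rewrite coefZ coefXn eq_sym.
  by case: eqVneq => [<-|/zero ->]; rewrite ?mulr1 ?mulr0.
have [[j' [jj' Bij']]|N'] := classic (exists j', j != j' /\ B`_i`_j' != 0).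
  have [y y0 ey] := root_neq0 jj' Bij Bij'.
  left; exists 1, y; rewrite oner_neq0 y0; split=> //.
  by rewrite EB -mul_polyC rmorphM evP ey mul0r.
right; exists B`_i`_j, i, j; split => //; rewrite {1}EB /monom2; congr (_ *: _).
apply/polyP => j'; rewrite coefZ coefXn eq_sym.
case: eqVneq => [<-|jj']; rewrite ?mulr1 ?mulr0 //.
by apply/eqP/negPn/negP => nz; apply: N'; exists j'.
Qed.

Lemma XsubC_dvd_bipoly (a : K) (h : {poly {poly K}}) :
  map_poly (horner_eval a) h = 0 -> exists h', h = ('X - a%:P)%:P * h'.
Proof.
move=> e; pose d (p : {poly K}) := p %/ ('X - a%:P).
have d0 : d 0 = 0 by rewrite /d div0p.
exists (map_poly d h); apply/polyP => i; rewrite coefCM coef_map_id0 //.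
rewrite mulrC divpK // dvdp_XsubCl; apply/rootP.
by have := congr1 (fun p : {poly K} => p`_i) e; rewrite coef_map coef0.
Qed.

Lemma XsubC_prime_bipoly (a : K) (D E h : {poly {poly K}}) :
  ('X - a%:P)%:P * h = D * E ->
  (exists D', D = ('X - a%:P)%:P * D') \/ (exists E', E = ('X - a%:P)%:P * E').
Proof.
move=> /(congr1 (map_poly (horner_eval a))); rewrite !rmorphM /= map_polyC /=.
rewrite /horner_eval !hornerE subrr mul0r => /esym/eqP.
by rewrite mulf_eq0 => /orP[/eqP/XsubC_dvd_bipoly|/eqP/XsubC_dvd_bipoly]; [left|right].
Qed.

Lemma XsubC_bipoly_neq0 (a : K) : ('X - a%:P)%:P != 0 :> {poly {poly K}}.
Proof. by rewrite polyC_eq0 polyXsubC_eq0. Qed.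

Lemma linear_factor_ind (Q : {poly K} -> Prop) :
  (forall c, c != 0 -> Q c%:P) ->
  (forall a p, p != 0 -> Q p -> Q (('X - a%:P) * p)) -> forall p, p != 0 -> Q p.
Proof.
move=> QC QM p; elim: {p}(size p) {-2}p (leqnn (size p)) => [|n IH] p sp p0.
  by rewrite leqn0 size_poly_eq0 (negbTE p0) in sp.
have [/eqP/size_poly1P[c c0 ->]|] := eqVneq (size p) 1; first exact: QC.
case/closed_rootP => a; rewrite -dvdp_XsubCl => /dvdpP[q e].
have q0 : q != 0 by apply: contraNneq p0 => q0; rewrite e q0 mul0r.
rewrite e mulrC; apply: QM => //; apply: IH => //.
by move: sp; rewrite e size_Mmonic ?monicXsubC // size_XsubC addn2.
Qed.

(* Gauss' lemma for [K[Y][X]], where the primes of [K[Y]] are linear. *)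
Lemma gauss_factor (h D E : {poly {poly K}}) (c : {poly K}) : c != 0 ->
  c%:P * h = D * E ->
  exists D' E', [/\ h = D' * E', size D' = size D & size E' = size E].
Proof.
move=> c0; elim/linear_factor_ind: c / c0 D E => [c c0|a p p0 IH] D E e.
  have cc0 : c^-1%:P != 0 :> {poly K} by rewrite polyC_eq0 invr_eq0.
  exists (c^-1%:P%:P * D), E; rewrite size_Cmul //; split=> //.
  by rewrite -mulrA -e mulrA -!polyCM mulVf // mul1r.
have key : p%:P * h * ('X - a%:P)%:P = D * E by rewrite -e polyCM; ring.
have := key; rewrite mulrC => /XsubC_prime_bipoly[[D' eD]|[E' eE]].
  have [|D1 [E1 [eh s1 s2]]] := IH D' E.
    by apply: (mulIf (XsubC_bipoly_neq0 a)); rewrite key eD; ring.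
  by exists D1, E1; rewrite eh s1 s2 eD size_Cmul // polyXsubC_eq0.
have [|D1 [E1 [eh s1 s2]]] := IH D E'.
  by apply: (mulIf (XsubC_bipoly_neq0 a)); rewrite key eE; ring.
by exists D1, E1; rewrite eh s1 s2 eE size_Cmul // polyXsubC_eq0.
Qed.

Section Irreducible.
Variable f0 : {poly {poly K}}.

Definition plane_curve (p : K * K) : Prop := in_torus p /\ ev p.1 p.2 f0 = 0.

Hypothesis fX : forall u, f0 <> 'X * u.
Hypothesis fY : forall u, f0 <> 'X%:P * u.
Hypothesis smooth : forall p, plane_curve p ->
  ev p.1 p.2 (logdX f0) != 0 \/ ev p.1 p.2 (logdY f0) != 0.
Hypothesis nonempty : exists p, plane_curve p.
Hypothesis connected : forall A B : {poly {poly K}},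
  (forall p, plane_curve p -> ev p.1 p.2 A = 0 \/ ev p.1 p.2 B = 0) ->
  (forall p, plane_curve p -> ~ (ev p.1 p.2 A = 0 /\ ev p.1 p.2 B = 0)) ->
  (forall p, plane_curve p -> ev p.1 p.2 A = 0) \/
  (forall p, plane_curve p -> ev p.1 p.2 B = 0).

Lemma curve_poly_neq0 : f0 != 0.
Proof. by apply/eqP => f00; apply: (fX (u := 0)); rewrite mulr0. Qed.

Let no_zero_factor (A B : {poly {poly K}}) : f0 = A * B ->
  (forall p, in_torus p -> ev p.1 p.2 B <> 0) -> exists2 c, c != 0 & B = c%:P%:P.
Proof.
move=> e N; have B0 : B != 0.
  by apply: contraNneq curve_poly_neq0 => B0; rewrite e B0 mulr0.
have [[x [y [x0 y0 exy]]]|[c [[|i] [[|j] [c0 eB]]]]] := torus_zero_or_monom B0.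
- by case: (N (x, y)).
- by exists c => //; rewrite eB /monom2 !expr0 !alg_polyC.
- case: (fY (u := A * (c *: 'X^j)%:P)); rewrite e eB /monom2 expr0 alg_polyC.
  by rewrite exprSr scalerAl polyCM; ring.
- case: (fX (u := A * (c%:P *: 'X^i))).
  by rewrite e eB /monom2 expr0 alg_polyC exprSr scalerAl; ring.
- case: (fX (u := A * ((c *: 'X^(j.+1)) *: 'X^i))).
  by rewrite e eB /monom2 [X in _ *: X]exprSr scalerAl; ring.
Qed.

(** The zero sets of the factors cover the curve, and by the Leibniz rule a common zero would be
    singular. Connectedness then puts the whole curve on one factor; the other has no zero on the
    torus, so it is a monomial, and [fX] and [fY] make it constant. *)
Lemma curve_poly_irreducible (A B : {poly {poly K}}) : f0 = A * B ->
  (exists2 c, c != 0 & A = c%:P%:P) \/ (exists2 c, c != 0 & B = c%:P%:P).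
Proof.
move=> e.
have eAB p : ev p.1 p.2 f0 = ev p.1 p.2 A * ev p.1 p.2 B by rewrite e rmorphM.
have cov p : plane_curve p -> ev p.1 p.2 A = 0 \/ ev p.1 p.2 B = 0.
  by move=> [_ /eqP]; rewrite eAB mulf_eq0 => /orP[/eqP|/eqP]; [left|right].
have disj p : plane_curve p -> ~ (ev p.1 p.2 A = 0 /\ ev p.1 p.2 B = 0).
  move=> /smooth + [a0 b0]; rewrite e logdXM logdYM !rmorphD !rmorphM a0 b0.
  by rewrite !mulr0 !mul0r !addr0 eqxx => -[].
have [allA|allB] := connected cov disj.
  right; apply: (no_zero_factor e) => p tp bp.
  have Cp : plane_curve p by split; rewrite // eAB bp mulr0.
  exact: (disj p Cp (conj (allA p Cp) bp)).
left; apply: (no_zero_factor (B := A) (A := B)); first by rewrite mulrC.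
move=> p tp bp; have Cp : plane_curve p by split; rewrite // eAB bp mul0r.
exact: (disj p Cp (conj bp (allB p Cp))).
Qed.

Let irreducible_sizeX (A B : {poly {poly K}}) : f0 = A * B ->
  (size A <= 1)%N \/ (size B <= 1)%N.
Proof.
by move=> /curve_poly_irreducible[[c c0 ->]|[c c0 ->]]; [left|right];
  rewrite size_polyC leq_b1.
Qed.

(* If [f0] does not depend on [X], the curve is a line [Y = s]. *)
Let line_case : (size f0 <= 1)%N -> exists s c, [/\ s != 0, c != 0 &
  f0 = c%:P%:P * ('X - s%:P)%:P].
Proof.
move=> /size1_polyC e; case: nonempty => p [[_ p20] Cp].
have : root f0`_0 p.2 by rewrite /root -(evP p.1) -e Cp.
rewrite -dvdp_XsubCl => /dvdpP[q eg].
have e' : f0 = q%:P * ('X - p.2%:P)%:P by rewrite {1}e eg polyCM.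
case: (curve_poly_irreducible e') => -[c c0 ec].
  by exists p.2, c; rewrite e' ec.
have /eqP := congr1 (fun h : {poly {poly K}} => size h`_0) ec.
by rewrite !coefC /= size_XsubC size_polyC c0.
Qed.

Lemma XsubC_ndvd (a : K) : (1 < size f0)%N -> ~ exists h, f0 = ('X - a%:P)%:P * h.
Proof.
move=> sf [h e]; case: (curve_poly_irreducible e) => -[c c0 ec].
  have /eqP := congr1 (fun h : {poly {poly K}} => size h`_0) ec.
  by rewrite !coefC /= size_XsubC size_polyC c0.
by move: sf; rewrite e ec -polyCM ltnNge size_polyC leq_b1.
Qed.

Lemma strip_content (c : {poly K}) (b E : {poly {poly K}}) : (1 < size f0)%N ->
  c != 0 -> c%:P * b = f0 * E -> exists u, b = f0 * u.
Proof.
move=> sf c0; elim/linear_factor_ind: c / c0 E => [c c0|a p p0 IH] E e.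
  exists (c^-1%:P%:P * E).
  by rewrite mulrCA -e mulrA -!polyCM mulVf // mul1r.
have key : p%:P * b * ('X - a%:P)%:P = f0 * E by rewrite -e polyCM; ring.
have := key; rewrite mulrC => /XsubC_prime_bipoly[[D' eD]|[E' eE]].
  by case: (XsubC_ndvd sf (a := a)); exists D'.
apply: (IH E'); apply: (mulIf (XsubC_bipoly_neq0 a)).
by rewrite key eE; ring.
Qed.

(** A nonzero resultant with respect to X lies in the ideal of [f0] and [b] and is a polynomial in Y
    alone. If it vanishes, there is a common factor of positive degree in X, and by Gauss' lemma and
    irreducibility this factor is [f0] up to content. *)
Lemma dvd_or_bezout (b : {poly {poly K}}) : (1 < size f0)%N ->
  (exists u, b = f0 * u) \/ exists u v c, c != 0 /\ u * f0 + v * b = c%:P.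
Proof.
move=> sf; have [b0|b0] := eqVneq b 0; first by left; exists 0; rewrite mulr0.
have [/size1_polyC eb|sb] := leqP (size b) 1.
  right; exists 0, 1, b`_0; rewrite -eb mul0r mul1r add0r; split=> //.
  by rewrite -polyC_eq0 -eb.
have [/eqP r0|r0] := eqVneq (resultant f0 b) 0; last first.
  have [uv _ e] := resultant_in_ideal sf sb.
  by right; exists uv.1, uv.2, (resultant f0 b).
left; move: r0; rewrite resultant_eq0; set D := Pdiv.Idomain.gcdp _ _ => sD.
have /Pdiv.Idomain.dvdpP[[c E] /= c0 e1] : (D %| f0) by apply: dvdp_gcdl.
have /Pdiv.Idomain.dvdpP[[c' E'] /= c'0 e2] : (D %| b) by apply: dvdp_gcdr.
rewrite -mul_polyC in e1; rewrite -mul_polyC in e2.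
have [E1 [D1 [ef sE sD1]]] := gauss_factor c0 e1.
have sE1 : (size E <= 1)%N.
  by rewrite -sE; case: (irreducible_sizeX ef) => //; rewrite sD1 leqNgt sD.
have eE := size1_polyC sE1.
have E0 : E`_0 != 0.
  rewrite -polyC_eq0 -eE; apply: contraNneq curve_poly_neq0 => E0.
  move/eqP: e1; rewrite E0 mul0r mulf_eq0 polyC_eq0 (negbTE c0) /=.
  by move=> /eqP ->.
apply: (@strip_content (E`_0 * c') b (c%:P * E')) => //.
  by rewrite mulf_neq0.
by rewrite polyCM -eE -mulrA e2 mulrCA -e1; ring.
Qed.

Lemma curve_points (c : {poly K}) : (1 < size f0)%N -> c != 0 ->
  exists p, plane_curve p /\ c.[p.2] != 0.
Proof.
move=> sf c0.
have l0 : lead_coef f0 != 0 by rewrite lead_coef_eq0 curve_poly_neq0.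
have g0 : f0`_0 != 0.
  have /biX_ndvd[j] := fX; apply: contraNneq => e.
  by rewrite /= e coef0.
(* Besides [c], the leading and the constant coefficient of [f0] in X are kept nonzero at y: two
   surviving coefficients give a nonzero root x. *)
have [y y0] := nonroot_neq0 (mulf_neq0 c0 (mulf_neq0 l0 g0)).
rewrite !hornerM !mulf_eq0 !negb_or => /and3P[n1 n2 n3].
have [|||x x0 ex] := @root_neq0 (map_poly (horner_eval y) f0) 0 (size f0).-1.
- by move: sf; case: (size f0) => [|[]].
- by rewrite coef_map.
- by rewrite coef_map -lead_coefE.
by exists (x, y); split=> //; split; [split|rewrite evE].
Qed.

Definition vanishes (b : {poly {poly K}}) : Prop :=
  forall p, plane_curve p -> ev p.1 p.2 b = 0.

Let ev_line (s : K) (b : {poly {poly K}}) : s != 0 ->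
  map_poly (horner_eval s) b != 0 -> exists2 x, x != 0 & ev x s b != 0.
Proof. by move=> s0 /nonroot_neq0[x x0 nx]; exists x => //; rewrite evE. Qed.

(** Otherwise a Bezout relation would give a nonzero polynomial in Y alone that vanishes on the
    curve, against [curve_points]. A line Y = s is treated apart, since the resultant in X needs
    positive degree. *)
Lemma vanishes_dvd b : vanishes b <-> exists u, b = f0 * u.
Proof.
split=> [V|[u ->] p [_ e]]; last by rewrite rmorphM e mul0r.
have [sf|sf] := leqP (size f0) 1.
  have [s [c [s0 c0 e]]] := line_case sf.
  have [/XsubC_dvd_bipoly[h eh]|] := eqVneq (map_poly (horner_eval s) b) 0.
    exists (c^-1%:P%:P * h); rewrite eh e.
    transitivity ((c * c^-1)%:P%:P * ('X - s%:P)%:P * h).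
      by rewrite mulfV // mul1r.
    by rewrite !polyCM; ring.
  case/(ev_line s0) => x x0 /eqP[]; apply: (V (x, s)); split; first by split.
  by rewrite e rmorphM !evP /= hornerXsubC subrr mulr0.
have [//|[u [v [c [c0 e]]]]] := dvd_or_bezout b sf.
have [p [Cp]] := curve_points sf c0.
rewrite -(evP p.1) -e rmorphD !rmorphM (V _ Cp) Cp.2 !mulr0 addr0.
by rewrite eqxx.
Qed.

(** Bezout relations for [a] and for [b] multiply to a nonzero polynomial in Y that would vanish on
    the curve together with the product. *)
Lemma vanishes_prime a b : vanishes (a * b) -> vanishes a \/ vanishes b.
Proof.
move=> V; have [sf|sf] := leqP (size f0) 1.
  have [s [c [s0 c0 e]]] := line_case sf.
  have : map_poly (horner_eval s) (a * b) = 0.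
    apply/eqP/negPn/negP => /(ev_line s0)[x x0 /eqP[]]; apply: (V (x, s)).
    by split; [split|rewrite e rmorphM !evP /= hornerXsubC subrr mulr0].
  have van g : map_poly (horner_eval s) g = 0 -> vanishes g.
    move=> eg p [_ /eqP]; rewrite e rmorphM !evP hornerXsubC !hornerC mulf_eq0.
    by rewrite (negbTE c0) /= subr_eq0 evE => /eqP ->; rewrite eg horner0.
  move/eqP; rewrite rmorphM mulf_eq0.
  by case/orP => /eqP/van; [left|right].
have [/vanishes_dvd|[u [v [c [c0 e]]]]] := dvd_or_bezout a sf; first by left.
have [/vanishes_dvd|[u' [v' [c' [c'0 e']]]]] := dvd_or_bezout b sf; first by right.
have [p [Cp]] := curve_points sf (mulf_neq0 c0 c'0).
rewrite hornerM -!(evP p.1) -e -e' !rmorphD !rmorphM Cp.2 !mulr0 !add0r.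
rewrite mulrACA -[ev _ _ a * _]rmorphM (V p Cp) mulr0.
by rewrite eqxx.
Qed.

End Irreducible.
End ClosedField.

Lemma ev2_monom2 (K L : fieldType) (phi : {rmorphism K -> L}) X Y c i j :
  ev2 phi X Y (monom2 c i j) = phi c * X ^+ i * Y ^+ j.
Proof.
rewrite /monom2 -!mul_polyC polyCM !rmorphM !rmorphXn ev2X ev2C.
by rewrite ev2Y mulrAC.
Qed.

(** * Algebraic dependence in the function field *)

Section Dependence.
Variable K : fieldType.

Definition bidegree_le (n : nat) (h : {poly {poly K}}) : Prop :=
  (size h <= n.+1)%N /\ forall i, (size (h`_i)%R <= n.+1)%N.

Lemma bidegree_leW m n h : (m <= n)%N -> bidegree_le m h -> bidegree_le n h.
Proof.
by move=> le [sh sc]; split=> [|i]; apply: leq_trans (_ : m.+1 <= n.+1)%N.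
Qed.

Lemma bidegree_leM m n g h : bidegree_le m g -> bidegree_le n h ->
  bidegree_le (m + n) (g * h).
Proof.
have S (R : nzRingType) (p q : {poly R}) : (size p <= m.+1)%N ->
    (size q <= n.+1)%N -> (size (p * q)%R <= (m + n).+1)%N.
  by move=> sp sq; apply: leq_trans (size_polyMleq _ _) _; lia.
move=> [sg cg] [sh ch]; split=> [|i]; first exact: S.
rewrite coefM; apply: leq_trans (size_sum _ _ _) _.
by apply/bigmax_leqP => j _; apply: S.
Qed.

Lemma bidegree_leX n h k : bidegree_le n h -> bidegree_le (n * k) (h ^+ k).
Proof.
move=> bh; elim: k => [|k IH]; last by rewrite exprS mulnS; apply: bidegree_leM.
rewrite muln0 expr0; split; first by rewrite size_poly1.
by move=> i; rewrite coef1; case: (i == 0)%N; rewrite ?size_poly1 ?size_poly0.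
Qed.

Lemma bidegree_le_ex h : exists n, bidegree_le n h.
Proof.
have [N [s1 s2 _]] := bicoef_support h.
by exists N; split=> [|i]; apply: leqW.
Qed.

Lemma bidegree_le_monom (c : K) i j n : (i <= n)%N -> (j <= n)%N ->
  bidegree_le n (monom2 c i j).
Proof.
move=> le1 le2; split=> [|k]; rewrite /monom2.
  by apply: leq_trans (size_scale_leq _ _) _; rewrite size_polyXn.
rewrite coefZ coefXn; case: (k == i); rewrite ?mulr0 ?size_poly0 // mulr1.
by apply: leq_trans (size_scale_leq _ _) _; rewrite size_polyXn.
Qed.

Lemma linear_dependence (I : finType) (v : I -> {poly {poly K}}) M :
  (forall i, bidegree_le M (v i)) -> (M.+1 * M.+1 < #|I|)%N ->
  exists w : I -> K, (exists i, w i != 0) /\ \sum_i (w i)%:P%:P * v i = 0.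
Proof.
move=> bv lt; pose A := \matrix_(i < #|I|)
  mxvec (\matrix_(a < M.+1, b < M.+1) (v (enum_val i))`_a`_b).
have : kermx A != 0.
  rewrite -mxrank_eq0 mxrank_ker subn_eq0 -ltnNge.
  exact: leq_ltn_trans (rank_leq_col A) lt.
case/rowV0Pn => u /sub_kermxP uA u0.
exists (fun i => u 0 (enum_rank i)); split.
  have /rV0Pn[i ui] := u0.
  by exists (enum_val i); rewrite enum_valK.
apply/polyP => a; apply/polyP => b; rewrite !coef0 coef_sum coef_sum.
under eq_bigr do rewrite !coefCM.
have [la|ga] := ltnP a M.+1; last first.
  by rewrite big1 // => i _; rewrite [(v i)`_a]nth_default ?coef0 ?mulr0 //;
    apply: leq_trans ga; case: (bv i).
have [lb|gb] := ltnP b M.+1; last first.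
  by rewrite big1 // => i _; rewrite [_`_b]nth_default ?mulr0 //;
    apply: leq_trans gb; case: (bv i).
have := congr1 (fun r : 'rV_(_) => r 0 (mxvec_index (Ordinal la) (Ordinal lb))) uA.
rewrite !mxE => e; rewrite -[RHS]e (reindex (fun i : 'I_#|I| => enum_val i)) /=.
  by apply: eq_bigr => i _; rewrite enum_valK !mxE mxvecE !mxE.
by exists enum_rank => i _; rewrite ?enum_valK ?enum_rankK.
Qed.

End Dependence.

(** F is the fraction field of K[X, Y] / (f0) with generic point (x, y), stated as a property of the
    triple. A change of variables then alters the equation and the generators while F stays the
    same, so that all places live on one field. *)
Record function_field (K : fieldType) (f0 : {poly {poly K}}) (F : fieldType)
    (phi : {rmorphism K -> F}) (x y : F) : Prop := FunctionField {
  ff_dvd : forall b, ev2 phi x y b = 0 <-> exists u, b = f0 * u;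
  ff_frac : forall s, exists a b,
    ev2 phi x y b != 0 /\ s * ev2 phi x y b = ev2 phi x y a;
  ff_neq0 : f0 != 0 }.

(* Dimension count: the pairs [(Q, R)] with [Q] of bidegree less than [n] have
   too many coefficients for [Q (a / d, b / d) * d ^ 2n + f0 * R] to be
   injective in them. *)
Lemma function_field_dependent (K : fieldType) (f0 : {poly {poly K}})
    (F : fieldType) (phi : {rmorphism K -> F}) (x y : F) :
  function_field f0 phi x y ->
  forall s t : F, exists2 Q, Q != 0 & ev2 phi s t Q = 0.
Proof.
case=> dvd frac f00 s t.
have [a1 [d1 [d10 ea]]] := frac s; have [b1 [d2 [d20 eb]]] := frac t.
pose psi := ev2 phi x y.
have [a [b [d [ea' eb' d0]]]] :
    exists a b d, [/\ s * psi d = psi a, t * psi d = psi b & psi d != 0].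
  exists (a1 * d2), (b1 * d1), (d1 * d2); rewrite !rmorphM mulf_neq0 //.
  by split=> //; rewrite /psi -?ea -?eb; ring.
have [E [Ea Eb Ed]] : exists E, [/\ bidegree_le E a, bidegree_le E b & bidegree_le E d].
  have [i hi] := bidegree_le_ex a; have [j hj] := bidegree_le_ex b.
  have [k hk] := bidegree_le_ex d.
  exists (i + j + k)%N; split; [apply: bidegree_leW hi|apply: bidegree_leW hj|
    apply: bidegree_leW hk]; lia.
have [e he] := bidegree_le_ex f0.
(* All vectors [v i] have bidegree at most 2nE + e, hence (m + e)^2 coefficients. There are n^2 +
   m^2 of them, so n^2 > 2me + e^2 is needed, that is n (n - 4Ee) > 2e + e^2 for this m. *)
pose n := (4 * E * e + 2 * e + e * e + 1)%N; pose m := (2 * n * E + 1)%N.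
pose v (i : ('I_n * 'I_n) + ('I_m * 'I_m)) : {poly {poly K}} :=
  match i with
  | inl i => (a ^+ i.1 * d ^+ (n - i.1)) * (b ^+ i.2 * d ^+ (n - i.2))
  | inr i => f0 * monom2 1 i.1 i.2
  end.
have bv i : bidegree_le (2 * n * E + e) (v i).
  have half c (i1 : 'I_n) : bidegree_le E c ->
      bidegree_le (n * E) (c ^+ i1 * d ^+ (n - i1)).
    move=> hc; have := bidegree_leM (bidegree_leX i1 hc) (bidegree_leX (n - i1) Ed).
    by apply: bidegree_leW; have := ltn_ord i1; nia.
  case: i => -[i j].
    have := bidegree_leM (half a i Ea) (half b j Eb).
    by apply: bidegree_leW; lia.
  have hm : bidegree_le (2 * n * E) (monom2 (1 : K) i j).
    by apply: bidegree_le_monom; [have := ltn_ord i|have := ltn_ord j]; rewrite /m; lia.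
  by have := bidegree_leM he hm; apply: bidegree_leW; lia.
have [|w [[i0 wi0] W]] := linear_dependence bv.
  rewrite card_sum !card_prod !card_ord /m; set X := (2 * n * E)%N.
  have : (2 * (X + 1) * e + e * e < n * n)%N by rewrite /X /n; nia.
  nia.
pose Q := \sum_(i : 'I_n * 'I_n) monom2 (w (inl i)) i.1 i.2.
pose R := \sum_(i : 'I_m * 'I_m) monom2 (w (inr i)) i.1 i.2.
have cQ k (u : 'I_k * 'I_k -> K) (i : 'I_k * 'I_k) : bicoef (\sum_j monom2 (u j) j.1 j.2)
    (Posz i.1, Posz i.2) = u i.
  rewrite bicoef_sum (bigD1 i) // bicoef_monom2 eqxx big1 => [|j ji]; first exact: addr0.
  rewrite bicoef_monom2; case: eqP => // -[e1 e2].
  case/eqP: ji; case: i j e1 e2 => [i1 i2] [j1 j2] /= e1 e2.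
  by congr (_, _); apply: val_inj.
have monomE c i j : monom2 c i j = c%:P%:P * monom2 (1 : K) i j.
  by rewrite /monom2 scale1r -!mul_polyC polyCM mulrA.
have W' : \sum_i (w (inl i))%:P%:P * v (inl i) + f0 * R = 0.
  rewrite -[RHS]W big_sumType /=; congr (_ + _); rewrite mulr_sumr.
  by apply: eq_bigr => i _; rewrite monomE; ring.
exists Q.
  apply: contraNneq wi0 => Q0.
  have wl i : w (inl i) = 0.
    have := cQ n (fun i => w (inl i)) i; rewrite -/Q Q0 => <-.
    by rewrite /= !coef0.
  case: i0 => i0; first by rewrite wl.
  move/eqP: W'; rewrite big1 ?add0r; last by move=> i _; rewrite wl !mul0r.
  rewrite mulf_eq0 (negbTE f00) /= => /eqP R0.
  have := cQ m (fun i => w (inr i)) i0; rewrite -/R R0 => <-.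
  by rewrite /= !coef0.
have /(congr1 psi) := W'; rewrite rmorphD rmorphM rmorph0.
have -> : psi f0 = 0 by apply/dvd; exists 1; rewrite mulr1.
rewrite mul0r addr0 => W2.
have D0 : psi d ^+ n * psi d ^+ n != 0 by rewrite mulf_neq0 ?expf_neq0.
apply: (mulIf D0); rewrite mul0r -[RHS]W2 rmorph_sum mulr_suml rmorph_sum /=.
apply: eq_bigr => -[i j] _ /=.
rewrite ev2_monom2 !rmorphM !rmorphXn ev2C -ea' -eb'.
have E1 : psi d ^+ n = psi d ^+ i * psi d ^+ (n - i) by rewrite -exprD subnKC // ltnW.
have E2 : psi d ^+ n = psi d ^+ j * psi d ^+ (n - j) by rewrite -exprD subnKC // ltnW.
rewrite {1}E1 E2 !exprMn; ring.
Qed.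

Notation ev2id K := (@ev2 K K (idfun : {rmorphism K -> K})).

Definition smooth_plane (K : closedFieldType) (f0 : {poly {poly K}}) : Prop :=
  forall p, plane_curve f0 p ->
    ev2id K p.1 p.2 (logdX f0) != 0 \/ ev2id K p.1 p.2 (logdY f0) != 0.

Section CurveEquation.
Variables (K : closedFieldType) (f : laurent K).
Hypothesis smooth : torus_smooth f.
Hypothesis connected : torus_connected (torus_curve f).

(** The construction of edge polynomials, applied to the identity substitution, removes the monomial
    factor of [f]. On the torus the Jacobian criterion can be put in terms of logarithmic
    derivatives, which monomial substitutions transform linearly. *)
Lemma curve_equation : exists (f0 : {poly {poly K}}) (n : int * int),
  [/\ forall m, f m = bicoef f0 (shear (1, 0) (0, 1) n m),
      forall u, f0 <> 'X * u, forall u, f0 <> 'X%:P * u,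
      forall p, torus_curve f p <-> plane_curve f0 p &
      smooth_plane f0].
Proof.
case: connected => -[p0 Cp0] _.
have [m0 fm0] : exists m, f m != 0.
  apply: NNPP => N; have f0 m : f m = 0.
    by apply/eqP/negPn/negP => nz; apply: N; exists m.
  by case: (smooth Cp0); rewrite /ldx /ldy big1 ?eqxx // => m _;
    rewrite f0 mul0rz !mul0r.
have uni : unimodular (1, 0) (0, 1) by [].
have [|f0 [fX fY [n1 [n2 E]]]] := @edge_poly_exists K (fun=> (1, 0)) (0, 1) f
  (finsupp f) m0 uni _ fm0.
  by move=> m; rewrite mem_finsupp.
exists f0, (n1, n2).
have E' m : f m = bicoef f0 (shear (1, 0) (0, 1) (n1, n2) m).
  by case: m => i j; rewrite E.
have eqC p : torus_curve f p <-> plane_curve f0 p.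
  have ev_eq : in_torus p -> leval f p = p.1 ^ n1 * p.2 ^ n2 * ev2id K p.1 p.2 f0.
    move=> [p10 p20]; rewrite -(lmap_id f) [p in LHS]surjective_pairing.
    exact: (laurent_shift idfun p10 p20 E').
  split=> -[tp e]; split=> //; last by rewrite ev_eq // e mulr0.
  move/eqP: e; case: (tp) => p10 p20; rewrite ev_eq // !mulf_eq0.
  by rewrite (negbTE (expfz_neq0 _ p10)) (negbTE (expfz_neq0 _ p20)) /= => /eqP.
split=> // p Cp; have Cp' : torus_curve f p by apply/eqC.
case: (Cp') => -[p10 p20] fp.
(* Passing from [f] to [f0] shifts the exponent [w] by n', which changes the sum only by n' f(p) =
   0. *)
have log (w : int * int -> int) h n' :
    (forall m, bicoef h (shear (1, 0) (0, 1) (n1, n2) m) = (w m - n')%:~R * f m) ->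
    p.1 ^ n1 * p.2 ^ n2 * ev2id K p.1 p.2 h =
    \sum_(m <- finsupp f) f m *~ w m * p.1 ^ m.1 * p.2 ^ m.2.
  move=> eh; have := @shear_sum _ _ (idfun : {rmorphism K -> K}) _ _ (n1, n2)
    (fun m => (w m - n')%:~R * f m) (finsupp f) h _ _ uni p10 p20 (fset_uniq _).
  rewrite !expr1z !expr0z mulr1 mul1r => -> //.
    transitivity (\sum_(m <- finsupp f) (f m *~ w m * p.1 ^ m.1 * p.2 ^ m.2)
        - n'%:~R * leval f p).
      rewrite /leval mulr_sumr -sumrB; apply: eq_bigr => m _ /=.
      by rewrite intrB -[f m *~ _]mulrzl; ring.
    by rewrite fp mulr0 subr0.
  move=> m; rewrite mem_finsupp; apply: contra => /eqP ->.
  by rewrite mulr0.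
have pz (u : K) (z : int) : u != 0 -> u ^ z = u * u ^ (z - 1).
  by move=> u0; rewrite -[X in X * _]expr1z -expfzDr // addrC subrK.
have nzu : p.1 ^ n1 * p.2 ^ n2 != 0 by rewrite mulf_neq0 ?expfz_neq0.
case: (smooth Cp') => nz; [left|right]; apply: contra nz => /eqP z.
  have := log fst (logdX f0) n1; rewrite z mulr0 => e.
  apply/eqP; apply: (mulfI p10); rewrite mulr0 [RHS]e.
    rewrite /ldx mulr_sumr; apply: eq_bigr => m _.
    by rewrite (pz p.1 m.1) //; ring.
  by move=> m; rewrite bicoef_logdX -E' /shear /dot /= mul1r mul0r addr0.
have := log snd (logdY f0) n2; rewrite z mulr0 => e.
apply/eqP; apply: (mulfI p20); rewrite mulr0 [RHS]e.
  rewrite /ldy mulr_sumr; apply: eq_bigr => m _.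
  by rewrite (pz p.2 m.2) //; ring.
by move=> m; rewrite bicoef_logdY -E' /shear /dot /= mul1r mul0r add0r.
Qed.

Lemma curve_function_field : exists (f0 : {poly {poly K}}) (n : int * int)
    (F : fieldType) (phi : {rmorphism K -> F}) (x y : F),
  [/\ [/\ forall m, f m = bicoef f0 (shear (1, 0) (0, 1) n m),
      forall p, torus_curve f p <-> plane_curve f0 p & smooth_plane f0],
      function_field f0 phi x y,
      forall b, ev2 phi x y b = 0 <-> vanishes f0 b,
      x != 0 & y != 0].
Proof.
have [f0 [n [E fX fY eqC sm]]] := curve_equation.
case: connected => -[p0 Cp0] conn.
have Pp0 : plane_curve f0 p0 by apply/eqC.
have conn' (A B : {poly {poly K}}) :
  (forall p, plane_curve f0 p -> ev2id K p.1 p.2 A = 0 \/ ev2id K p.1 p.2 B = 0) ->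
  (forall p, plane_curve f0 p -> ~ (ev2id K p.1 p.2 A = 0 /\ ev2id K p.1 p.2 B = 0)) ->
  (forall p, plane_curve f0 p -> ev2id K p.1 p.2 A = 0) \/
  (forall p, plane_curve f0 p -> ev2id K p.1 p.2 B = 0).
  have closed (D : {poly {poly K}}) :
      torus_closed (fun p => in_torus p /\ ev2id K p.1 p.2 D = 0).
    have [g hg] := bipoly_laurent D; exists (eq g) => p.
    have e : leval g p = ev2id K p.1 p.2 D.
      by rewrite -hg lmap_id -surjective_pairing.
    by split=> -[tp hp]; split=> //; [move=> _ <-; rewrite e|rewrite -e hp].
  move=> cov disj; have [||h|h] := conn _ _ (closed A) (closed B).
  - move=> p Cp; have := cov p ((eqC p).1 Cp); case: Cp => tp _ [].
      by left.
    by right.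
  - move=> p Cp [[_ a0] [_ b0]]; apply: (disj p ((eqC p).1 Cp)).
    by split.
  - by left=> p /eqC/h[].
  - by right=> p /eqC/h[].
have dvd := vanishes_dvd fX fY sm (ex_intro _ p0 Pp0) conn'.
have [||||F [psi [ker fr]]] := @prime_residue_field {poly {poly K}} (vanishes f0).
- by move=> p _; rewrite rmorph0.
- by move=> /(_ p0 Pp0)/eqP; rewrite rmorph1 oner_eq0.
- by move=> a u v hu hv p Cp; rewrite rmorphD rmorphM hu // hv // mulr0 addr0.
- exact: (vanishes_prime fX fY sm (ex_intro _ p0 Pp0) conn').
pose phi : {rmorphism K -> F} := psi \o (polyC \o polyC).
have psiE h : psi h = ev2 phi (psi 'X) (psi 'X%:P) h.
  elim/bipoly_ind: h => [c|||a b Ha Hb|a b Ha Hb].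
  - by rewrite ev2C.
  - by rewrite ev2X.
  - by rewrite ev2Y.
  - by rewrite !rmorphD Ha Hb.
  - by rewrite !rmorphM Ha Hb.
case: (Pp0) => -[p10 p20] _.
exists f0, n, F, phi, (psi 'X), (psi 'X%:P); split=> //.
- split.
  + by move=> b; rewrite -psiE ker.
  + by move=> s; have [a [b [b0 e]]] := fr s; exists a, b; rewrite -!psiE.
  + exact: curve_poly_neq0 fX.
- by move=> b; rewrite -psiE.
- by apply/eqP => /ker/(_ p0 Pp0)/eqP; rewrite ev2X (negbTE p10).
- by apply/eqP => /ker/(_ p0 Pp0)/eqP; rewrite ev2Y (negbTE p20).
Qed.

End CurveEquation.

(** * Monomial changes of variables *)

Lemma monomial_pullback (K : fieldType) (a b c d : int) (g : {poly {poly K}}) :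
  exists (N : nat) (g' : {poly {poly K}}),
    forall (L : fieldType) (phi : {rmorphism K -> L}) x y, x != 0 -> y != 0 ->
      ev2 phi x y g' = (x * y) ^+ N * ev2 phi (x ^ a * y ^ b) (x ^ c * y ^ d) g.
Proof.
have mono (a' b' : int) : exists (N : nat) (g' : {poly {poly K}}),
    forall (L : fieldType) (phi : {rmorphism K -> L}) x y, x != 0 -> y != 0 ->
      ev2 phi x y g' = (x * y) ^+ N * (x ^ a' * y ^ b').
  (* Large enough for N + a' and N + b' to be nonnegative. *)
  pose N := (`|a'| + `|b'|)%N.
  exists N, (monom2 1 (absz (N%:Z + a')) (absz (N%:Z + b'))) => L phi x y x0 y0.
  rewrite ev2_monom2 rmorph1 mul1r exprMn !exprnP !gez0_abs; try lia.
  by rewrite !expfzDr //; ring.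
elim/bipoly_ind: g => [k|||g1 g2 [N1 [g1' e1]] [N2 [g2' e2]]|
    g1 g2 [N1 [g1' e1]] [N2 [g2' e2]]].
- by exists 0%N, k%:P%:P => L phi x y _ _; rewrite !ev2C mul1r.
- have [N [g' e]] := mono a b.
  by exists N, g' => L phi x y x0 y0; rewrite ev2X e.
- have [N [g' e]] := mono c d.
  by exists N, g' => L phi x y x0 y0; rewrite ev2Y e.
- exists (N1 + N2)%N, (g1' * ('X * 'X%:P) ^+ N2 + g2' * ('X * 'X%:P) ^+ N1).
  move=> L phi x y x0 y0; rewrite !rmorphD !rmorphM !rmorphXn !rmorphM e1 // e2 //.
  by rewrite !ev2X !ev2Y exprD; ring.
- exists (N1 + N2)%N, (g1' * g2') => L phi x y x0 y0.
  by rewrite !rmorphM e1 // e2 // exprD; ring.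
Qed.

Section MonomialChange.
Variables (delta : int * int -> int * int) (L : fieldType).
Implicit Types (p P : L * L).

Definition inverse_subst (b : int * int) p : L * L :=
  (p.1 ^ b.2 * p.2 ^ (- b.1), p.1 ^ (- (delta b).2) * p.2 ^ (delta b).1).

Lemma expz_comb (u v : L) (a b a' b' c d : int) : u != 0 -> v != 0 ->
  (u ^ a * v ^ b) ^ c * (u ^ a' * v ^ b') ^ d =
    u ^ (a * c + a' * d) * v ^ (b * c + b' * d).
Proof.
move=> u0 v0; rewrite !expfzMl !exprz_exp !expfzDr //; ring.
Qed.

Lemma monomial_substK b P : unimodular (delta b) b -> in_torus P ->
  inverse_subst b (monomial_subst delta b P) = P.
Proof.
move=> uni [P1 P2]; rewrite /inverse_subst /monomial_subst /= !expz_comb //.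
move: uni; rewrite /unimodular; set d := delta b => uni.
have -> : d.1 * b.2 + d.2 * - b.1 = 1 by rewrite -uni; ring.
have -> : b.1 * b.2 + b.2 * - b.1 = 0 by ring.
have -> : d.1 * - d.2 + d.2 * d.1 = 0 by ring.
have -> : b.1 * - d.2 + b.2 * d.1 = 1 by rewrite -uni; ring.
by rewrite !expr1z !expr0z mulr1 mul1r -surjective_pairing.
Qed.

Lemma inverse_substK b p : unimodular (delta b) b -> in_torus p ->
  monomial_subst delta b (inverse_subst b p) = p.
Proof.
move=> uni [P1 P2]; rewrite /inverse_subst /monomial_subst /= !expz_comb //.
move: uni; rewrite /unimodular; set d := delta b => uni.
have -> : b.2 * d.1 + - d.2 * b.1 = 1 by rewrite -uni; ring.
have -> : - b.1 * d.1 + d.1 * b.1 = 0 by ring.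
have -> : b.2 * d.2 + - d.2 * b.2 = 0 by ring.
have -> : - b.1 * d.2 + d.1 * b.2 = 1 by rewrite -uni; ring.
by rewrite !expr1z !expr0z mulr1 mul1r -surjective_pairing.
Qed.

Lemma inverse_subst_torus b p : in_torus p -> in_torus (inverse_subst b p).
Proof. by move=> [p1 p2]; split; rewrite mulf_neq0 ?expfz_neq0. Qed.

Lemma monomial_subst_torus b p : in_torus p -> in_torus (monomial_subst delta b p).
Proof. by move=> [p1 p2]; split; rewrite mulf_neq0 ?expfz_neq0. Qed.

End MonomialChange.

Lemma cancel_X (K : fieldType) (h g w : {poly {poly K}}) i :
  (forall u, h <> 'X * u) -> 'X ^+ i * g = h * w -> exists u, g = h * u.
Proof.
move=> hX; have h0 : h`_0 != 0.
  by have /biX_ndvd[j] := hX; apply: contraNneq => /= ->; rewrite coef0.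
elim: i w => [|i IH] w; first by rewrite mul1r; exists w.
rewrite exprS -mulrA => e; have /eqP := congr1 (fun p : {poly {poly K}} => p`_0) e.
rewrite coefXM /= coef0M eq_sym mulf_eq0 (negbTE h0) /= => /eqP w0.
have ew : w = 'X * \poly_(i < size w) w`_i.+1.
  apply/polyP => k; rewrite coefXM coef_poly; case: k => //= k.
  by case: ltnP => // le; rewrite nth_default // ltnW.
apply: (IH (\poly_(i < size w) w`_i.+1)).
apply: (@mulfI _ ('X : {poly {poly K}})); first by rewrite polyX_eq0.
by rewrite e {1}ew; ring.
Qed.

Lemma cancel_Y (K : closedFieldType) (h g w : {poly {poly K}}) j :
  (forall u, h <> 'X%:P * u) -> 'X%:P ^+ j * g = h * w -> exists u, g = h * u.
Proof.
move=> hY; elim: j w => [|j IH] w; first by rewrite mul1r; exists w.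
have eX : 'X%:P = ('X - 0%:P)%:P :> {poly {poly K}} by rewrite subr0.
rewrite exprS -mulrA => e; move: (e); rewrite {1}eX => /XsubC_prime_bipoly.
rewrite -eX => -[[D /hY //]|[D eD]]; apply: (IH D).
apply: (@mulfI _ ('X%:P : {poly {poly K}})); first by rewrite polyC_eq0 polyX_eq0.
by rewrite e eD; ring.
Qed.

(** Polynomial identities can be checked at this point, where negative powers of the coordinates
    make sense as well. *)
Lemma generic_point (K : fieldType) :
  exists (Q : fieldType) (psi : {rmorphism K -> Q}) (x y : Q),
    [/\ x != 0, y != 0 & injective (ev2 psi x y)].
Proof.
pose A2 := {poly {poly K}}.
exists {fraction A2}, (@FracField.tofrac A2 \o (polyC \o polyC)),
  (@FracField.tofrac A2 'X), (@FracField.tofrac A2 'X%:P).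
split; first by rewrite tofrac_eq0 polyX_eq0.
  by rewrite tofrac_eq0 polyC_eq0 polyX_eq0.
set ev := ev2 _ _ _; have evE (k : A2) : ev k = FracField.tofrac k.
  elim/bipoly_ind: k => [c|||k1 k2 H1 H2|k1 k2 H1 H2].
  - by rewrite /ev ev2C.
  - by rewrite /ev ev2X.
  - by rewrite /ev ev2Y.
  - by rewrite !rmorphD H1 H2.
  - by rewrite !rmorphM H1 H2.
by move=> k1 k2; rewrite !evE => /eqP; rewrite tofrac_eq => /eqP.
Qed.

Section FunctionFieldChange.
Variables (K : closedFieldType) (F : fieldType) (phi : {rmorphism K -> F}).

Lemma ev2_translate (L : fieldType) (psi : {rmorphism K -> L}) X Y h a :
  ev2 psi X Y (translate h a) = ev2 psi (X + psi a) Y h.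
Proof.
rewrite /translate; elim/bipoly_ind: h => [c|||u v Hu Hv|u v Hu Hv].
- by rewrite comp_polyC !ev2C.
- by rewrite comp_polyX rmorphD ev2C !ev2X.
- by rewrite comp_polyC !ev2Y.
- by rewrite !rmorphD Hu Hv.
- by rewrite !rmorphM Hu Hv.
Qed.

Lemma translateK (h : {poly {poly K}}) a : translate (translate h (- a)) a = h.
Proof.
rewrite /translate -comp_polyA; rewrite comp_polyD comp_polyX comp_polyC.
by rewrite -addrA -!polyCD subrr addr0 comp_polyXr.
Qed.

Lemma translateM (g h : {poly {poly K}}) a :
  translate (g * h) a = translate g a * translate h a.
Proof. by rewrite /translate rmorphM. Qed.

Lemma translate_function_field h X Y a : function_field h phi X Y ->
  function_field (translate h a) phi (X - phi a) Y.
Proof.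
move=> [dvd frac h0].
have evN b : ev2 phi X Y (translate b (- a)) = ev2 phi (X - phi a) Y b.
  by rewrite ev2_translate rmorphN.
split.
- move=> b; rewrite -evN dvd; split=> -[u e].
    by exists (translate u a); rewrite -translateM -e translateK.
  exists (translate u (- a)); rewrite e translateM; congr (_ * _).
  by rewrite -{1}(opprK a) translateK.
- move=> s; have [b [c [c0 e]]] := frac s.
  exists (translate b a), (translate c a).
  by rewrite !ev2_translate subrK.
- apply: contraNneq h0 => e.
  by have := translateK h (- a); rewrite opprK e /translate comp_poly0 => <-.
Qed.

(** If g vanishes at (X, Y), its pullback under the inverse substitution, with denominators cleared,
    vanishes at (x, y) and so is a multiple of [h]. Substituting back at a generic point gives an
    identity monomial * g = h' * u; since neither variable divides [h'], the monomial cancels. *)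
Lemma edge_function_field d b n (h h' : {poly {poly K}}) X Y :
  unimodular d b -> X != 0 -> Y != 0 ->
  (forall u, h' <> 'X * u) -> (forall u, h' <> 'X%:P * u) ->
  (forall m, bicoef h m = bicoef h' (shear d b n m)) ->
  function_field h phi (X ^ d.1 * Y ^ b.1) (X ^ d.2 * Y ^ b.2) ->
  function_field h' phi X Y.
Proof.
move=> uni X0 Y0 hX hY hh' [dvd frac h0].
have evh (L : fieldType) (psi : {rmorphism K -> L}) (u v : L) : u != 0 -> v != 0 ->
    ev2 psi (u ^ d.1 * v ^ b.1) (u ^ d.2 * v ^ b.2) h =
      u ^ n.1 * v ^ n.2 * ev2 psi u v h'.
  by move=> u0 v0; apply: edge_ev2.
pose delta (_ : int * int) := d.
have uni' : unimodular (delta b) b by [].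
split.
- move=> g; split=> [eg|[u ->]]; last first.
    have : ev2 phi X Y h' = 0; last by move=> e; rewrite rmorphM e mul0r.
    have : ev2 phi (X ^ d.1 * Y ^ b.1) (X ^ d.2 * Y ^ b.2) h = 0.
      by apply/dvd; exists 1; rewrite mulr1.
    move=> /eqP; rewrite evh // !mulf_eq0 (negbTE (expfz_neq0 _ X0)).
    by rewrite (negbTE (expfz_neq0 _ Y0)) /= => /eqP.
  have [N [g' eg']] := monomial_pullback b.2 (- b.1) (- d.2) d.1 g.
  have inv (L : fieldType) (x y : L) : x != 0 -> y != 0 ->
      let x' := x ^ d.1 * y ^ b.1 in let y' := x ^ d.2 * y ^ b.2 in
      x' ^ b.2 * y' ^ (- b.1) = x /\ x' ^ (- d.2) * y' ^ d.1 = y.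
    move=> x0 y0 /=.
    have := @monomial_substK delta L b (x, y) uni' (conj x0 y0).
    by rewrite /inverse_subst /monomial_subst /= => -[-> ->].
  have [u eu] : exists u, g' = h * u.
    apply/dvd; rewrite eg' ?mulf_neq0 ?expfz_neq0 //.
    by have [-> ->] := inv F X Y X0 Y0; rewrite eg mulr0.
  have [Q [psi [x [y [x0 y0 inj]]]]] := generic_point K.
  have [M [u' eu']] := monomial_pullback d.1 b.1 d.2 b.2 u.
  have := eg' Q psi (x ^ d.1 * y ^ b.1) (x ^ d.2 * y ^ b.2).
  rewrite !mulf_neq0 ?expfz_neq0 // => /(_ isT isT).
  have [-> ->] := inv Q x y x0 y0; rewrite eu rmorphM evh //.
  move=> E; have {E} := congr1 (fun s => (x * y) ^+ M * s) E.
  rewrite (_ : (x * y) ^+ M * (_ * ev2 psi _ _ u) = x ^ n.1 * y ^ n.2 *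
    ev2 psi x y h' * ((x * y) ^+ M *
      ev2 psi (x ^ d.1 * y ^ b.1) (x ^ d.2 * y ^ b.2) u)); last by ring.
  rewrite -eu' //.
  have [i [j e]] : exists i j : int, (x * y) ^+ M *
      (x ^ d.1 * y ^ b.1 * (x ^ d.2 * y ^ b.2)) ^+ N = x ^ i * y ^ j.
    exists (Posz M + (d.1 + d.2) * Posz N), (Posz M + (b.1 + b.2) * Posz N).
    rewrite mulrACA -!expfzDr // !exprnP !expfzMl !exprz_exp !expfzDr //.
    by ring.
  rewrite mulrA e => {e} E.
  have {E} E : x ^ (i - n.1) * y ^ (j - n.2) * ev2 psi x y g =
      ev2 psi x y h' * ev2 psi x y u'.
    rewrite !expfzDr // -!invr_expz.
    have nx := expfz_neq0 n.1 x0; have ny := expfz_neq0 n.2 y0.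
    apply: (mulfI nx); apply: (mulfI ny).
    transitivity (x ^ i * y ^ j * ev2 psi x y g); first by field; rewrite nx ny.
    by rewrite -E; ring.
  move: (i - n.1) (j - n.2) E => {i j} i j E.
  have [i1 [i2 ei]] : exists i1 i2 : nat, x ^+ i2 * x ^ i = x ^+ i1.
    have le : 0 <= `|i|%N%:Z + i by lia.
    by exists (absz (`|i|%N%:Z + i)), `|i|%N; rewrite !exprnP -expfzDr // (gez0_abs le).
  have [j1 [j2 ej]] : exists j1 j2 : nat, y ^+ j2 * y ^ j = y ^+ j1.
    have le : 0 <= `|j|%N%:Z + j by lia.
    by exists (absz (`|j|%N%:Z + j)), `|j|%N; rewrite !exprnP -expfzDr // (gez0_abs le).
  have E' : 'X ^+ i1 * ('X%:P ^+ j1 * g) = h' * ('X ^+ i2 * 'X%:P ^+ j2 * u').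
    apply: inj; rewrite !rmorphM !rmorphXn !ev2X !ev2Y -ei -ej.
    transitivity (x ^+ i2 * y ^+ j2 *
      (x ^ i * y ^ j * ev2 psi x y g)); first by ring.
    by rewrite E; ring.
  by have [w /(cancel_Y hY)] := cancel_X hX E'.
- move=> s; have [a1 [b1 [b0 e]]] := frac s.
  have [M [a2 ea]] := monomial_pullback d.1 b.1 d.2 b.2 a1.
  have [N [b2 eb]] := monomial_pullback d.1 b.1 d.2 b.2 b1.
  exists (a2 * ('X * 'X%:P) ^+ N), (b2 * ('X * 'X%:P) ^+ M).
  rewrite !rmorphM !rmorphXn !rmorphM !ev2X !ev2Y ea // eb //.
  have XY : X * Y != 0 by rewrite mulf_neq0.
  split; first by rewrite !mulf_neq0 ?expf_neq0.
  by rewrite -e; ring.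
- by apply: contraNneq h0 => e; apply/eqP/bicoef_inj => m; rewrite hh' e !bicoef0.
Qed.

End FunctionFieldChange.

(** * Places of plane curves *)

Lemma simple_rootP (K : fieldType) (p : {poly K}) r :
  simple_root p r <-> p.[r] = 0 /\ p^`().[r] != 0.
Proof.
rewrite /simple_root; split=> [m1|[pr dpr]].
  (* By the convention of [mup], every element has multiplicity 0 as a root of the zero
     polynomial. *)
  have p0 : p != 0.
    apply/eqP => p0; move: m1; rewrite p0 /mup.
    by case: arg_maxnP => // -[[|i] hi] //=; rewrite size_poly0 in hi.
  have : ('X - r%:P) ^+ 1 %| p by rewrite -mup_geq // m1.
  have : ~~ (('X - r%:P) ^+ 2 %| p) by rewrite -mup_geq // m1.
  rewrite expr1 => n2 /dvdpP[q e]; rewrite e hornerM hornerXsubC subrr mulr0; split=> //.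
  rewrite derivM derivXsubC mulr1 !hornerE subrr mulr0 add0r.
  apply: contra n2 => /eqP/rootP; rewrite -dvdp_XsubCl => /dvdpP[u eu].
  by rewrite e eu exprS expr1 -mulrA dvdp_mull.
have p0 : p != 0 by apply: contraNneq dpr => ->; rewrite linear0 horner0.
apply/eqP; rewrite eqn_leq mup_geq // expr1 dvdp_XsubCl; apply/andP; split; last exact/rootP.
rewrite mup_leq //; apply: contra dpr => /dvdpP[u ->].
have := derivXsubC r; have := hornerXsubC r r; move: ('X - r%:P) => b.
rewrite subrr => br b1.
by rewrite exprS expr1 !derivM b1 !(hornerD, hornerM) br !(mulr0, mul0r, addr0).
Qed.

Lemma multiple_rootP (K : fieldType) (p : {poly K}) a :
  multiple_root p a -> exists q, p = ('X - a%:P) ^+ 2 * q.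
Proof.
rewrite /multiple_root => m1; have p0 : p != 0.
  apply/eqP => p0; move: m1; rewrite p0 /mup.
  by case: arg_maxnP => // -[[|i] hi] //=; rewrite size_poly0 in hi.
by move: m1; rewrite mup_geq // => /dvdpP[q e]; exists q; rewrite e mulrC.
Qed.

Lemma root_simple_or_multiple (K : fieldType) (p : {poly K}) r : p != 0 ->
  p.[r] = 0 -> simple_root p r \/ multiple_root p r.
Proof.
move=> p0 /rootP; rewrite -dvdp_XsubCl -[_ - _]expr1 -mup_geq //.
by rewrite /simple_root /multiple_root leq_eqVlt => /orP[/eqP <-|]; [left|right].
Qed.

Lemma multiple_not_simple (K : fieldType) (p : {poly K}) r :
  simple_root p r -> ~ multiple_root p r.
Proof. by rewrite /simple_root /multiple_root => ->. Qed.

Section LocalPrincipal.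
Variables (A : comNzRingType) (K F : fieldType).
Variables (psi : {rmorphism A -> F}) (ev : {rmorphism A -> K}).
Variables (tau sigma u w : A).
Hypothesis gen : forall a, ev a = 0 -> exists a1 a2, a = sigma * a1 + tau * a2.
Hypothesis rel : psi (sigma * u + tau * w) = 0.
Hypothesis u0 : psi u != 0.
Hypothesis evu : ev u != 0.

(** The relation sigma u + tau w = 0, with u a unit at the point, eliminates the generator sigma. It
    will be the first-order Taylor expansion of the equation of the curve. *)
Lemma two_generators_principal a : ev a = 0 ->
  exists s c, localization psi ev s c /\ psi a = psi tau * s.
Proof.
move=> /gen[a1 [a2 e]]; exists (psi (a2 * u - a1 * w) / psi u).
exists (ev (a2 * u - a1 * w) / ev u); split.
  exists (a2 * u - a1 * w), u; split=> //; last by rewrite divfK.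
  by rewrite divfK.
have /eqP := rel; rewrite rmorphD !rmorphM addr_eq0 => /eqP es.
apply: (mulIf u0); rewrite mulrA divfK // e rmorphD rmorphB !rmorphM.
transitivity (psi sigma * psi u * psi a1 + psi tau * psi a2 * psi u); first by ring.
by rewrite es; ring.
Qed.

Lemma two_generators_eq0 : psi tau = 0 -> psi sigma = 0.
Proof.
move=> t0; have /eqP := rel; rewrite rmorphD !rmorphM t0 mul0r addr0 mulf_eq0.
by rewrite (negbTE u0) orbF => /eqP.
Qed.

End LocalPrincipal.

Section PlanePlace.
Variables (K : closedFieldType) (F : fieldType) (phi : {rmorphism K -> F}).

Lemma taylor1 (r s : K) (g : {poly {poly K}}) : exists g1 g2,
  g = (ev2id K r s g)%:P%:P + ('X - r%:P%:P) * g1 + ('X - s%:P)%:P * g2.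
Proof.
elim/bipoly_ind: g => [c|||u v [u1 [u2 eu]] [v1 [v2 ev]]|u v [u1 [u2 eu]] [v1 [v2 ev]]].
- by exists 0, 0; rewrite ev2C !mulr0 !addr0.
- by exists 1, 0; rewrite ev2X mulr1 mulr0 addr0 addrC subrK.
- by exists 0, 1; rewrite ev2Y mulr0 addr0 mulr1 polyCB addrC subrK.
- exists (u1 + v1), (u2 + v2); rewrite rmorphD !polyCD.
  by rewrite {1}eu {1}ev; ring.
- exists (u1 * v + (ev2id K r s u)%:P%:P * v1), (u2 * v + (ev2id K r s u)%:P%:P * v2).
  transitivity (((ev2id K r s u)%:P)%:P * v + ('X - (r%:P)%:P) * u1 * v +
    (('X - s%:P)%:P) * u2 * v); first by rewrite {1}eu; ring.
  by rewrite {1}ev rmorphM !polyCM; ring.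
Qed.

Lemma evid_deriv1 r s (g g1 g2 : {poly {poly K}}) c :
  g = c%:P%:P + ('X - r%:P%:P) * g1 + ('X - s%:P)%:P * g2 ->
  ev2id K r s g^`() = ev2id K r s g1 /\
  ev2id K r s (map_poly (@deriv K) g) = ev2id K r s g2.
Proof.
have e1 : ev2id K r s ('X - r%:P%:P) = 0 by rewrite rmorphB ev2X ev2C subrr.
have e2 : ev2id K r s ('X - s%:P)%:P = 0 by rewrite evP hornerXsubC subrr.
move=> ->; split.
  rewrite !derivD derivC add0r !derivM derivXsubC derivC mul0r add0r mul1r.
  move: ('X - s%:P)%:P e2 ('X - r%:P%:P) e1 => b e2 a e1.
  by rewrite !rmorphD !rmorphM e1 e2 !mul0r !addr0.
have m1 : map_poly (@deriv K) ('X - r%:P%:P) = 0.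
  by rewrite -!polyCN map_derivD map_derivX map_derivC derivC add0r.
have m2 : map_poly (@deriv K) ('X - s%:P)%:P = 1 by rewrite map_derivC derivXsubC.
rewrite !map_derivD !map_derivM map_derivC derivC m1 m2.
move: ('X - s%:P)%:P e2 ('X - r%:P%:P) e1 {m1 m2} => b e2 a e1.
by rewrite !mul0r !add0r mul1r !rmorphD !rmorphM e1 e2 !mul0r add0r addr0.
Qed.

Section Point.
Variables (h : {poly {poly K}}) (X Y : F) (r s : K).
Hypothesis ff : function_field h phi X Y.
Hypothesis hrs : ev2id K r s h = 0.

Definition plane_place := localization (ev2 phi X Y) (ev2id K r s).

Let well_defined a : ev2 phi X Y a = 0 -> ev2id K r s a = 0.
Proof. by case: ff => dvd _ _ /dvd[u ->]; rewrite rmorphM hrs mul0r. Qed.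

Let cst : {rmorphism K -> {poly {poly K}}} := polyC \o polyC.

Lemma plane_place_place : place phi plane_place.
Proof.
by apply: (@localization_place _ _ _ phi cst) => // c; rewrite /= ev2C.
Qed.

Lemma plane_placeX : plane_place X r.
Proof. by have := localization_ev (ev2 phi X Y) (ev2id K r s) 'X; rewrite !ev2X. Qed.

Lemma plane_placeY : plane_place Y s.
Proof. by have := localization_ev (ev2 phi X Y) (ev2id K r s) 'X%:P; rewrite !ev2Y. Qed.

(** Otherwise [h] would divide both X - r and Y - s and be constant, hence 0 because it vanishes at
    (r, s). This makes the candidate uniformizer nonzero. *)
Lemma not_both_constant : ~ (X = phi r /\ Y = phi s).
Proof.
case: ff => dvd _ h0 [eX eY].
have [u eu] : exists u, 'X - r%:P%:P = h * u.
  by apply/dvd; rewrite rmorphB ev2X ev2C eX subrr.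
have [v ev] : exists v, ('X - s%:P)%:P = h * v.
  by apply/dvd; rewrite polyCB rmorphB ev2Y ev2C eY subrr.
have v0 : v != 0.
  by apply: contraNneq (XsubC_bipoly_neq0 s) => v0; rewrite ev v0 mulr0.
have sh : (size h <= 1)%N.
  have := congr1 (fun q : {poly {poly K}} => size q) ev.
  rewrite size_polyC polyXsubC_eq0 size_mul // => e.
  have : (0 < size v)%N by rewrite size_poly_gt0.
  by move: e => /=; case: (size v) => // n + _; rewrite addnS /= => e2;
    apply: leq_trans (leq_addr n _) _; rewrite -e2.
have := size1_polyC sh => eh.
have := congr1 (fun q : {poly {poly K}} => q`_1) eu.
rewrite coefB coefX coefC subr0 eh coefCM => /= e1.
have sh0 : (size (h`_0)%R <= 1)%N.
  have e2 := congr1 (fun q : {poly K} => size q) e1.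
  have nz : h`_0 * u`_1 != 0 by rewrite -e1 oner_neq0.
  move: nz; rewrite mulf_eq0 negb_or => /andP[n1 n2].
  have : (0 < size (u`_1)%R)%N by rewrite size_poly_gt0.
  move: e2; rewrite size_poly1 size_mul // /=; case: (size (u`_1)%R) => // n + _.
  by rewrite addnS /= => e2; apply: leq_trans (leq_addr n _) _; rewrite -e2.
move: hrs; rewrite eh evP (size1_polyC sh0) hornerC => c0.
by move: h0; rewrite eh (size1_polyC sh0) c0 eqxx.
Qed.

(** The maximal ideal is generated by X - r and Y - s, and the Taylor expansion of [h] is a relation
    between them with the partial derivatives as leading coefficients. If the X-derivative is
    nonzero at the point, Y - s alone generates, and vice versa. *)
Lemma plane_place_discrete :
  ev2id K r s h^`() != 0 \/ ev2id K r s (map_poly (@deriv K) h) != 0 ->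
  exists t, discrete plane_place t.
Proof.
have [g1 [g2 eh]] := taylor1 r s h; rewrite hrs add0r in eh.
have ehF : ev2 phi X Y h = 0 by case: ff => dvd _ _; apply/dvd; exists 1; rewrite mulr1.
have cstF c : ev2 phi X Y (cst c) = phi c by rewrite /= ev2C.
have cstK c : ev2id K r s (cst c) = c by rewrite /= ev2C.
have frac := ff_frac ff.
have frac' z : exists a b, ev2 phi X Y b != 0 /\ z * ev2 phi X Y b = ev2 phi X Y a.
  exact: frac.
have neq0 a : ev2id K r s a != 0 -> ev2 phi X Y a != 0.
  by apply: contra => /eqP/well_defined ->.
have gen a : ev2id K r s a = 0 -> exists a1 a2,
    a = ('X - r%:P%:P) * a1 + ('X - s%:P)%:P * a2.
  by have [a1 [a2 ea]] := taylor1 r s a => a0; exists a1, a2; rewrite ea a0 add0r.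
have tX : ev2id K r s ('X - r%:P%:P) = 0 by rewrite rmorphB ev2X ev2C subrr.
have tY : ev2id K r s ('X - s%:P)%:P = 0 by rewrite evP hornerXsubC subrr.
have eX : ev2 phi X Y ('X - r%:P%:P) = X - phi r by rewrite rmorphB ev2X ev2C.
have eY : ev2 phi X Y ('X - s%:P)%:P = Y - phi s by rewrite polyCB rmorphB ev2Y ev2C.
have both : ev2 phi X Y ('X - r%:P%:P) = 0 -> ev2 phi X Y ('X - s%:P)%:P = 0 -> False.
  by rewrite eX eY => /subr0_eq e1 /subr0_eq e2; apply: not_both_constant.
have eh0 : h = (0 : K)%:P%:P + ('X - r%:P%:P) * g1 + ('X - s%:P)%:P * g2 by rewrite add0r.
have [-> ->] := evid_deriv1 eh0.
case=> nz; have nzF := neq0 _ nz.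
  have rel : ev2 phi X Y (('X - r%:P%:P) * g1 + ('X - s%:P)%:P * g2) = 0 by rewrite -eh.
  exists (ev2 phi X Y ('X - s%:P)%:P).
  apply: (localization_discrete cstF cstK well_defined frac'
    (function_field_dependent ff) _ tY).
    by apply/eqP => z; apply: both => //; apply: two_generators_eq0 rel nzF z.
  exact: two_generators_principal gen rel nzF nz.
have rel : ev2 phi X Y (('X - s%:P)%:P * g2 + ('X - r%:P%:P) * g1) = 0.
  by rewrite addrC -eh.
exists (ev2 phi X Y ('X - r%:P%:P)).
apply: (localization_discrete cstF cstK well_defined frac'
  (function_field_dependent ff) _ tX).
  by apply/eqP => z; apply: both => //; apply: two_generators_eq0 rel nzF z.
apply: two_generators_principal rel nzF nz => a /gen[a1 [a2 ->]].
by exists a2, a1; rewrite addrC.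
Qed.

End Point.
End PlanePlace.

(** The relation [chart] solved for the variables of f_l. Applied to the generic point, it gives X
    and Y as elements of F. *)
Fixpoint coord (K L : fieldType) (delta : int * int -> int * int)
    (phi : {rmorphism K -> L}) (l : edge_index K) (p : L * L) : L * L :=
  match l with
  | First b => inverse_subst delta b p
  | Next l' a b =>
      let Q := coord delta phi l' p in inverse_subst delta b (Q.1 - phi a, Q.2)
  end.

Lemma restr_horner (K : closedFieldType) (h : {poly {poly K}}) r :
  (restr h).[r] = ev2id K r 0 h.
Proof. by rewrite evE. Qed.

Lemma deriv_restr (K : fieldType) (h : {poly {poly K}}) : (restr h)^`() = restr h^`().
Proof. by rewrite /restr deriv_map. Qed.

Lemma restr_neq0 (K : fieldType) (h : {poly {poly K}}) :
  (forall u, h <> 'X%:P * u) -> restr h != 0.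
Proof.
move=> /biY_ndvd[i]; apply: contraNneq => e.
have := congr1 (fun p : {poly K} => p`_i) e.
by rewrite coef_map coef0 /= /horner_eval horner_coef0 => ->.
Qed.

(** Setting Y = 0 would make (X - a)^2 divide X - a. Consequently X - a is nonzero in F, and the
    next monomial substitution can be inverted. *)
Lemma restr_multiple_ndvd (K : closedFieldType) (h u : {poly {poly K}}) a :
  multiple_root (restr h) a -> 'X - a%:P%:P = h * u -> False.
Proof.
move=> /multiple_rootP[q eq] /(congr1 (map_poly (horner_eval (0 : K)))).
rewrite rmorphM rmorphB /= map_polyX map_polyC /= {1}/horner_eval hornerC.
rewrite -[map_poly _ h]/(restr h) eq => e.
have b0 : 'X - a%:P != 0 :> {poly K} by rewrite polyXsubC_eq0.
have /(mulfI b0) e' : ('X - a%:P) * 1 = ('X - a%:P) *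
    (('X - a%:P) * (q * map_poly (horner_eval 0) u)).
  by rewrite mulr1 {1}e; ring.
have /eqP := congr1 (fun p : {poly K} => p.[a]) e'.
by rewrite hornerM hornerXsubC subrr mul0r -polyC1 hornerC oner_eq0.
Qed.

(** * Valuations and edges of the Newton polygon *)

Section Newton.
Variables (K F : fieldType) (phi : {rmorphism K -> F}) (P : F -> K -> Prop).
Variables (t : F).
Hypotheses (pl : place phi P) (dv : discrete P t).

(** The monomial m has valuation e (b . m) at (x, y). A minimum attained only once could not be
    cancelled by the other terms of g(x, y) = 0, so [b] takes its minimum on the support at least
    twice. *)
Lemma newton_edge (g : {poly {poly K}}) (x y : F) (e : int) (b : int * int) :
  g != 0 -> ev2 phi x y g = 0 -> 0 < e -> vex P t (e * b.1) x ->
  vex P t (e * b.2) y -> coprimez b.1 b.2 ->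
  edge_normal (newton_polygon (bicoef g)) b.
Proof.
move=> g0 gxy e0 vx vy cop; apply/edge_normalP; split=> //.
have [N [_ _]] := bicoef_support g.
set s0 := [seq _ | i <- _, j <- _] => hs0.
pose s := [seq m <- s0 | bicoef g m != 0].
have us : uniq s by rewrite filter_uniq // uniq_square.
have hs m : bicoef g m != 0 = (m \in s).
  by rewrite mem_filter; case: (boolP (_ != 0)) => // /hs0 ->.
have [m0 m0s] : exists m0, m0 \in s.
  apply: NNPP => N0; case/eqP: g0; apply: bicoef_inj => m.
  by rewrite bicoef0; apply/eqP/negPn/negP; rewrite hs => ms; apply: N0; exists m.
have [m1 m1s min1] := seq_argmin (dot b) m0s.
have term m : m \in s ->
    vex P t (e * dot b m) (phi (bicoef g m) * x ^ m.1 * y ^ m.2).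
  rewrite -hs => nz; rewrite /dot mulrDr !mulrA.
  apply: (vexM pl dv); last exact: (vexXz pl dv).
  by rewrite -[_ * m.1]add0r; apply: (vexM pl dv); [apply: (vexC pl)|apply: (vexXz pl dv)].
have [m2 [m2s m21 e2]] : exists m2, [/\ m2 \in s, m2 != m1 & dot b m2 = dot b m1].
  apply: NNPP => N2.
  have big m : m \in s -> m != m1 -> dot b m1 + 1 <= dot b m.
    move=> ms m1m; have := min1 m ms; rewrite le_eqVlt => /orP[/eqP eqd|].
      by case: N2; exists m.
    by rewrite lezD1.
  have := gxy; rewrite (@ev2_support _ _ phi x y g s us); last by move=> m; rewrite hs.
  rewrite (bigD1_seq m1) //= => /eqP; rewrite addr_eq0 => /eqP em.
  have : vge P t (e * dot b m1 + 1) (phi (bicoef g m1) * x ^ m1.1 * y ^ m1.2).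
    rewrite em -mulN1r -[e * _ + 1]add0r; apply: (vgeM pl dv).
      by apply: vge_place; apply: (placeN pl); apply: (place1 pl).
    rewrite big_seq_cond; apply: (big_ind (vge P t (e * dot b m1 + 1))).
    - exact: (vge0 pl).
    - by move=> u v; apply: (vgeD pl).
    - move=> m /andP[ms m1m]; apply: (vge_le pl dv) (vex_vge (term m ms)).
      by have := big m ms m1m; nia.
  by move/(vex_le pl dv (term m1 m1s)); lia.
exists m1, m2; rewrite eq_sym m21 !hs e2; split=> // m.
by rewrite hs; apply: min1.
Qed.

Lemma coprime_scaling (v1 v2 : int) : v1 != 0 \/ v2 != 0 ->
  exists e b, [/\ 0 < e, coprimez b.1 b.2, v1 = e * b.1 & v2 = e * b.2].
Proof.
move=> nz; have g0 : gcdz v1 v2 != 0.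
  by rewrite gcdz_eq0 negb_and; apply/orP.
exists (gcdz v1 v2), ((v1 %/ gcdz v1 v2)%Z, (v2 %/ gcdz v1 v2)%Z).
have e1 : v1 = gcdz v1 v2 * (v1 %/ gcdz v1 v2)%Z by rewrite mulrC divzK ?dvdz_gcdl.
have e2 : v2 = gcdz v1 v2 * (v2 %/ gcdz v1 v2)%Z by rewrite mulrC divzK ?dvdz_gcdr.
have gp : 0 < gcdz v1 v2 by rewrite lt0r g0.
split=> //=; apply/eqP; apply: (mulfI g0).
by rewrite mulr1 -[X in X * _]gez0_abs ?ltW // mulz_gcdr -e1 -e2.
Qed.

Lemma coprime_scaling_unique (e e' : int) (b b' : int * int) : 0 < e -> 0 < e' ->
  coprimez b.1 b.2 -> coprimez b'.1 b'.2 ->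
  e * b.1 = e' * b'.1 -> e * b.2 = e' * b'.2 -> e = e' /\ b = b'.
Proof.
move=> e0 e'0 /eqP c /eqP c' e1 e2.
have ee : e = e'.
  have := mulz_gcdr e b.1 b.2; rewrite c e1 e2 -mulz_gcdr c' !mulr1.
  by rewrite !gez0_abs ?ltW.
split=> //; subst e'; have n0 : e != 0 by rewrite gt_eqF.
by rewrite [b]surjective_pairing [b']surjective_pairing (mulfI n0 e1) (mulfI n0 e2).
Qed.

End Newton.

(** * The iterated edge polynomials *)

Lemma edge_poly_shift (K : fieldType) delta b (f : laurent K) n f0 h :
  (forall m, f m = bicoef f0 (shear (1, 0) (0, 1) n m)) ->
  edge_poly delta b f h <-> edge_poly delta b (bicoef f0) h.
Proof.
move=> E; have E' i j : bicoef f0 (i, j) = f (i + n.1, j + n.2).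
  by rewrite E /shear /dot /= !mul1r !mul0r addr0 add0r !addrK.
split=> -[hX hY [nX [nY e]]]; split=> //.
  exists (nX - dot (delta b) n), (nY - dot b n) => i j.
  by rewrite E' e /dot; congr (bicoef _ (_, _)); ring.
exists (nX + dot (delta b) n), (nY + dot b n) => i j.
rewrite (_ : f (i, j) = bicoef f0 (i - n.1, j - n.2)); last by rewrite E' !subrK.
by rewrite e /dot; congr (bicoef _ (_, _)); ring.
Qed.

Lemma edge_normal_shift (K : fieldType) b (f : laurent K) n f0 :
  (forall m, f m = bicoef f0 (shear (1, 0) (0, 1) n m)) ->
  edge_normal (newton_polygon f) b <-> edge_normal (newton_polygon (bicoef f0)) b.
Proof.
move=> E; pose T (m : int * int) := (m.1 + n.1, m.2 + n.2).
pose T' (m : int * int) := (m.1 - n.1, m.2 - n.2).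
have TK m : T (T' m) = m by rewrite /T /T' /= !subrK -surjective_pairing.
have TK' m : T' (T m) = m by rewrite /T /T' /= !addrK -surjective_pairing.
have E0 m : bicoef f0 m = f (T m).
  by case: m => i j; rewrite E /shear /dot /T /= !mul1r !mul0r addr0 add0r !addrK.
have dT m : dot b (T m) = dot b m + dot b n by rewrite /dot /T /=; ring.
have dT' m : dot b (T' m) = dot b m - dot b n by rewrite /dot /T' /=; ring.
split=> /edge_normalP[cop [m1 [m2 [ne c1 c2 e mi]]]]; apply/edge_normalP; split=> //.
  exists (T' m1), (T' m2); rewrite !E0 !TK; split=> //.
  - by apply: contra ne => /eqP/(congr1 T); rewrite !TK => ->.
  - by rewrite !dT' e.
  - by move=> m; rewrite E0 => /mi; rewrite dT dT' lerBlDr.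
exists (T m1), (T m2); rewrite -!E0; split=> //.
- by apply: contra ne => /eqP/(congr1 T'); rewrite !TK' => ->.
- by rewrite !dT e.
- by move=> m; rewrite -{1}(TK m) -E0 => /mi; rewrite dT dT' lerBrDr.
Qed.

Lemma in_P_nextE (K : fieldType) delta (f : laurent K) l a b h :
  in_P delta f (Next l a b) h -> exists h0,
  [/\ in_P delta f l h0, a != 0 /\ multiple_root (restr h0) a,
    0 < b.1 /\ 0 < b.2,
    edge_normal (newton_polygon (bicoef (translate h0 a))) b &
    edge_poly delta b (bicoef (translate h0 a)) h].
Proof. by move=> H; inversion H; subst; exists h0. Qed.

Lemma in_P_firstE (K : fieldType) delta (f : laurent K) b h :
  in_P delta f (First K b) h ->
  edge_normal (newton_polygon f) b /\ edge_poly delta b f h.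
Proof. by move=> H; inversion H. Qed.

Section Levels.
Variables (K : closedFieldType) (delta : int * int -> int * int).
Hypothesis uni : forall b : int * int, coprimez b.1 b.2 -> unimodular (delta b) b.
Variables (f : laurent K) (f0 : {poly {poly K}}) (n : int * int).
Hypothesis ff0 : forall m, f m = bicoef f0 (shear (1, 0) (0, 1) n m).
Variables (F : fieldType) (phi : {rmorphism K -> F}) (x y : F).
Hypotheses (ff : function_field f0 phi x y) (x0 : x != 0) (y0 : y != 0).

Let co l := coord delta phi l (x, y).

Lemma level_step g x' y' b h : x' != 0 -> y' != 0 -> coprimez b.1 b.2 ->
  function_field g phi x' y' -> edge_poly delta b (bicoef g) h ->
  let Q := inverse_subst delta b (x', y') in
  [/\ in_torus Q, function_field h phi Q.1 Q.2,
    (x', y') = monomial_subst delta b Q &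
    (forall u, h <> 'X * u) /\ (forall u, h <> 'X%:P * u)].
Proof.
move=> x'0 y'0 cop ffg [hX hY [nX [nY e]]] Q.
have tQ : in_torus Q by apply: inverse_subst_torus.
have eQ : monomial_subst delta b Q = (x', y') by apply: inverse_substK => //; apply: uni.
split=> //; case: tQ => Q1 Q2.
apply: (edge_function_field (n := (nX, nY)) (uni cop) Q1 Q2 hX hY).
  by move=> [i j]; apply: e.
by move: eQ => [-> ->].
Qed.

(** The invariant of the recursion: each f_l is an equation of the same field F in its own
    variables. Only the translation could leave the torus, and a multiple root excludes that. *)
Lemma in_P_level l h : in_P delta f l h ->
  [/\ in_torus (co l), function_field h phi (co l).1 (co l).2 &
    (forall u, h <> 'X * u) /\ (forall u, h <> 'X%:P * u)].
Proof.
elim=> {l h} [b h [cop _] ep|l h a b h' _ [[X0 Y0] ffl hXY] a0 ma b1 b2 [cop _] ep].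
  have := level_step x0 y0 cop ff ((edge_poly_shift delta b h ff0).1 ep).
  by case.
have Xa : (co l).1 - phi a != 0.
  rewrite subr_eq0; apply/eqP => e; have [dvd _ _] := ffl.
  have [u eu] : exists u, 'X - a%:P%:P = h * u.
    by apply/dvd; rewrite rmorphB ev2X ev2C e subrr.
  exact: restr_multiple_ndvd ma eu.
by have [tQ fQ _ hQ] := level_step Xa Y0 cop (translate_function_field a ffl) ep; split.
Qed.

Lemma in_P_translate_neq0 l h a : in_P delta f l h -> multiple_root (restr h) a ->
  (co l).1 - phi a != 0.
Proof.
move=> /in_P_level[_ [dvd _ _] _] ma; rewrite subr_eq0; apply/eqP => e.
have [u eu] : exists u, 'X - a%:P%:P = h * u.
  by apply/dvd; rewrite rmorphB ev2X ev2C e subrr.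
exact: restr_multiple_ndvd ma eu.
Qed.

Lemma in_P_functional l h h' : in_P delta f l h -> in_P delta f l h' -> h = h'.
Proof.
move=> H; elim: H h' => {l h} [b h [cop _] ep h' H'|
  l h a b g _ IH a0 ma b1 b2 [cop _] ep h' H'].
  by have [_ ep'] := in_P_firstE H'; apply: edge_poly_unique ep ep'; apply: uni.
have [h0 [H0 _ _ _ ep']] := in_P_nextE H'; have e := IH _ H0; subst h0.
by apply: edge_poly_unique ep ep'; apply: uni.
Qed.

Variables (P : F -> K -> Prop) (t : F).
Hypotheses (pl : place phi P) (dv : discrete P t).

Definition centred l r := P (co l).1 r /\ P (co l).2 0.

Lemma centred_root l h r : in_P delta f l h -> centred l r -> (restr h).[r] = 0.
Proof.
move=> /in_P_level[_ [dvd _ _] _] [hx hy]; rewrite restr_horner.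
apply: (place_uniq pl (place_ev2 pl h hx hy)).
have -> : ev2 phi (co l).1 (co l).2 h = 0 by apply/dvd; exists 1; rewrite mulr1.
exact: place0 pl.
Qed.

Lemma vanishing_power s (k : int) : P s 0 -> 0 < k -> P (s ^ k) 0.
Proof.
case: k => // -[|k] // hs _; have := placeX pl k.+1 hs.
by rewrite expr0n.
Qed.

Lemma monomial_eq l b a h : in_P delta f (Next l a b) h ->
  ((co l).1 - phi a, (co l).2) = monomial_subst delta b (co (Next l a b)) /\
  coprimez b.1 b.2.
Proof.
move=> /in_P_nextE[h0 [H0 [a0 ma] _ [cop _] _]]; split=> //.
rewrite /co /= -/(co l) inverse_substK //; first exact: uni.
split; first exact: in_P_translate_neq0 H0 ma.
by case: (in_P_level H0) => -[].
Qed.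

Lemma monomial_eq_first b h : in_P delta f (First K b) h ->
  (x, y) = monomial_subst delta b (co (First K b)) /\ coprimez b.1 b.2.
Proof.
move=> /in_P_firstE[[cop _] _]; split=> //.
by rewrite /co /= inverse_substK //; apply: uni.
Qed.

(** The previous variables satisfy X - a = X'^d1 Y'^b1 and Y = X'^d2 Y'^b2. Here X' is a unit and Y'
    vanishes at the place; positivity of b1 and b2 makes both left-hand sides vanish. *)
Lemma centred_down l a b h r : in_P delta f (Next l a b) h -> r != 0 ->
  centred (Next l a b) r -> centred l a.
Proof.
move=> H r0 [hx hy]; have [[e1 e2] _] := monomial_eq H.
have [h0 [_ _ [b1 b2] _ _]] := in_P_nextE H; split.
  have -> : (co l).1 = (co l).1 - phi a + phi a by rewrite subrK.
  rewrite -[a in P _ a]add0r; apply: (placeD pl); last exact: (placeC pl).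
  rewrite e1 -(mulr0 (r ^ (delta b).1)); apply: (placeM pl); first exact: (placeXz pl).
  exact: vanishing_power.
rewrite e2 -(mulr0 (r ^ (delta b).2)); apply: (placeM pl); first exact: (placeXz pl).
exact: vanishing_power.
Qed.

(** At the first level Y is a product of powers of x and y, so it would be a unit with residue 0.
    Deeper levels reduce to this one by [centred_down]. *)
Lemma centred_not_torus l h r : in_P delta f l h -> r != 0 -> centred l r ->
  ~ exists c d, [/\ c != 0, d != 0, P x c & P y d].
Proof.
elim: l h r => [b|l IH a b] h r H r0 hc.
  move=> [c [d [c0 d0 hx hy]]]; case: hc => _.
  have : P (co (First K b)).2 (c ^ (- (delta b).2) * d ^ (delta b).1).
    by apply: (placeM pl); apply: (placeXz pl).
  move=> h1 /(place_uniq pl h1)/eqP.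
  by rewrite mulf_eq0 !(negbTE (expfz_neq0 _ _)).
have hd := centred_down H r0 hc; have [h0 [H0 [a0 _] _ _ _]] := in_P_nextE H.
exact: IH H0 a0 hd.
Qed.

Fixpoint depth (l : edge_index K) : nat :=
  match l with First _ => 0 | Next l' _ _ => (depth l').+1 end.

Lemma centred_vex l h r : in_P delta f l h -> r != 0 -> centred l r ->
  vex P t 0 (co l).1 /\ exists2 e, 0 < e & vex P t e (co l).2.
Proof.
move=> /in_P_level[[X0 Y0] _ _] r0 [hx hy]; split; first exact: vex_unit r0 hx.
have [e he le] := vge_vex pl dv Y0 (vge_pos pl dv hy).
by exists e => //; apply: lt_le_trans he.
Qed.

Lemma monomial_vex b (Q : F * F) e u v : (u, v) = monomial_subst delta b Q ->
  vex P t 0 Q.1 -> vex P t e Q.2 -> vex P t (e * b.1) u /\ vex P t (e * b.2) v.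
Proof.
move=> [-> ->] h1 h2; split.
  by rewrite -[e * _]add0r -(mul0r (delta b).1); apply: (vexM pl dv); apply: (vexXz pl dv).
by rewrite -[e * _]add0r -(mul0r (delta b).2); apply: (vexM pl dv); apply: (vexXz pl dv).
Qed.

(** The place determines every choice along the index: a is the residue of X, and the normal vector
    is the primitive vector positively proportional to the valuations of X - a and Y, or of x and y
    at the first level. *)
Lemma centred_same_depth l l' h h' r r' : depth l = depth l' ->
  in_P delta f l h -> in_P delta f l' h' -> r != 0 -> r' != 0 ->
  centred l r -> centred l' r' -> l = l'.
Proof.
elim: l l' h h' r r' => [b|l IH a b] [b'|l' a' b'] h h' r r' //=.
  move=> _ H H' r0 r'0 c c'.
  have [eq1 cop] := monomial_eq_first H; have [eq1' cop'] := monomial_eq_first H'.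
  have [v1 [e e0 v2]] := centred_vex H r0 c.
  have [v1' [e' e'0 v2']] := centred_vex H' r'0 c'.
  have [w1 w2] := monomial_vex eq1 v1 v2; have [w1' w2'] := monomial_vex eq1' v1' v2'.
  by have [_ ->] := coprime_scaling_unique e0 e'0 cop cop'
    (vex_uniq pl dv w1 w1') (vex_uniq pl dv w2 w2').
move=> [ed] H H' r0 r'0 c c'.
have d := centred_down H r0 c; have d' := centred_down H' r'0 c'.
have [eq1 cop] := monomial_eq H; have [eq1' cop'] := monomial_eq H'.
have [v1 [e e0 v2]] := centred_vex H r0 c.
have [v1' [e' e'0 v2']] := centred_vex H' r'0 c'.
have el : l = l'.
  have [g [Hg [a0 _] _ _ _]] := in_P_nextE H.
  have [g' [Hg' [a'0 _] _ _ _]] := in_P_nextE H'.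
  exact: IH ed Hg Hg' a0 a'0 d d'.
subst l'; have ea : a = a' by apply: (place_uniq pl d.1 d'.1).
subst a'.
have [w1 w2] := monomial_vex eq1 v1 v2; have [w1' w2'] := monomial_vex eq1' v1' v2'.
by have [_ ->] := coprime_scaling_unique e0 e'0 cop cop'
  (vex_uniq pl dv w1 w1') (vex_uniq pl dv w2 w2').
Qed.

Lemma centred_prefix l h r d : in_P delta f l h -> r != 0 -> centred l r ->
  (d < depth l)%N -> exists l' h' a, [/\ depth l' = d, in_P delta f l' h', a != 0,
    centred l' a & multiple_root (restr h') a].
Proof.
elim: l h r => [//|l IH a b] h r H r0 c /=.
have hd := centred_down H r0 c; have [h0 [H0 [a0 ma] _ _ _]] := in_P_nextE H.
rewrite ltnS leq_eqVlt => /orP[/eqP ->|]; first by exists l, h0, a.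
exact: IH H0 a0 hd.
Qed.

(** If the depths differed, the shorter index would be a proper prefix of the longer one, and its
    root, being the residue of the same element, would be both simple and multiple. *)
Lemma centred_index_unique l l' r r' :
  root_at_infinity delta f (l, r) -> root_at_infinity delta f (l', r') ->
  centred l r -> centred l' r' -> (l, r) = (l', r').
Proof.
move=> [h /= [H r0 sr]] [h' /= [H' r'0 sr']] c c'.
have key m m' g g' s s' : in_P delta f m g -> in_P delta f m' g' ->
    s != 0 -> s' != 0 -> simple_root (restr g) s -> centred m s -> centred m' s' ->
    ~ (depth m < depth m')%N.
  move=> Hg Hg' s0 s'0 ss cm cm' /(centred_prefix Hg' s'0 cm').
  move=> [l1 [h1 [a [e1 H1 a0 c1 ma]]]].
  have el := centred_same_depth e1 H1 Hg a0 s0 c1 cm; subst l1.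
  have eh := in_P_functional H1 Hg; subst h1.
  have ea : a = s by apply: (place_uniq pl c1.1 cm.1).
  by subst a; apply: multiple_not_simple ss ma.
have ed : depth l = depth l'.
  case: (ltngtP (depth l) (depth l')) => // lt.
    by case: (key _ _ _ _ _ _ H H' r0 r'0 sr c c').
  by case: (key _ _ _ _ _ _ H' H r'0 r0 sr' c' c).
have el := centred_same_depth ed H H' r0 r'0 c c'; subst l'.
by rewrite (place_uniq pl c.1 c'.1).
Qed.

End Levels.

(** * Descent to a simple root *)

Section Resolution.
Variables (K : closedFieldType) (delta : int * int -> int * int).
Hypothesis uni : forall b : int * int, coprimez b.1 b.2 -> unimodular (delta b) b.
Variables (f : laurent K) (f0 : {poly {poly K}}) (n : int * int).
Hypothesis ff0 : forall m, f m = bicoef f0 (shear (1, 0) (0, 1) n m).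
Variables (F : fieldType) (phi : {rmorphism K -> F}) (x y : F).
Hypotheses (ff : function_field f0 phi x y) (x0 : x != 0) (y0 : y != 0).
Variables (P : F -> K -> Prop) (t : F).
Hypotheses (pl : place phi P) (dv : discrete P t).

Let co l := coord delta phi l (x, y).

(** The valuations are e times a primitive vector [b]. By unimodularity the inverse substitution
    turns them into v1 b.2 - v2 b.1 = 0 for X and e for Y. *)
Lemma edge_step g x' y' v1 v2 : function_field g phi x' y' ->
  vex P t v1 x' -> vex P t v2 y' -> v1 != 0 \/ v2 != 0 ->
  exists e b h r, [/\ 0 < e /\ (v1 = e * b.1 /\ v2 = e * b.2),
    edge_normal (newton_polygon (bicoef g)) b, edge_poly delta b (bicoef g) h,
    r != 0 & let Q := inverse_subst delta b (x', y') in P Q.1 r /\ vex P t e Q.2].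
Proof.
move=> ffg vx vy /coprime_scaling[e [b [e0 cop e1 e2]]].
have [dvd _ g0] := ffg.
have gxy : ev2 phi x' y' g = 0 by apply/dvd; exists 1; rewrite mulr1.
have en : edge_normal (newton_polygon (bicoef g)) b.
  by apply: (newton_edge pl dv g0 gxy e0) => //; rewrite -?e1 -?e2.
have [h ep] : exists h, edge_poly delta b (bicoef g) h.
  have [N [_ _ hN]] := bicoef_support g.
  have /edge_normalP[_ [m [_ [_ gm _ _ _]]]] := en.
  exact: edge_poly_exists (uni cop) hN gm.
have u := uni cop; rewrite /unimodular in u.
have vX : vex P t 0 (x' ^ b.2 * y' ^ (- b.1)).
  rewrite (_ : 0 = v1 * b.2 + v2 * - b.1); last by rewrite e1 e2; ring.
  by apply: (vexM pl dv); apply: (vexXz pl dv).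
have vY : vex P t e (x' ^ (- (delta b).2) * y' ^ (delta b).1).
  rewrite (_ : e = v1 * - (delta b).2 + v2 * (delta b).1).
    by apply: (vexM pl dv); apply: (vexXz pl dv).
  by rewrite e1 e2 -[LHS]mulr1 -u; ring.
have [r r0 hr] := vex0_unit vX.
by exists e, b, h, r.
Qed.

Lemma logdX_translate (h : {poly {poly K}}) a X Y :
  ev2 phi (X - phi a) Y (logdX (translate h a)) = (X - phi a) * ev2 phi X Y h^`().
Proof.
rewrite /logdX rmorphM ev2X; congr (_ * _).
have -> : (translate h a)^`() = translate h^`() a.
  by rewrite /translate deriv_comp derivD derivX derivC addr0 mulr1.
by rewrite ev2_translate subrK.
Qed.

Lemma logdY_translate (h : {poly {poly K}}) a X Y :
  ev2 phi (X - phi a) Y (logdY (translate h a)) = ev2 phi X Y (logdY h).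
Proof.
rewrite /logdY !rmorphM !ev2Y; congr (_ * _).
have -> : map_poly (@deriv K) (translate h a) = translate (map_poly (@deriv K) h) a.
  rewrite /translate; elim/bipoly_ind: h => [c|||u v Hu Hv|u v Hu Hv].
  - by rewrite comp_polyC !map_derivC derivC comp_polyC.
  - by rewrite comp_polyX map_derivD map_derivC map_derivX derivC addr0 comp_poly0.
  - by rewrite comp_polyC !map_derivC comp_polyC.
  - by rewrite comp_polyD !map_derivD Hu Hv comp_polyD.
  - by rewrite comp_polyM !map_derivM Hu Hv comp_polyD !comp_polyM.
by rewrite ev2_translate subrK.
Qed.

Lemma restr_translate (h : {poly {poly K}}) a :
  restr (translate h a) = restr h \Po ('X + a%:P).
Proof.
rewrite /restr /translate map_comp_poly rmorphD /= map_polyX map_polyC /=.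
by rewrite /horner_eval hornerC.
Qed.

Lemma multiple_root_coef (h : {poly {poly K}}) a i : multiple_root (restr h) a ->
  (i < 2)%N -> bicoef (translate h a) (Posz i, 0) = 0.
Proof.
move=> /multiple_rootP[q e] i2.
have : (restr (translate h a))`_i = 0.
  rewrite restr_translate e exprS expr1 !comp_polyM comp_polyB comp_polyX comp_polyC.
  by rewrite addrK -mulrA coefXM; case: i i2 => [|[|i]] // _; rewrite coefXM.
by rewrite /restr coef_map /= /horner_eval horner_coef0.
Qed.

(* The two lattice points of the edge are not both [(0, 0)] or [(1, 0)], where
   the coefficients vanish. *)
Lemma multiple_root_shift (h h' : {poly {poly K}}) a b nX nY :
  multiple_root (restr h) a -> 0 < b.1 -> 0 < b.2 ->
  edge_normal (newton_polygon (bicoef (translate h a))) b ->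
  (forall u, h' <> 'X%:P * u) ->
  (forall i j, bicoef (translate h a) (i, j) = bicoef h'
    ((delta b).1 * i + (delta b).2 * j - nX, b.1 * i + b.2 * j - nY)) ->
  unimodular (delta b) b -> b.1 < nY.
Proof.
move=> ma b1 b2 /edge_normalP[_ [m1 [m2 [m12 c1 c2 e12 mi]]]] /biY_ndvd[i0 hi0] e u.
have [m em] : exists m, shear (delta b) b (nX, nY) m = (Posz i0, 0).
  by eexists; apply: (shear_surj (nX, nY) (Posz i0, 0) u).
have cm : bicoef (translate h a) m != 0.
  by case: m em => i j em; rewrite e -[(_ - nX, _)]/(shear (delta b) b (nX, nY) (i, j)) em.
have em2 : dot b m = nY.
  by have := congr1 snd em; rewrite /shear /= => /eqP; rewrite subr_eq0 => /eqP.
have le1 := mi _ cm; rewrite em2 in le1.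
have le2 : nY <= dot b m1.
  by case: m1 c1 {m12 e12 mi le1} => i j; rewrite e => /bicoef_nonneg[_]; rewrite subr_ge0.
have bad i j : bicoef (translate h a) (i, j) != 0 -> i < 2 -> j = 0 -> False.
  move=> nz + j0; have [+ _] := bicoef_nonneg nz; rewrite j0 in nz.
  case: i nz => // i nz _ i2.
  by move: nz; rewrite multiple_root_coef // eqxx.
case: m1 m2 m12 c1 c2 e12 le1 le2 {mi} => [i1 j1] [i2 j2] /eqP m12 c1 c2.
rewrite /dot /= => e12 le1 le2.
have [p1 q1] := bicoef_nonneg c1; have [p2 q2] := bicoef_nonneg c2.
have k1 : 2 <= i1 \/ 1 <= j1.
  by case: (ltP i1 2) => [lt|]; [right; case: (ltP 0 j1) => // le; case: (bad _ _ c1 lt); lia|left].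
have k2 : 2 <= i2 \/ 1 <= j2.
  by case: (ltP i2 2) => [lt|]; [right; case: (ltP 0 j2) => // le; case: (bad _ _ c2 lt); lia|left].
have fin (i j : int) : 1 <= i -> 0 <= j -> 2 <= i \/ 1 <= j ->
    b.1 * i + b.2 * j <= nY -> b.1 < nY.
  move=> i1' j0 [h2|h2]; apply: lt_le_trans.
    have : 0 <= b.1 * (i - 2) by apply: mulr_ge0; lia.
    by have := mulr_ge0 (ltW b2) j0; rewrite mulrBr; lia.
  have : 0 <= b.1 * (i - 1) by apply: mulr_ge0; lia.
  have : 0 <= b.2 * (j - 1) by apply: mulr_ge0; lia.
  by rewrite !mulrBr; lia.
have [z1|z1] := eqVneq i1 0.
  have z2 : i2 != 0.
    apply/eqP => z2; apply: m12; rewrite z1 z2; congr (_, _).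
    have n0 : b.2 != 0 by rewrite gt_eqF.
    by apply: (mulfI n0); move: e12; rewrite z1 z2 !mulr0 !add0r.
  by apply: (fin i2 j2) => //; rewrite -?e12 //; lia.
by apply: (fin i1 j1) => //; lia.
Qed.

(* By [multiple_root_shift], every step lowers the minimum of the valuations of
   the two logarithmic derivatives, here bounded by [k]. *)
Lemma resolution (k : nat) l h a : in_P delta f l h -> a != 0 ->
  centred delta phi x y P l a ->
  ~ (vge P t k (ev2 phi (co l).1 (co l).2 (logdX h)) /\
     vge P t k (ev2 phi (co l).1 (co l).2 (logdY h))) ->
  exists l' r, root_at_infinity delta f (l', r) /\ centred delta phi x y P l' r.
Proof.
elim: k l h a => [|k IH] l h a H a0 c nv.
  by case: nv; split; apply: vge_place; apply: (place_ev2 pl _ c.1 c.2).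
have [[X0 Y0] ffl [hX hY]] := in_P_level uni ff0 ff x0 y0 H.
have := centred_root uni ff0 ff x0 y0 pl H c.
case/(root_simple_or_multiple (restr_neq0 hY)) => [sr|ma].
  by exists l, a; split=> //; exists h.
have Xa := in_P_translate_neq0 uni ff0 ff x0 y0 H ma.
move: (c) => [hcX hcY].
have Xa0 : P ((co l).1 - phi a) 0.
  by rewrite -(subrr a); apply: (placeB pl) hcX _; apply: (placeC pl).
have [e1 le1 v1] := vge_vex pl dv Xa (vge_pos pl dv Xa0).
have [e2 le2 v2] := vge_vex pl dv Y0 (vge_pos pl dv hcY).
have ffg := translate_function_field a ffl.
have [|e [b [h' [r [[e0 [ee1 ee2]] en ep r0 [hr he]]]]]] := edge_step ffg v1 v2.
  by left; lia.
have b1 : 0 < b.1 by nia.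
have b2 : 0 < b.2 by nia.
have H' : in_P delta f (Next l a b) h' by apply: in_P_next ep.
have c' : centred delta phi x y P (Next l a b) r.
  by split=> //=; apply: (vge_place0 pl dv e0); apply: vex_vge.
apply: (IH _ _ _ H' r0 c') => -[g1 g2]; apply: nv.
have [[X'0 Y'0] _ [hX' hY']] := in_P_level uni ff0 ff x0 y0 H'.
have [me cop] := monomial_eq uni ff0 ff x0 y0 H'.
case: (ep) => _ _ [nX [nY enn]].
have ltn := multiple_root_shift ma b1 b2 en hY' enn (uni cop).
set X := (co l).1 in Xa Xa0 v1 ffg me hcX *; set Y := (co l).2 in v2 ffg me *.
set X' := (co (Next l a b)).1 in X'0 me g1 g2 hr *.
set Y' := (co (Next l a b)).2 in Y'0 me g1 g2 he *.
have ehh m : bicoef (translate h a) m = bicoef h' (shear (delta b) b (nX, nY) m).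
  by case: m => i j; apply: enn.
case: me; rewrite -/X' -/Y' => meX meY.
have gz : ev2 phi (X' ^ (delta b).1 * Y' ^ b.1) (X' ^ (delta b).2 * Y' ^ b.2)
    (translate h a) = 0.
  by rewrite -meX -meY; case: ffg => dvd _ _; apply/dvd; exists 1; rewrite mulr1.
have r1 := edge_logdX (uni cop) X'0 Y'0 ehh gz.
have r2 := edge_logdY (uni cop) X'0 Y'0 ehh gz.
rewrite -meX -meY /= in r1 r2.
set A := ev2 _ _ _ (logdX (translate h a)) in r1 r2.
set B := ev2 _ _ _ (logdY (translate h a)) in r1 r2.
have vu : vex P t (e * nY) (X' ^ nX * Y' ^ nY).
  rewrite -[e * nY]add0r -(mul0r nX); apply: (vexM pl dv).
    by apply: (vexXz pl dv); apply: (vex_unit t r0 hr).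
  exact: (vexXz pl dv).
have vge_int (z : int) s m : vge P t m s -> vge P t m (z%:~R * s).
  move=> hs; rewrite -[m]add0r; apply: (vgeM pl dv) hs; apply: vge_place.
  by rewrite -(rmorph_int phi); apply: (placeC pl).
have w1 := vgeM pl dv (vex_vge vu) g1; rewrite r1 in w1.
have w2 := vgeM pl dv (vex_vge vu) g2; rewrite r2 in w2.
have u := uni cop; rewrite /unimodular in u.
have uF : (delta b).1%:~R * b.2%:~R - (delta b).2%:~R * b.1%:~R = 1 :> F.
  by rewrite -!intrM -intrB u.
(* [A] and [B] are recovered from their two combinations by the inverse unimodular matrix, which is
   integral and thus keeps the bound. *)
have vA : vge P t (e * nY + k) A.
  have -> : A = b.2%:~R * ((delta b).1%:~R * A + (delta b).2%:~R * B) +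
      (- (delta b).2)%:~R * (b.1%:~R * A + b.2%:~R * B).
    transitivity (((delta b).1%:~R * b.2%:~R - (delta b).2%:~R * b.1%:~R) * A).
      by rewrite uF mul1r.
    by rewrite rmorphN; ring.
  by apply: (vgeD pl); apply: vge_int.
have vB : vge P t (e * nY + k) B.
  have -> : B = (- b.1)%:~R * ((delta b).1%:~R * A + (delta b).2%:~R * B) +
      (delta b).1%:~R * (b.1%:~R * A + b.2%:~R * B).
    transitivity (((delta b).1%:~R * b.2%:~R - (delta b).2%:~R * b.1%:~R) * B).
      by rewrite uF mul1r.
    by rewrite rmorphN; ring.
  by apply: (vgeD pl); apply: vge_int.
have le_eb : 0 <= e * b.1 by apply: mulr_ge0; lia.
(* Going back from the translated polynomial to [h] costs at most e b.1, the valuation of X - a,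
   while the removed monomial contributes e nY. The difference is at least e, which supplies the
   step from k to k + 1. *)
have le_en : e * b.1 + e <= e * nY.
  have : 0 <= e * (nY - (b.1 + 1)) by rewrite mulr_ge0 ?(ltW e0) // subr_ge0 lezD1.
  by rewrite mulrBr mulrDr mulr1 subr_ge0.
split.
  move: vA; rewrite /A logdX_translate => /(vge_div pl dv v1) vD.
  rewrite /logdX rmorphM ev2X -[_%:Z]add0r; apply: (vgeM pl dv).
    exact: vge_place hcX.
  by apply: (vge_le pl dv) vD; rewrite ee1; lia.
move: vB; rewrite /B logdY_translate; apply: (vge_le pl dv).
by lia.
Qed.

Hypothesis logd_neq0 :
  ~ (ev2 phi x y (logdX f0) = 0 /\ ev2 phi x y (logdY f0) = 0).

Lemma place_at_infinity : ~ (exists c d, [/\ c != 0, d != 0, P x c & P y d]) ->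
  exists l r, root_at_infinity delta f (l, r) /\ centred delta phi x y P l r.
Proof.
move=> ninf; have [v1 hv1] := vexP dv x0; have [v2 hv2] := vexP dv y0.
have nz : v1 != 0 \/ v2 != 0.
  apply: NNPP => N; apply: ninf; have [z1 z2] : v1 = 0 /\ v2 = 0.
    by split; apply/eqP/negPn/negP => nz; apply: N; [left|right].
  subst; have [c c0 hc] := vex0_unit hv1; have [d d0 hd] := vex0_unit hv2.
  by exists c, d.
have [e [b [h [r [[e0 [ee1 ee2]] en ep r0 [hr he]]]]]] := edge_step ff hv1 hv2 nz.
have H : in_P delta f (First K b) h.
  apply: in_P_first; first by apply/(edge_normal_shift b ff0).
  by apply/(edge_poly_shift delta b h ff0).
have c : centred delta phi x y P (First K b) r.
  by split=> //=; apply: (vge_place0 pl dv e0); apply: vex_vge.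
have [[X0 Y0] ffl _] := in_P_level uni ff0 ff x0 y0 H.
have [me cop] := monomial_eq_first uni phi x0 y0 H.
set X := (co (First K b)).1 in X0 ffl me *; set Y := (co (First K b)).2 in Y0 ffl me *.
(* The matrix relating the two pairs of logarithmic derivatives is invertible, so they do not both
   become 0. The valuation of a nonzero one then bounds the number of steps. *)
have nlog : ~ (ev2 phi X Y (logdX h) = 0 /\ ev2 phi X Y (logdY h) = 0).
  move=> [z1 z2]; apply: logd_neq0; case: ep => _ _ [nX [nY enn]].
  have ehh m : bicoef f0 m = bicoef h (shear (delta b) b (nX, nY) m).
    by case: m => i j; apply: enn.
  case: me; rewrite -/X -/Y => meX meY.
  have gz : ev2 phi (X ^ (delta b).1 * Y ^ b.1) (X ^ (delta b).2 * Y ^ b.2) f0 = 0.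
    by rewrite -meX -meY; case: ff => dvd _ _; apply/dvd; exists 1; rewrite mulr1.
  have := edge_logdX (uni cop) X0 Y0 ehh gz; have := edge_logdY (uni cop) X0 Y0 ehh gz.
  rewrite -meX -meY z1 z2 !mulr0; move: (ev2 _ _ _ _) (ev2 _ _ _ _) => B A r2 r1.
  have u := uni cop; rewrite /unimodular in u.
  have uF : (delta b).1%:~R * b.2%:~R - (delta b).2%:~R * b.1%:~R = 1 :> F.
    by rewrite -!intrM -intrB u.
  split.
    rewrite -[LHS]mul1r -uF.
    transitivity (b.2%:~R * ((delta b).1%:~R * A + (delta b).2%:~R * B) -
      (delta b).2%:~R * (b.1%:~R * A + b.2%:~R * B)); first by ring.
    by rewrite -r1 -r2 !mulr0 subr0.
  rewrite -[LHS]mul1r -uF.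
  transitivity ((delta b).1%:~R * (b.1%:~R * A + b.2%:~R * B) -
    b.1%:~R * ((delta b).1%:~R * A + (delta b).2%:~R * B)); first by ring.
  by rewrite -r1 -r2 !mulr0 subr0.
have bound s : s != 0 -> exists k : nat, ~ vge P t k s.
  move=> /(vexP dv)[m hm]; exists `|m|%N.+1 => /(vex_le pl dv hm) le.
  by have := le_trans le (lez_abs m); rewrite lez_nat ltnn.
have [z1|/bound[k nk]] := eqVneq (ev2 phi X Y (logdX h)) 0; last first.
  by apply: (@resolution k _ _ _ H r0 c) => -[].
have [z2|/bound[k nk]] := eqVneq (ev2 phi X Y (logdY h)) 0; last first.
  by apply: (@resolution k _ _ _ H r0 c) => -[].
by case: nlog.
Qed.

End Resolution.

(** * Points of the smooth completion *)

Lemma dhomog_map (N d : nat) (k K : fieldType) (iota : {rmorphism k -> K})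
    (Q : {mpoly k[N]}) : Q \is d.-homog -> map_mpoly iota Q \is d.-homog.
Proof.
move=> /dhomogP hQ; apply/dhomogP => u; rewrite mcoeff_msupp mcoeff_map_mpoly.
by rewrite fmorph_eq0 -mcoeff_msupp => /hQ.
Qed.

Section Homogeneous.
Variables (N : nat) (K L : fieldType) (phi : {rmorphism K -> L}).

Lemma mmap_ext (z z' : 'I_N -> L) (p : {mpoly K[N]}) : z =1 z' ->
  mmap phi z p = mmap phi z' p.
Proof. by move=> e; apply: eq_bigr => m _; rewrite (mmap1_eq _ e). Qed.

Lemma mmap_homog_scale d (p : {mpoly K[N]}) c (z : 'I_N -> L) : p \is d.-homog ->
  mmap phi (fun i => c * z i) p = c ^+ d * mmap phi z p.
Proof.
move=> /dhomogP hp; rewrite /mmap mulr_sumr; apply: eq_big_seq => m /hp md.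
rewrite mulrCA; congr (_ * _); rewrite /mmap1.
under eq_bigr do rewrite exprMn.
by rewrite big_split /= prodrXr -md /= mdegE.
Qed.

Lemma mmap_homog_div d (p : {mpoly K[N]}) j (z : 'I_N -> L) : p \is d.-homog ->
  z j != 0 -> mmap phi z p = z j ^+ d * mmap phi (fun i => z i / z j) p.
Proof.
move=> hp zj; rewrite -(mmap_homog_scale _ _ hp); apply: mmap_ext => i.
by rewrite mulrC divfK.
Qed.

End Homogeneous.

(** Every sufficiently large degree is allowed, so that several polynomials can be homogenized to a
    common degree. *)
Lemma homogenization (N : nat) (K : fieldType) (j : 'I_N) (p : {mpoly K[N]}) :
  exists D0 : nat, forall D, (D0 <= D)%N -> exists2 q : {mpoly K[N]},
    q \is D.-homog & forall (L : fieldType) (phi : {rmorphism K -> L}) (z : 'I_N -> L),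
      z j != 0 -> mmap phi z q = z j ^+ D * mmap phi (fun i => z i / z j) p.
Proof.
exists (msize p) => D le.
exists (\sum_(m <- msupp p) p@_m *: ('X_[m] * 'X_j ^+ (D - mdeg m))).
  rewrite big_seq; apply: rpred_sum => m ms; apply: rpredZ.
  have lt := leq_trans (msize_mdeg_lt ms) le.
  have : ('X_[m] * 'X_j ^+ (D - mdeg m) : {mpoly K[N]})
      \is (mdeg m + 1 * (D - mdeg m)).-homog.
    apply: dhomogM; first by rewrite dhomogX.
    by apply: dhomogMn; rewrite dhomogX /= mdeg1.
  by rewrite mul1n subnKC // ltnW.
move=> L phi z zj; rewrite raddf_sum [in RHS]/mmap mulr_sumr.
apply: eq_big_seq => m ms /=; have lt := leq_trans (msize_mdeg_lt ms) le.
rewrite mmapZ rmorphM rmorphXn /= !mmapX mmap1U.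
have eD : z j ^+ D = z j ^+ mdeg m * z j ^+ (D - mdeg m).
  by rewrite -exprD subnKC // ltnW.
suff -> : mmap1 z m = z j ^+ mdeg m * mmap1 (fun i => z i / z j) m.
  by rewrite eD; ring.
rewrite /mmap1 mdegE -prodrXr -big_split /=; apply: eq_bigr => i _.
by rewrite -exprMn mulrC divfK.
Qed.

Lemma homogeneous_bipoly (N : nat) (K : fieldType) d (A B D : {mpoly K[N]}) h :
  A \is d.-homog -> B \is d.-homog -> D \is d.-homog ->
  exists e0 : nat, forall e, (e0 <= e)%N -> exists2 T : {mpoly K[N]},
    T \is (d * e).-homog & forall v, D.@[v] != 0 ->
      T.@[v] = D.@[v] ^+ e * ev2 (idfun : {rmorphism K -> K})
        (A.@[v] / D.@[v]) (B.@[v] / D.@[v]) h.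
Proof.
move=> hA hB hD; elim/bipoly_ind: h => [c|||u w [e1 H1] [e2 H2]|u w [e1 H1] [e2 H2]].
- exists 0%N => e _; exists (c *: D ^+ e); first by rewrite rpredZ // dhomogMn.
  by move=> v _; rewrite ev2C mevalZ rmorphXn /= mulrC.
- exists 1%N => -[//|e] _; exists (A * D ^+ e).
    by rewrite mulnS; apply: dhomogM => //; apply: dhomogMn.
  by move=> v D0; rewrite ev2X rmorphM rmorphXn /= exprS; field.
- exists 1%N => -[//|e] _; exists (B * D ^+ e).
    by rewrite mulnS; apply: dhomogM => //; apply: dhomogMn.
  by move=> v D0; rewrite ev2Y rmorphM rmorphXn /= exprS; field.
- exists (e1 + e2)%N => e le.
  have [|T1 h1 E1] := H1 e; first exact: leq_trans (leq_addr _ _) le.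
  have [|T2 h2 E2] := H2 e; first exact: leq_trans (leq_addl _ _) le.
  exists (T1 + T2); first exact: rpredD.
  by move=> v D0; rewrite !rmorphD /= E1 // E2 // mulrDr.
- exists (e1 + e2)%N => e le.
  have [|T1 h1 E1] := H1 (e - e2)%N; first by lia.
  have [T2 h2 E2] := H2 e2 (leqnn _).
  have le2 : (e2 <= e)%N by lia.
  exists (T1 * T2); first by rewrite -(subnK le2) mulnDr; apply: dhomogM.
  move=> v D0; rewrite !rmorphM /= E1 // E2 //.
  by rewrite -{2}(subnK le2) exprD; ring.
Qed.

Lemma laurent_bipoly (K : fieldType) (h : laurent K) : exists h' n,
  forall m, h m = bicoef h' (shear (1, 0) (0, 1) n m).
Proof.
have [[m0 hm0]|N] := classic (exists m, h m != 0).
  have [|h' [_ _ [n1 [n2 E]]]] := @edge_poly_exists K (fun=> (1, 0)) (0, 1) h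
    (finsupp h) m0 erefl _ hm0; first by move=> m; rewrite mem_finsupp.
  by exists h', (n1, n2) => -[i j]; rewrite E.
exists 0, (0, 0) => m; have -> : h m = 0.
  by apply/eqP/negPn/negP => nz; apply: N; exists m.
by rewrite bicoef0.
Qed.

(** * Generic points of the curve *)

Section Transfer.
Variables (K : closedFieldType) (f0 : {poly {poly K}}) (F : fieldType).
Variables (phi : {rmorphism K -> F}) (x y : F).
Hypotheses (ff : function_field f0 phi x y) (x0 : x != 0) (y0 : y != 0).
Hypothesis van : forall b, ev2 phi x y b = 0 <-> vanishes f0 b.
Hypothesis smooth : smooth_plane f0.

Notation Pp p := (plane_place phi x y p.1 p.2).

Lemma curve_place p : plane_curve f0 p ->
  place phi (Pp p) /\ exists t, discrete (Pp p) t.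
Proof.
move=> Cp; have [_ e] := Cp; split; first exact: plane_place_place ff e.
apply: (plane_place_discrete ff e).
case: (smooth Cp) => nz; [left|right]; apply: contra nz => /eqP z.
  by rewrite /logdX rmorphM z mulr0.
by rewrite /logdY rmorphM z mulr0.
Qed.

Lemma curve_place_leval p h : plane_curve f0 p ->
  Pp p (leval (lmap phi h) (x, y)) (leval h p).
Proof.
move=> Cp; have [[p10 p20] _] := Cp.
rewrite [p in leval h p]surjective_pairing.
apply: (place_leval (curve_place Cp).1) => //.
  exact: plane_placeX.
exact: plane_placeY.
Qed.

(** With [generic_curve_point] this turns identities at points into identities in F: a nonzero
    difference would have a nonzero value at some point. Exceptional sets are given by polynomials
    [D], so that finitely many can be avoided by a product. *)
Lemma generic_neq0 s : s != 0 -> exists2 D, ev2 phi x y D != 0 &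
  forall p, plane_curve f0 p -> ev2id K p.1 p.2 D != 0 ->
    exists2 c, c != 0 & Pp p s c.
Proof.
move=> s0; have [a [b [b0 e]]] := ff_frac ff s.
have a0 : ev2 phi x y a != 0 by rewrite -e mulf_neq0.
exists (a * b); first by rewrite rmorphM mulf_neq0.
move=> p Cp; rewrite rmorphM mulf_eq0 negb_or => /andP[na nb].
exists (ev2id K p.1 p.2 a / ev2id K p.1 p.2 b).
  by rewrite mulf_neq0 ?invr_eq0.
by exists a, b; rewrite divfK.
Qed.

Lemma generic_curve_point D : ev2 phi x y D != 0 ->
  exists2 p, plane_curve f0 p & ev2id K p.1 p.2 D != 0.
Proof.
move=> D0; apply: NNPP => N; case/eqP: D0; apply/van => p Cp.
by apply/eqP/negPn/negP => nz; apply: N; exists p.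
Qed.

Variables (delta : int * int -> int * int) (f : laurent K) (n : int * int).
Hypothesis uni : forall b : int * int, coprimez b.1 b.2 -> unimodular (delta b) b.
Hypothesis ff0 : forall m, f m = bicoef f0 (shear (1, 0) (0, 1) n m).

Let co l := coord delta phi l (x, y).

Lemma chart_place l h p Q : in_P delta f l h -> plane_curve f0 p ->
  chart delta l p Q -> Pp p (co l).1 Q.1 /\ Pp p (co l).2 Q.2.
Proof.
move=> H Cp; have [pl _] := curve_place Cp; have [[p10 p20] _] := Cp.
elim: l h Q H => [b|l IH a b] h Q H /=.
  move=> [tQ ep]; have [[cop _] _] := in_P_firstE H.
  have <- : inverse_subst delta b p = Q by rewrite ep monomial_substK //; apply: uni.
  have hX := plane_placeX phi x y p.1 p.2; have hY := plane_placeY phi x y p.1 p.2.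
  by split; apply: (placeM pl); apply: (placeXz pl).
move=> [tQ [Q' [cQ' eQ]]].
have [h0 [H0 _ _ [cop _] _]] := in_P_nextE H.
have [h1 h2] := IH _ _ H0 cQ'.
have [] := monomial_subst_torus delta b tQ; rewrite -eQ /= => q1 q2.
have eQ2 : inverse_subst delta b (Q'.1 - a, Q'.2) = Q.
  by rewrite eQ monomial_substK //; apply: uni.
have h1' : Pp p ((co l).1 - phi a) (Q'.1 - a).
  by apply: (placeB pl) h1 _; apply: (placeC pl).
by rewrite -eQ2; split; apply: (placeM pl); apply: (placeXz pl).
Qed.

(** A chart fails only where some X - a vanishes, and this is a nonzero element of F at each
    level. *)
Lemma chart_generic l h : in_P delta f l h -> exists2 D, ev2 phi x y D != 0 &
  forall p, plane_curve f0 p -> ev2id K p.1 p.2 D != 0 ->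
    exists Q, chart delta l p Q.
Proof.
elim: l h => [b|l IH a b] h H.
  exists 1; first by rewrite rmorph1 oner_neq0.
  move=> p Cp _; have [tp _] := Cp; have [[cop _] _] := in_P_firstE H.
  exists (inverse_subst delta b p); split; first exact: inverse_subst_torus.
  by rewrite inverse_substK //; apply: uni.
have [h0 [H0 [a0 ma] _ [cop _] _]] := in_P_nextE H.
have [D1 D10 g1] := IH _ H0.
have [D2 D20 g2] := generic_neq0 (in_P_translate_neq0 uni ff0 ff x0 y0 H0 ma).
exists (D1 * D2); first by rewrite rmorphM mulf_neq0.
move=> p Cp; rewrite rmorphM mulf_eq0 negb_or => /andP[n1 n2].
have [Q' cQ'] := g1 p Cp n1; have [c c0 hc] := g2 p Cp n2.
have [pl _] := curve_place Cp.
have [h1 h2] := chart_place H0 Cp cQ'.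
have tQ' : in_torus (Q'.1 - a, Q'.2).
  split=> /=; last by case: l cQ' {H IH H0 g1 g2 h1 h2 hc ma} => [?|? ? ?] /= [[_ ?] _].
  have h3 := placeB pl h1 (placeC pl a).
  by rewrite (place_uniq pl h3 hc).
exists (inverse_subst delta b (Q'.1 - a, Q'.2)); split.
  exact: inverse_subst_torus.
by exists Q'; split=> //; rewrite inverse_substK //; apply: uni.
Qed.

End Transfer.

Lemma mpoly_closed_ind (N : nat) (R : nzRingType) (P : {mpoly R[N]} -> Prop) :
  (forall c, P c%:MP) -> (forall i, P 'X_i) -> (forall a b, P a -> P b -> P (a + b)) ->
  (forall a b, P a -> P b -> P (a * b)) -> forall p, P p.
Proof.
move=> PC PX PD PM p; rewrite [p]mpolyE; apply: (big_ind P) => //.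
  by rewrite -mpolyC0.
move=> m _; rewrite -mul_mpolyC; apply: (PM) => //; rewrite mpolyXE_id.
apply: (big_ind P); [by rewrite -mpolyC1|by move=> u v; apply: (PM)|].
by move=> i _; elim: (m i) => [|j IH]; rewrite ?expr0 -?mpolyC1 // exprS; apply: PM.
Qed.

Lemma mpoly_taylor1 (N : nat) (K : comNzRingType) (q : 'I_N -> K) (a : {mpoly K[N]}) :
  exists H : 'I_N -> {mpoly K[N]},
    a = (a.@[q])%:MP + \sum_l ('X_l - (q l)%:MP) * H l.
Proof.
elim/mpoly_closed_ind: a => [c|i|a b [H ea] [H' eb]|a b [H ea] [H' eb]].
- exists (fun=> 0); rewrite mevalC big1 ?addr0 // => l _.
  by rewrite mulr0.
- exists (fun l => (l == i)%:R); rewrite mevalXU (bigD1 i) //= eqxx mulr1 big1.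
    by rewrite addr0 addrC subrK.
  by move=> l /negbTE ->; rewrite mulr0.
- exists (fun l => H l + H' l); rewrite mevalD mpolyCD {1}ea {1}eb addrACA.
  by congr (_ + _); rewrite -big_split; apply: eq_bigr => l _ /=; rewrite mulrDr.
- exists (fun l => H l * b + (a.@[q])%:MP * H' l); rewrite mevalM mpolyCM.
  transitivity ((a.@[q])%:MP * b + (\sum_l ('X_l - (q l)%:MP) * H l) * b).
    by rewrite -mulrDl -ea.
  rewrite {1}eb mulrDr -addrA; congr (_ + _); rewrite mulr_sumr mulr_suml -big_split.
  by apply: eq_bigr => l _ /=; ring.
Qed.

Lemma mderiv_taylor1 (N : nat) (K : comNzRingType) (q : 'I_N -> K) (a : {mpoly K[N]}) c
    (H : 'I_N -> {mpoly K[N]}) k :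
  a = c%:MP + \sum_l ('X_l - (q l)%:MP) * H l -> (mderiv k a).@[q] = (H k).@[q].
Proof.
move=> ->; rewrite mderivD mderivC add0r (raddf_sum (mderiv k)) (raddf_sum (meval q)) /=.
have X0 l : ('X_l - (q l)%:MP : {mpoly K[N]}).@[q] = 0.
  by rewrite mevalB mevalXU mevalC subrr.
rewrite (bigD1 k) //= big1 ?addr0.
  rewrite mderivM mderivB mderivC subr0 mevalD !mevalM X0 mul0r addr0.
  have um : (U_(k) - U_(k))%MM = 0%MM :> 'X_{1..N}.
    by rewrite -{1}[U_(k)%MM]add0m addmK.
  by rewrite mderivX mnm1E eqxx um mpolyX0 scale1r meval1 mul1r.
move=> l lk; rewrite mderivM mderivB mderivC subr0 mevalD !mevalM X0 mul0r addr0.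
by rewrite mderivX mnm1E (negbTE lk) scale0r meval0 mul0r.
Qed.

Lemma euler_homogeneous (N : nat) (K : comNzRingType) d (p : {mpoly K[N]}) (q : 'I_N -> K) :
  p \is d.-homog -> \sum_l (mderiv l p).@[q] * q l = p.@[q] *+ d.
Proof.
move=> /dhomogP hp.
transitivity (\sum_(m <- msupp p) \sum_l ((mderiv l (p@_m *: 'X_[m])).@[q] * q l)).
  rewrite exchange_big /=; apply: eq_bigr => l _.
  rewrite -mulr_suml {1}[p]mpolyE; congr (_ * _).
  by rewrite (raddf_sum (mderiv l)) (raddf_sum (meval q)).
rewrite [p in RHS]mpolyE (raddf_sum (meval q)) -sumrMnl; apply: eq_big_seq => m /hp /= <-.
under eq_bigr do rewrite mderivZ mderivX !mevalZ -!mulrA.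
rewrite -mulr_sumr mevalZ -mulrnAr; congr (_ * _).
rewrite mdegE -sumrMnr; apply: eq_bigr => l _.
have [->|ml] := posnP (m l); first by rewrite mul0r mulr0n.
rewrite mulr_natl; congr (_ *+ _); rewrite -(mevalXU q l) -mevalM -mpolyXD.
by rewrite submK // lep1mP -lt0n.
Qed.

(** The vector q is killed by [J] but not by the j-th coordinate form, so this form raises the rank
    to n - 1 and one further form [l] completes it. In terms of differentials: modulo the equations
    and the affine chart, every coordinate is a multiple of [l]. *)
Lemma tangent_complement (K : fieldType) m n (J : 'M[K]_(m, n)) (q : 'cV[K]_n) j :
  (\rank J).+2 = n -> J *m q = 0 -> q j 0 = 1 ->
  exists (B1 : 'M[K]_(n, m)) (b2 b3 : 'cV[K]_n) (l : 'rV[K]_n),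
    B1 *m J + b2 *m delta_mx 0 j + b3 *m l = 1%:M.
Proof.
move=> rJ Jq qj; pose e : 'rV[K]_n := delta_mx 0 j.
pose M := (J + e)%MS.
have lt : (\rank J < \rank M)%N.
  rewrite ltn_neqAle mxrankS ?addsmxSl // andbT; apply/negP => /eqP er.
  have : (M <= J)%MS by rewrite -(mxrank_leqif_sup (addsmxSl J e)) -er.
  rewrite addsmx_sub => /andP[_ /submxP[D eD]].
  have : (e *m q) 0 0 = 0 by rewrite eD -mulmxA Jq mulmx0 mxE.
  by rewrite -rowE mxE qj => /eqP; rewrite oner_eq0.
have rC : (\rank (M^C)%MS <= 1)%N by rewrite mxrank_compl; lia.
pose l := nz_row (M^C)%MS.
have lC : (M^C <= l)%MS.
  have [z|nz] := eqVneq (M^C)%MS 0; first by rewrite z sub0mx.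
  rewrite -(mxrank_leqif_sup (nz_row_sub _)) rank_rV nz_row_eq0 nz.
  by rewrite eqn_leq rC andbT lt0n mxrank_eq0.
have : (1%:M <= J + e + l)%MS.
  apply: submx_trans (addsmxS (submx_refl M) lC); rewrite submx_full //.
  exact: addsmx_compl_full.
case/sub_addsmxP => -[u1 u2] /= e1.
have /sub_addsmxP[[v1 v2] /= e2] : (u1 *m M <= J + e)%MS by apply: submxMl.
by exists v1, v2, u2, l; rewrite -e2 -e1.
Qed.

Section Completion.
Variables (k : fieldType) (K : closedFieldType) (iota : {rmorphism k -> K}).
Variables (f : laurent k) (N m : nat) (G : 'I_m -> {mpoly k[N.+1]}).
Variable g : 'I_N.+1 -> laurent k.
Variables (f0 : {poly {poly K}}) (F : fieldType).
Variables (phi : {rmorphism K -> F}) (x y : F).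
Hypothesis ff : function_field f0 phi x y.
Hypothesis van : forall b, ev2 phi x y b = 0 <-> vanishes f0 b.
Hypothesis smooth : smooth_plane f0.
Hypothesis eqC : forall p, torus_curve (lmap iota f) p <-> plane_curve f0 p.
Hypothesis sc : smooth_completion iota f G g.

Let GK i := map_mpoly iota (G i).
Notation C := (proj_zeros GK).
Notation mpt p := (map_eval iota g p).
Notation Pp p := (plane_place phi x y p.1 p.2).

(** Homogeneous coordinates over F of the generic point of C. *)
Definition gamma (i : 'I_N.+1) : F := leval (lmap phi (lmap iota (g i))) (x, y).
Let pF (Q : {mpoly K[N.+1]}) : F := mmap phi gamma Q.

Lemma curve_place_gamma p Q : plane_curve f0 p -> Pp p (pF Q) (peval Q (mpt p)).
Proof.
move=> Cp; have [pl _] := curve_place ff smooth Cp.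
have := place_mmap pl Q (fun i => curve_place_leval ff smooth (lmap iota (g i)) Cp).
by rewrite /peval; congr (Pp p _ _); apply: meval_eq => i; rewrite mxE.
Qed.

Lemma peval_scale d (Q : {mpoly K[N.+1]}) (c : K) v : Q \is d.-homog ->
  peval Q (c *: v) = c ^+ d * peval Q v.
Proof.
move=> hQ; rewrite /peval -(mmap_homog_scale _ _ _ hQ).
by apply: mmap_ext => i; rewrite mxE.
Qed.

Let bir : birational_map iota f G g := sc.2.
Let spc : smooth_proj_curve GK := sc.1.

Lemma gamma_neq0 : exists j, gamma j != 0.
Proof.
case: bir => _ [d [A [B [D [_ _ [[p [/eqC Cp np _]] _] _]]]]].
have [j nj] := rV0Pn _ np; exists j.
have [pl _] := curve_place ff smooth Cp.
apply: (place_neq0 pl nj); rewrite mxE.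
exact: (curve_place_leval ff smooth (lmap iota (g j)) Cp).
Qed.

Lemma generic_point_neq0 (s s' : F) : s != 0 -> s' != 0 ->
  exists p, [/\ plane_curve f0 p, exists2 c, c != 0 & Pp p s c &
    exists2 c, c != 0 & Pp p s' c].
Proof.
move=> s0 s'0; have [D D0 g1] := generic_neq0 ff s0.
have [D' D'0 g2] := generic_neq0 ff s'0.
have [|p Cp] := @generic_curve_point _ f0 _ phi x y van (D * D').
  by rewrite rmorphM mulf_neq0.
rewrite rmorphM mulf_eq0 negb_or => /andP[n1 n2].
by exists p; split=> //; [apply: g1|apply: g2].
Qed.

Lemma map_neq0 p j c : plane_curve f0 p -> c != 0 -> Pp p (gamma j) c -> mpt p != 0.
Proof.
move=> Cp c0 hc; have [pl _] := curve_place ff smooth Cp.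
apply/rV0Pn; exists j.
have := curve_place_leval ff smooth (lmap iota (g j)) Cp.
by rewrite mxE => /(place_uniq pl hc) <-.
Qed.

Lemma pF_eq0 (Q : {mpoly K[N.+1]}) : (forall p, plane_curve f0 p -> mpt p != 0 ->
  peval Q (mpt p) = 0) -> pF Q = 0.
Proof.
move=> H; apply/eqP/negPn/negP => nz; have [j gj] := gamma_neq0.
have [p [Cp [c c0 hc] [c' c'0 hc']]] := generic_point_neq0 nz gj.
have [pl _] := curve_place ff smooth Cp.
have := place_uniq pl hc (curve_place_gamma Q Cp).
by rewrite H ?(map_neq0 Cp c'0 hc') // => e; rewrite e eqxx in c0.
Qed.

Lemma pF_eq0_peval (Q : {mpoly K[N.+1]}) p : plane_curve f0 p -> pF Q = 0 ->
  peval Q (mpt p) = 0.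
Proof.
move=> Cp e; have [pl _] := curve_place ff smooth Cp.
by have := curve_place_gamma Q Cp; rewrite e => /(place_uniq pl (place0 pl)).
Qed.

Lemma pF_equation i : pF (GK i) = 0.
Proof.
apply: pF_eq0 => p Cp np; case: bir => + _.
case/(_ p ((eqC p).2 Cp) np) => q [_ Cq] [c c0 ->].
by have [/(_ i)[d hd] _ _] := spc; rewrite (peval_scale _ _ hd) Cq mulr0.
Qed.

(** The inverse is given at points only; the identities A = x D and B = y D in F follow by testing
    at a point where A, B, D and some g_j are nonzero. *)
Lemma inverse_map : exists d (A B D : {mpoly K[N.+1]}),
  [/\ [/\ A \is d.-homog, B \is d.-homog & D \is d.-homog],
    pF D != 0, pF A = x * pF D, pF B = y * pF D &
    [/\ forall q, C q -> [/\ peval A q != 0, peval B q != 0 & peval D q != 0] ->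
      let p := (peval A q / peval D q, peval B q / peval D q) in
      plane_curve f0 p /\ (mpt p != 0 -> coords_of (mpt p) q) &
      exists q, [/\ C q, [/\ peval A q != 0, peval B q != 0 & peval D q != 0] &
        mpt (peval A q / peval D q, peval B q / peval D q) != 0]]].
Proof.
case: bir => _ [d [A [B [D [[hA hB hD] h1 [[p0 [/eqC Cp0 np0 [nA nB nD]]] h2] [h3 h4]]]]]].
exists d, (map_mpoly iota A), (map_mpoly iota B), (map_mpoly iota D).
have [pl0 _] := curve_place ff smooth Cp0.
have AF : pF (map_mpoly iota A) != 0 by apply: (place_neq0 pl0 nA (curve_place_gamma _ Cp0)).
have BF : pF (map_mpoly iota B) != 0 by apply: (place_neq0 pl0 nB (curve_place_gamma _ Cp0)).
have DF : pF (map_mpoly iota D) != 0 by apply: (place_neq0 pl0 nD (curve_place_gamma _ Cp0)).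
have key (s : F) (Q : {mpoly K[N.+1]}) (pr : K * K -> K) :
    (forall p, plane_curve f0 p -> Pp p s (pr p)) ->
    (forall p, plane_curve f0 p -> mpt p != 0 ->
      peval (map_mpoly iota A) (mpt p) != 0 -> peval (map_mpoly iota B) (mpt p) != 0 ->
      peval (map_mpoly iota D) (mpt p) != 0 ->
      peval Q (mpt p) = pr p * peval (map_mpoly iota D) (mpt p)) ->
    pF Q = s * pF (map_mpoly iota D).
  move=> hs hQ; apply/eqP; rewrite -subr_eq0; apply/negPn/negP => nz.
  have [j gj] := gamma_neq0.
  have [p [Cp [c c0 hc] [c' c'0 hc']]] := generic_point_neq0 nz
    (mulf_neq0 gj (mulf_neq0 AF (mulf_neq0 BF DF))).
  have [pl _] := curve_place ff smooth Cp.
  have hg := curve_place_leval ff smooth (lmap iota (g j)) Cp.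
  have hA' := curve_place_gamma (map_mpoly iota A) Cp.
  have hB' := curve_place_gamma (map_mpoly iota B) Cp.
  have hD' := curve_place_gamma (map_mpoly iota D) Cp.
  have := place_uniq pl hc' (placeM pl hg (placeM pl hA' (placeM pl hB' hD'))).
  move=> e; move: c'0; rewrite e !mulf_eq0 !negb_or => /and4P[n1 n2 n3 n4].
  have := place_uniq pl hc (placeB pl (curve_place_gamma Q Cp) (placeM pl (hs p Cp) hD')).
  by rewrite hQ ?(map_neq0 Cp n1 hg) // subrr => e'; rewrite e' eqxx in c0.
split=> //.
- by split; apply: dhomog_map.
- apply: (key x _ (fun p => p.1)) => [p Cp|p Cp np a0 b0 d0]; first exact: plane_placeX.
  have /(congr1 fst) /= <- := h2 p ((eqC p).2 Cp) np (And3 a0 b0 d0).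
  by rewrite divfK.
- apply: (key y _ (fun p => p.2)) => [p Cp|p Cp np a0 b0 d0]; first exact: plane_placeY.
  have /(congr1 snd) /= <- := h2 p ((eqC p).2 Cp) np (And3 a0 b0 d0).
  by rewrite divfK.
- split=> // q Cq dq p; split; first by apply/eqC; apply: h1.
  exact: h4.
Qed.

(** The image of C_0 is dense: C is covered by Q = 0 and by the closed set where the inverse map or
    its composite with [g] is not defined. By irreducibility one of them is all of C, and the second
    misses a point. *)
Lemma pF_vanish d (Q : {mpoly K[N.+1]}) q : Q \is d.-homog -> pF Q = 0 -> C q ->
  peval Q q = 0.
Proof.
move=> hQ Q0 Cq; have [e [A [B [D [[hA hB hD] _ _ _ [hq [q0 [Cq0 dq0 nq0]]]]]]]] := inverse_map.
have [_ [[_ _ irr] _ _] _] := spc.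
(* Clearing denominators in g_i(A / D, B / D) shows that the exceptional set is closed. *)
have T i : exists (e' : nat) (T : {mpoly K[N.+1]}), T \is (e * e').-homog /\
    forall v, peval A v != 0 -> peval B v != 0 -> peval D v != 0 ->
      (peval T v == 0) = (leval (lmap iota (g i))
        (peval A v / peval D v, peval B v / peval D v) == 0).
  have [h [n E]] := laurent_bipoly (lmap iota (g i)).
  have [e0 /(_ e0 (leqnn _))[T hT eT]] := homogeneous_bipoly h hA hB hD.
  exists e0, T; split=> // v a0 b0 d0.
  rewrite -(lmap_id (lmap iota (g i))) (laurent_shift idfun _ _ E) ?mulf_neq0 ?invr_eq0 //.
  rewrite /peval eT // !mulf_eq0 expf_eq0 (negbTE d0) andbF /=.
  by rewrite !(negbTE (expfz_neq0 _ _)) ?mulf_neq0 ?invr_eq0.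
have [Ti /fun_choice[Tp hTp]] := fun_choice T.
pose Z1 v := proj_point v /\ peval Q v = 0.
pose Z2 v := proj_point v /\ forall i, peval (A * B * D * Tp i) v = 0.
have c1 : proj_closed Z1.
  exists (fun R => R = Q); split; first by move=> R ->; exists d.
  by move=> v; split=> -[pv hv]; split=> //; [move=> R ->|apply: hv].
have c2 : proj_closed Z2.
  exists (fun R => exists i, R = A * B * D * Tp i); split.
    move=> R [i ->]; exists (e + e + e + e * Ti i)%N.
    by apply: dhomogM (hTp i).1; apply: dhomogM hD; apply: dhomogM.
  move=> v; split=> -[pv hv]; split=> //; first by move=> R [i ->].
  by move=> i; apply: hv; exists i.
have [|h|h] := irr _ _ c1 c2; last 2 first.
- by case: (h q Cq).
- have [j nj] := rV0Pn _ nq0; case: (dq0) => a0 b0 d0.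
  have [_ /(_ j)/eqP] := h q0 Cq0; rewrite /peval !rmorphM !mulf_eq0.
  rewrite !(negbTE a0, negbTE b0, negbTE d0) /= -/(peval (Tp j) q0) (hTp j).2 //.
  by move: nj; rewrite mxE => /negbTE ->.
move=> v Cv; have [z|nz] := eqVneq (peval (A * B * D) v) 0.
  right; split; first by case: Cv.
  by move=> i; rewrite /peval mevalM; move: z; rewrite /peval => ->; rewrite mul0r.
move: (nz); rewrite /peval !rmorphM !mulf_eq0 !negb_or => /andP[/andP[a0 b0] d0].
have [Cp hp] := hq v Cv (And3 a0 b0 d0).
set p := (_, _) in Cp hp.
have [np|/hp[c c0 ep]] := eqVneq (mpt p) 0.
  right; split; first by case: Cv.
  move=> i; rewrite /peval mevalM -/(peval (Tp i) v).
  have /eqP -> : peval (Tp i) v == 0; last by rewrite mulr0.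
  rewrite (hTp i).2 //; have := congr1 (fun r : 'rV_N.+1 => r 0 i) np.
  by rewrite !mxE => ->.
left; split; first by case: Cv.
have := pF_eq0_peval Cp Q0; rewrite ep (peval_scale _ _ hQ) => /eqP.
by rewrite mulf_eq0 expf_eq0 (negbTE c0) andbF => /eqP.
Qed.

End Completion.

(** * Local rings of the smooth completion *)

Section ProjectivePlace.
Variables (k : fieldType) (K : closedFieldType) (iota : {rmorphism k -> K}).
Variables (f : laurent k) (N m : nat) (G : 'I_m -> {mpoly k[N.+1]}).
Variable g : 'I_N.+1 -> laurent k.
Variables (f0 : {poly {poly K}}) (F : fieldType).
Variables (phi : {rmorphism K -> F}) (x y : F).
Hypothesis ff : function_field f0 phi x y.
Hypothesis van : forall b, ev2 phi x y b = 0 <-> vanishes f0 b.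
Hypothesis smooth : smooth_plane f0.
Hypothesis eqC : forall p, torus_curve (lmap iota f) p <-> plane_curve f0 p.
Hypothesis sc : smooth_completion iota f G g.

Let GK i := map_mpoly iota (G i).
Notation C := (proj_zeros GK).
Let ga := gamma iota g phi x y.
Let pF (Q : {mpoly K[N.+1]}) : F := mmap phi ga Q.

Variables (q : 'rV[K]_N.+1) (j : 'I_N.+1).
Hypotheses (Cq : C q) (qj : q 0 j = 1).

Definition proj_place := localization
  (mmap phi (fun i => gamma iota g phi x y i / gamma iota g phi x y j)
    : {rmorphism {mpoly K[N.+1]} -> F})
  (meval (fun i => q 0 i) : {rmorphism {mpoly K[N.+1]} -> K}).

Let psi : {rmorphism {mpoly K[N.+1]} -> F} := mmap phi (fun i => ga i / ga j).
Let ev : {rmorphism {mpoly K[N.+1]} -> K} := meval (fun i => q 0 i).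

Lemma pF_vanish_at d (Q : {mpoly K[N.+1]}) : Q \is d.-homog -> pF Q = 0 -> peval Q q = 0.
Proof. by move=> hQ Q0; apply: (pF_vanish ff van smooth eqC sc hQ Q0 Cq). Qed.

Lemma gamma_at_neq0 : ga j != 0.
Proof.
apply/eqP => e; have : peval ('X_j : {mpoly K[N.+1]}) q = 0.
  apply: (@pF_vanish_at 1%N); first by rewrite dhomogX /= mdeg1.
  by rewrite /pF mmapX mmap1U.
by rewrite /peval mevalXU qj => /eqP; rewrite oner_eq0.
Qed.

Let gj := gamma_at_neq0.

Lemma pF_psi d (Q : {mpoly K[N.+1]}) : Q \is d.-homog -> pF Q = ga j ^+ d * psi Q.
Proof. by move=> hQ; apply: mmap_homog_div. Qed.

Lemma proj_homogenization a : exists D0 : nat, forall D, (D0 <= D)%N ->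
  exists2 Q : {mpoly K[N.+1]}, Q \is D.-homog &
    pF Q = ga j ^+ D * psi a /\ peval Q q = ev a.
Proof.
have [D0 H] := homogenization j a; exists D0 => D /H[Q hQ eQ]; exists Q => //.
split; first exact: eQ.
have := eQ K idfun (fun i => q 0 i); rewrite qj => /(_ (oner_neq0 _)).
rewrite expr1n mul1r /peval /ev /= /meval => ->.
by apply: mmap_ext => i; rewrite divr1.
Qed.

(** A relation between affine coordinates of the generic point homogenizes to one on the image of
    C_0, which extends to [q] by density. *)
Let well_defined a : psi a = 0 -> ev a = 0.
Proof.
move=> e; have [D0 /(_ D0 (leqnn _))[Q hQ [e1 e2]]] := proj_homogenization a.
by rewrite -e2; apply: (pF_vanish_at hQ); rewrite e1 e mulr0.
Qed.

Let cst : {rmorphism K -> {mpoly K[N.+1]}} := @mpolyC N.+1 K.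
Let psi_cst c : psi (cst c) = phi c. Proof. exact: mmapC. Qed.
Let ev_cst c : ev (cst c) = c. Proof. exact: mevalC. Qed.

Lemma proj_place_place : place phi proj_place.
Proof. exact: localization_place psi_cst ev_cst well_defined. Qed.

Lemma fractions_closed (S : F -> Prop) : (forall c, S (phi c)) -> S x -> S y ->
  (forall a b, S a -> S b -> S (a + b)) -> (forall a b, S a -> S b -> S (a * b)) ->
  (forall a, a != 0 -> S a -> S a^-1) -> forall s, S s.
Proof.
move=> SC Sx Sy SD SM SV s.
have SP h : S (ev2 phi x y h).
  elim/bipoly_ind: h => [c|||a b Ha Hb|a b Ha Hb].
  - by rewrite ev2C.
  - by rewrite ev2X.
  - by rewrite ev2Y.
  - by rewrite rmorphD; apply: (SD).
  - by rewrite rmorphM; apply: (SM).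
have [a [b [b0 e]]] := ff_frac ff s.
have -> : s = ev2 phi x y a / ev2 phi x y b by rewrite -e mulfK.
by apply: (SM) => //; apply: (SV).
Qed.

Lemma proj_fractions s : exists a b, psi b != 0 /\ s * psi b = psi a.
Proof.
have [d [A [B [D [[hA hB hD] D0 eA eB _]]]]] := inverse_map ff van smooth eqC sc.
have gd : ga j ^+ d != 0 by rewrite expf_neq0.
have pD : psi D != 0.
  by move: D0; rewrite -/(pF D) (pF_psi hD) mulf_eq0 negb_or => /andP[].
have ratio (Q : {mpoly K[N.+1]}) z : Q \is d.-homog -> pF Q = z * pF D ->
    z * psi D = psi Q.
  by move=> hQ; rewrite (pF_psi hQ) (pF_psi hD) mulrCA => /(mulfI gd).
apply: (fractions_closed (S := fun s => exists a b, psi b != 0 /\ s * psi b = psi a)).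
- by move=> c; exists (cst c), 1; rewrite psi_cst rmorph1 mulr1 oner_neq0.
- by exists A, D; split=> //; apply: ratio.
- by exists B, D; split=> //; apply: ratio.
- move=> u v [a [b [b0 e]]] [a' [b' [b'0 e']]].
  exists (a * b' + a' * b), (b * b'); rewrite rmorphD !rmorphM mulf_neq0 //.
  by split=> //; rewrite -e -e'; ring.
- move=> u v [a [b [b0 e]]] [a' [b' [b'0 e']]].
  exists (a * a'), (b * b'); rewrite !rmorphM mulf_neq0 //.
  by split=> //; rewrite -e -e'; ring.
- move=> u u0 [a [b [b0 e]]]; exists b, a; rewrite -e mulf_neq0 //.
  by split=> //; rewrite mulrA mulVf ?mul1r.
Qed.

Let w l : {mpoly K[N.+1]} := 'X_l - (q 0 l)%:MP.

Let ev_w l : ev (w l) = 0.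
Proof. by rewrite /w rmorphB /= mevalXU mevalC subrr. Qed.

(* The affine coordinates at [q] generate the maximal ideal; by the Jacobian
   criterion and Cramer's rule, one linear form [tau] in them suffices. *)
Lemma cotangent_generator : exists tau : {mpoly K[N.+1]}, ev tau = 0 /\
  forall l, exists s c, proj_place s c /\ psi (w l) = psi tau * s.
Proof.
have [hG _ rk] := sc.1.
pose J := jacobian GK q.
have Jq : J *m q^T = 0.
  apply/matrixP => i i'; rewrite !mxE.
  have [d hd] := hG i; have := euler_homogeneous (fun l => q 0 l) hd.
  have -> : (map_mpoly iota (G i)).@[fun l => q 0 l] = 0 by apply: Cq.2.
  rewrite mul0rn => e; rewrite -[RHS]e; apply: eq_bigr => l _.
  by rewrite !mxE (ord1 i').
have rJ : (\rank J).+2 = N.+1 by rewrite (rk q Cq).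
have qjT : q^T j 0 = 1 by rewrite mxE.
have [B1 [b2 [b3 [ell eB]]]] := tangent_complement rJ Jq qjT.
have [H hH] := fun_choice (fun i => mpoly_taylor1 (fun l => q 0 l) (GK i)).
have eH i l : ev (H i l) = J i l by rewrite mxE; symmetry;
  exact: (@mderiv_taylor1 _ _ (fun l => q 0 l) (GK i) _ (H i) l (hH i)).
have Gw i : \sum_l psi (w l) * psi (H i l) = 0.
  have : psi (GK i) = 0.
    have [d hd] := hG i; have /eqP := pF_equation ff van smooth eqC sc i.
    rewrite -/GK -/(GK i) -/(pF (GK i)) (pF_psi hd) mulf_eq0 expf_eq0 (negbTE gj) andbF.
    by move=> /eqP.
  rewrite hH (_ : _.@[_] = 0); last by apply: Cq.2.
  rewrite mpolyC0 add0r rmorph_sum => e; rewrite -[RHS]e.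
  by apply: eq_bigr => l _; rewrite rmorphM.
pose tau := \sum_l cst (ell 0 l) * w l.
have etau : ev tau = 0.
  by rewrite rmorph_sum big1 // => l _; rewrite rmorphM ev_w mulr0.
exists tau; split=> // l.
(* The matrix identity of [tangent_complement], with the Jacobian replaced by the Taylor
   coefficients [H], which give exact relations and not only first-order ones. At [q] the matrix
   becomes the identity, so its determinant is a unit there. *)
pose M := map_mx cst B1 *m \matrix_(i, l) H i l + map_mx cst (b2 *m delta_mx 0 j) +
  map_mx cst (b3 *m ell).
have evM : map_mx ev M = 1%:M.
  rewrite -eB /M !map_mxD map_mxM; congr (_ *m _ + _ + _).
  - by apply/matrixP => a b; rewrite 2!mxE; apply: ev_cst.
  - by apply/matrixP => a b; rewrite 2!mxE; apply: eH.
  - by apply/matrixP => a b; rewrite mxE [map_mx cst _ a b]mxE; apply: ev_cst.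
  - by apply/matrixP => a b; rewrite mxE [map_mx cst _ a b]mxE; apply: ev_cst.
have evd : ev (\det M) = 1 by rewrite -det_map_mx evM det1.
have pd : psi (\det M) != 0.
  by apply/eqP => /well_defined; rewrite evd => /eqP; rewrite oner_eq0.
pose W : 'cV[F]_N.+1 := \col_l psi (w l).
have wj : psi (w j) = 0.
  rewrite /w rmorphB /= mmapX mmap1U mmapC; apply/eqP; rewrite subr_eq0; apply/eqP.
  by transitivity (1 : F); [apply: divff|rewrite qj; apply/esym/(rmorph1 phi)].
have MW : map_mx psi M *m W = psi tau *: map_mx phi b3.
  apply/matrixP => a z; rewrite {z}(ord1 z) mxE [RHS]mxE [map_mx phi b3 a 0]mxE.
  have psiM b : map_mx psi M a b = \sum_i phi (B1 a i) * psi (H i b) +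
      phi (b2 a 0) * (j == b)%:R + phi (b3 a 0) * phi (ell 0 b).
    rewrite mxE /M !mxE !rmorphD rmorph_sum; congr (_ + _ + _).
    - by apply: eq_bigr => i _; rewrite rmorphM !mxE psi_cst.
    - by rewrite psi_cst big_ord1 mxE eqxx /= eq_sym rmorphM; congr (_ * _); case: eqP; rewrite ?rmorph1 ?rmorph0.
    - by rewrite psi_cst big_ord1 rmorphM.
  transitivity (\sum_b ((\sum_i phi (B1 a i) * psi (H i b)) * psi (w b) +
      phi (b2 a 0) * ((j == b)%:R * psi (w b)) + phi (b3 a 0) * (phi (ell 0 b) * psi (w b)))).
    by apply: eq_bigr => b _; rewrite psiM mxE; ring.
  rewrite !big_split /= -!mulr_sumr.
  have -> : \sum_b (\sum_i phi (B1 a i) * psi (H i b)) * psi (w b) = 0.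
    under eq_bigr do rewrite mulr_suml.
    rewrite exchange_big big1 // => i _.
    transitivity (phi (B1 a i) * \sum_l psi (w l) * psi (H i l)); last by rewrite Gw mulr0.
    by rewrite mulr_sumr; apply: eq_bigr => b _; ring.
  have -> : \sum_b (j == b)%:R * psi (w b) = 0.
    by apply: big1 => b _; case: (eqVneq j b) => [<-|_]; rewrite ?mul0r // mul1r.
  have -> : \sum_b phi (ell 0 b) * psi (w b) = psi tau.
    by rewrite rmorph_sum; apply: eq_bigr => b _; rewrite rmorphM psi_cst.
  by rewrite mulr0 !add0r mulrC.
pose R := \adj M *m map_mx cst b3.
have key : psi (\det M) * psi (w l) = psi tau * psi (R l 0).
  have : map_mx psi (\adj M) *m (map_mx psi M *m W) =
      psi tau *: (map_mx psi (\adj M) *m map_mx phi b3) by rewrite MW scalemxAr.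
  rewrite mulmxA -map_mxM mul_adj_mx map_scalar_mx mul_scalar_mx.
  move/matrixP/(_ l 0); rewrite [LHS]mxE [W l 0]mxE [RHS]mxE => ->; congr (_ * _).
  rewrite /R !mxE rmorph_sum; apply: eq_bigr => b _.
  by rewrite rmorphM !mxE psi_cst.
exists (psi (R l 0) / psi (\det M)), (ev (R l 0) / ev (\det M)); split.
  have pl := proj_place_place; apply: (placeM pl); first exact: localization_ev.
  by apply: (placeV pl); [rewrite evd oner_neq0|apply: localization_ev].
by apply: (mulfI pd); rewrite key; field.
Qed.

Lemma proj_place_discrete : exists t, discrete proj_place t.
Proof.
have pl := proj_place_place.
have [tau [etau htau]] := cotangent_generator.
exists (psi tau); apply: (localization_discrete psi_cst ev_cst well_defined
  proj_fractions (function_field_dependent ff) _ etau).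
  apply/eqP => t0.
  (* If [tau] vanished in F, all affine coordinates would be constant. These generate F, so x and y
     would be constant too. *)
  have psi_const (Q : {mpoly K[N.+1]}) : psi Q = phi (ev Q).
    rewrite [LHS]/= /ev /= /meval /mmap rmorph_sum; apply: eq_bigr => u _.
    rewrite rmorphM; congr (_ * _); rewrite /mmap1 rmorph_prod; apply: eq_bigr => l _.
    rewrite rmorphXn; congr (_ ^+ _); have [s [c [_]]] := htau l.
    rewrite t0 mul0r /w rmorphB /= mmapX mmap1U mmapC => /eqP.
    by rewrite subr_eq0 => /eqP.
  have all_const s : exists c, s = phi c.
    have [a [b [b0 e]]] := proj_fractions s.
    exists (ev a / ev b); rewrite fmorph_div -!psi_const -e mulfK //.
  have [r er] := all_const x; have [s es] := all_const y.
  have e0 : ev2id K r s f0 = 0.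
    have : ev2 phi x y f0 = 0 by apply/(ff_dvd ff); exists 1; rewrite mulr1.
    rewrite er es -(ev2_comp (phi := idfun) (psi := phi)) // => /eqP.
    by rewrite fmorph_eq0 => /eqP.
  exact: (not_both_constant ff e0 (conj er es)).
move=> a ea.
have [H eH] := mpoly_taylor1 (fun l => q 0 l) a.
have -> : psi a = \sum_l psi (w l) * psi (H l).
  rewrite {1}eH (_ : a.@[_] = 0); last exact: ea.
  by rewrite mpolyC0 add0r rmorph_sum; apply: eq_bigr => l _; rewrite rmorphM.
have [s /fun_choice[c hc]] := fun_choice htau.
exists (\sum_l s l * psi (H l)), (\sum_l c l * ev (H l)); split.
  apply: (place_sum pl) => l; apply: (placeM pl) (hc l).1 _; exact: localization_ev.
by rewrite mulr_sumr; apply: eq_bigr => l _; rewrite (hc l).2 mulrA.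
Qed.

End ProjectivePlace.

Section Domination.
Variables (K : closedFieldType) (F : fieldType) (phi : {rmorphism K -> F}).

Lemma plane_place_sub X Y r s (P : F -> K -> Prop) u v : place phi P ->
  P X r -> P Y s -> plane_place phi X Y r s u v -> P u v.
Proof.
move=> pl hX hY [a [b [b0 e1 e2]]].
have hb := place_ev2 pl b hX hY; have nb := place_neq0 pl b0 hb.
have -> : u = ev2 phi X Y a / ev2 phi X Y b by rewrite -e1 mulfK.
have -> : v = ev2id K r s a / ev2id K r s b by rewrite -e2 mulfK.
apply: (placeM pl); first exact: place_ev2.
exact: (placeV pl).
Qed.

(* Valuation rings are maximal for domination. *)
Lemma place_sub_eq (P Q : F -> K -> Prop) t : place phi P -> place phi Q ->
  discrete Q t -> (forall u v, Q u v -> P u v) -> forall u v, P u v -> Q u v.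
Proof.
move=> pP pQ dQ sub u v hu.
have [u0|u0] := eqVneq u 0.
  rewrite u0 in hu *; rewrite (place_uniq pP hu (place0 pP)); exact: place0 pQ.
have [[v' hv']|h0] := place_valuation pQ dQ u.
  by rewrite (place_uniq pP hu (sub _ _ hv')).
have := placeM pP hu (sub _ _ h0); rewrite mulfV // mulr0.
by move=> /(place_uniq pP (place1 pP))/eqP; rewrite oner_eq0.
Qed.

End Domination.

Lemma proj_point_scale (K : fieldType) (N : nat) (v : 'rV[K]_N.+1) c :
  proj_point v -> proj_point (c *: v) -> c = 1.
Proof.
move=> [i [vi zi]] [i' [vi' zi']]; rewrite mxE in vi'.
have c0 : c != 0 by apply: contraPneq vi' => ->; rewrite mul0r => /eqP; rewrite eq_sym oner_eq0.
case: (ltngtP i i') => [lt|lt|/val_inj e].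
- by have /eqP := zi' i lt; rewrite mxE vi mulr1 (negbTE c0).
- by move: vi'; rewrite zi // mulr0 => /eqP; rewrite eq_sym oner_eq0.
- by move: vi'; rewrite -e vi mulr1.
Qed.

(** * Points at infinity as places *)

Section PointsAtInfinity.
Variables (k : fieldType) (K : closedFieldType) (iota : {rmorphism k -> K}).
Variable delta : int * int -> int * int.
Hypothesis uni : forall b : int * int, coprimez b.1 b.2 -> unimodular (delta b) b.
Variables (f : laurent k) (N m : nat) (G : 'I_m -> {mpoly k[N.+1]}).
Variable g : 'I_N.+1 -> laurent k.
Variables (f0 : {poly {poly K}}) (n : int * int) (F : fieldType).
Variables (phi : {rmorphism K -> F}) (x y : F).
Let fK := lmap iota f.
Hypothesis ff0 : forall m, fK m = bicoef f0 (shear (1, 0) (0, 1) n m).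
Hypotheses (ff : function_field f0 phi x y) (x0 : x != 0) (y0 : y != 0).
Hypothesis van : forall b, ev2 phi x y b = 0 <-> vanishes f0 b.
Hypothesis smooth : smooth_plane f0.
Hypothesis eqC : forall p, torus_curve fK p <-> plane_curve f0 p.
Hypothesis sc : smooth_completion iota f G g.

Let GK i := map_mpoly iota (G i).
Notation C := (proj_zeros GK).
Notation mpt p := (map_eval iota g p).
Notation Pp p := (plane_place phi x y p.1 p.2).
Notation Pq := (proj_place iota g phi x y).
Let ga := gamma iota g phi x y.
Let pF (Q : {mpoly K[N.+1]}) : F := mmap phi ga Q.
Let psi j (Q : {mpoly K[N.+1]}) : F := mmap phi (fun i => ga i / ga j) Q.
Let co l := coord delta phi l (x, y).

Lemma exists_coord q : C q -> exists j, q 0 j = 1.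
Proof. by move=> [[j [qj _]] _]; exists j. Qed.

Section AtPoint.
Variables (q : 'rV[K]_N.+1) (j : 'I_N.+1).
Hypotheses (Cq : C q) (qj : q 0 j = 1).

Let gj : ga j != 0 := gamma_at_neq0 ff van smooth eqC sc Cq qj.
Let pl := proj_place_place ff van smooth eqC sc Cq qj.

Let pF_ratio d (Q : {mpoly K[N.+1]}) : Q \is d.-homog -> pF Q = ga j ^+ d * psi j Q.
Proof. exact: (pF_psi ff van smooth eqC sc Cq qj). Qed.

Let homogenize a : exists D0 : nat, forall D, (D0 <= D)%N ->
  exists2 Q : {mpoly K[N.+1]}, Q \is D.-homog &
    pF Q = ga j ^+ D * psi j a /\ peval Q q = a.@[fun i => q 0 i].
Proof. exact: (proj_homogenization ff van smooth eqC sc Cq qj). Qed.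

Lemma proj_place_ratio i : Pq q j (ga i / ga j) (q 0 i).
Proof.
have := localization_ev (mmap phi (fun i => ga i / ga j) : {rmorphism {mpoly K[N.+1]} -> F})
  (meval (fun i => q 0 i) : {rmorphism {mpoly K[N.+1]} -> K}) 'X_i.
by rewrite /= mmapX mmap1U mevalXU.
Qed.

Lemma proj_place_sub (P : F -> K -> Prop) : place phi P ->
  (forall i, P (ga i / ga j) (q 0 i)) -> forall u v, Pq q j u v -> P u v.
Proof.
move=> pP hz u v [a [b [b0 e1 e2]]].
have hb := place_mmap pP b hz; have nb := place_neq0 pP b0 hb.
have -> : u = psi j a / psi j b by rewrite -[psi j a]e1 mulfK.
have -> : v = a.@[fun i => q 0 i] / b.@[fun i => q 0 i] by rewrite -[a.@[_]]e2 mulfK.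
apply: (placeM pP); first exact: place_mmap.
exact: (placeV pP).
Qed.

(** Both sides express that X and Y are quotients of forms regular at [q], one through values at
    points of C_0, the other in F. Generic points lead from the former to the latter, and residues
    at points lead back. *)
Lemma centred_atP l h r : in_P delta fK l h ->
  centred_at iota delta f g q l r <-> centred delta phi x y (Pq q j) l r.
Proof.
move=> H; split=> [[d [U [V [W [[hU hV hW] [W0 Ur V0] key]]]]]|].
  have [D D0 gen] := chart_generic ff x0 y0 smooth uni ff0 H.
  have rel (Z : {mpoly K[N.+1]}) (s : F) (pr : K * K -> K) :
      (forall p Q, plane_curve f0 p -> chart delta l p Q -> Pp p s (pr Q)) ->
      (forall p Q, plane_curve f0 p -> mpt p != 0 -> chart delta l p Q ->
        peval Z (mpt p) = pr Q * peval W (mpt p)) -> pF Z = s * pF W.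
    move=> hs hZ; apply/eqP; rewrite -subr_eq0; apply/negPn/negP => nz.
    have [p [Cp [c c0 hc] [c' c'0 hc']]] := generic_point_neq0 ff van nz (mulf_neq0 gj D0).
    have [plp _] := curve_place ff smooth Cp.
    have hD := place_ev2 plp D (plane_placeX phi x y p.1 p.2) (plane_placeY phi x y p.1 p.2).
    have hg := curve_place_leval ff smooth (lmap iota (g j)) Cp.
    have := place_uniq plp hc' (placeM plp hg hD).
    move=> e; move: c'0; rewrite e mulf_eq0 negb_or => /andP[n1 n2].
    have [Q cQ] := gen p Cp n2.
    have := place_uniq plp hc (placeB plp (curve_place_gamma iota g ff smooth Z Cp)
      (placeM plp (hs p Q Cp cQ) (curve_place_gamma iota g ff smooth W Cp))).
    rewrite (hZ p Q) // ?subrr; first by move=> e'; rewrite e' eqxx in c0.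
    exact: (map_neq0 ff smooth Cp n1 hg).
  have gd : ga j ^+ d != 0 by rewrite expf_neq0.
  split.
    exists U, W; split=> //.
    have := rel U (co l).1 (fun Q => Q.1).
    rewrite (pF_ratio hU) (pF_ratio hW) mulrCA => E; apply/esym/(mulfI gd)/E.
      by move=> p Q Cp cQ; case: (chart_place ff smooth uni H Cp cQ).
    by move=> p Q Cp np cQ; case: (key p Q ((eqC p).2 Cp) np cQ).
  exists V, W; split=> //; last by rewrite mul0r; apply/esym/V0.
  have := rel V (co l).2 (fun Q => Q.2).
  rewrite (pF_ratio hV) (pF_ratio hW) mulrCA => E; apply/esym/(mulfI gd)/E.
    by move=> p Q Cp cQ; case: (chart_place ff smooth uni H Cp cQ).
  by move=> p Q Cp np cQ; case: (key p Q ((eqC p).2 Cp) np cQ).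
move=> [[a [b [b0 e1 e2]]] [a' [b' [b'0 e1' e2']]]].
have [dU HU] := homogenize (a * b'); have [dV HV] := homogenize (a' * b).
have [dW HW] := homogenize (b * b').
pose d := (dU + dV + dW)%N.
have [|U hU [eU evU]] := HU d; first by rewrite /d; lia.
have [|V hV [eV evV]] := HV d; first by rewrite /d; lia.
have [|W hW [eW evW]] := HW d; first by rewrite /d; lia.
have psiM c c' : psi j (c * c') = psi j c * psi j c' by rewrite /psi rmorphM.
have relU : pF U = (co l).1 * pF W.
  have E : (co l).1 * psi j b = psi j a := e1.
  by rewrite eU eW !psiM -E; ring.
have relV : pF V = (co l).2 * pF W.
  have E : (co l).2 * psi j b' = psi j a' := e1'.
  by rewrite eV eW !psiM -E; ring.
exists d, U, V, W; split=> //.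
  rewrite evU evV evW !mevalM; split; first exact: mulf_neq0.
    by rewrite mulrA; congr (_ * _); apply/esym/e2.
  have -> : a'.@[fun i => q 0 i] = 0 by apply: etrans (esym e2') (mul0r _).
  by rewrite mul0r.
move=> p Q /eqC Cp np cQ; have [plp _] := curve_place ff smooth Cp.
have [h1 h2] := chart_place ff smooth uni H Cp cQ.
have hW' := curve_place_gamma iota g ff smooth W Cp.
split.
  apply: (place_uniq plp (curve_place_gamma iota g ff smooth U Cp)).
  by rewrite -/(pF U) relU; apply: (placeM plp).
apply: (place_uniq plp (curve_place_gamma iota g ff smooth V Cp)).
by rewrite -/(pF V) relV; apply: (placeM plp).
Qed.

(** The residues (c, d) form a point of C_0 whose local ring is dominated by that of [q]. Being a
    discrete valuation ring, it equals the latter, so the coordinate ratios are regular at (c, d)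
    with the coordinates of [q] as values. *)
Lemma unit_not_at_infinity c d : c != 0 -> d != 0 -> Pq q j x c -> Pq q j y d ->
  exists2 p, torus_curve fK p & map_value iota f g p q.
Proof.
move=> c0 d0 hx hy; have Cp : plane_curve f0 (c, d).
  split=> //=; apply: (place_uniq pl (place_ev2 pl f0 hx hy)).
  have -> : ev2 phi x y f0 = 0 by apply/(ff_dvd ff); exists 1; rewrite mulr1.
  exact: place0 pl.
exists (c, d); first exact/eqC.
have [plp [t dvp]] := curve_place ff smooth Cp.
have sub := plane_place_sub pl hx hy.
have hz i : Pp (c, d) (ga i / ga j) (q 0 i).
  by apply: (place_sub_eq pl plp dvp sub); apply: proj_place_ratio.
have [ab Hab] := fun_choice (fun i => let: ex_intro a (ex_intro b H) := hz i in
  ex_intro (fun ab : {poly {poly K}} * {poly {poly K}} =>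
    [/\ ev2id K c d ab.2 != 0, ga i / ga j * ev2 phi x y ab.2 = ev2 phi x y ab.1 &
    q 0 i * ev2id K c d ab.2 = ev2id K c d ab.1]) (a, b) H).
(* A common denominator, nonzero at (c, d), turns the ratios into a polynomial tuple. *)
pose B := \prod_i (ab i).2.
pose hp i := (ab i).1 * \prod_(i' | i' != i) (ab i').2.
have eB (R : fieldType) (ps : {rmorphism {poly {poly K}} -> R}) (z : R) i :
    z * ps (ab i).2 = ps (ab i).1 -> ps (hp i) = z * ps B.
  by move=> e; rewrite /B (bigD1 i) //= /hp !rmorphM -e; ring.
have B0 : ev2id K c d B != 0.
  by rewrite rmorph_prod; apply/prodf_neq0 => i _; case: (Hab i).
have [h Hh] := fun_choice (fun i => bipoly_laurent (hp i)).
have hF i : leval (lmap phi (h i)) (x, y) = ga i / ga j * ev2 phi x y B.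
  by rewrite Hh; apply: eB; case: (Hab i).
exists h; split.
  move=> p' /eqC Cp' i i'; have [plp' _] := curve_place ff smooth Cp'.
  rewrite !mxE; apply: (place_uniq plp'
    (placeM plp' (curve_place_leval ff smooth (h i) Cp')
      (curve_place_leval ff smooth (lmap iota (g i')) Cp'))).
  rewrite hF (_ : _ * leval _ _ = ga i' / ga j * ev2 phi x y B *
    leval (lmap phi (lmap iota (g i))) (x, y)).
    rewrite -hF; exact: (placeM plp' (curve_place_leval ff smooth (h i') Cp')
      (curve_place_leval ff smooth (lmap iota (g i)) Cp')).
  by rewrite -[leval (lmap phi (lmap iota (g i'))) _]/(ga i') -[leval _ _]/(ga i); ring.
exists (ev2id K c d B) => //; apply/rowP => i; rewrite !mxE.
have := Hh i K idfun c d; rewrite lmap_id => ->.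
have [_ _ e] := Hab i; rewrite (eB _ (ev2id K c d) (q 0 i) i e).
exact: mulrC.
Qed.

(** If [q] were the value at a point p of C_0, the coordinate ratios would be regular at p with
    values [q]. The local ring of [q] would then be dominated by that of p, hence equal to it, and x
    and y would be units at [q]. *)
Lemma not_unit_at_infinity :
  ~ (exists c d, [/\ c != 0, d != 0, Pq q j x c & Pq q j y d]) ->
  point_at_infinity iota f G g q.
Proof.
move=> nu; split=> // -[p /eqC Cp [h [hrel [c c0 hc]]]]; apply: nu.
have [plp _] := curve_place ff smooth Cp; have [[p10 p20] _] := Cp.
pose hF i := leval (lmap phi (h i)) (x, y).
have relF i i' : hF i * ga i' = hF i' * ga i.
  apply/eqP; rewrite -subr_eq0; apply/negPn/negP => nz.
  have [p' [Cp' [u u0 hu] _]] := generic_point_neq0 ff van nz gj.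
  have [plp' _] := curve_place ff smooth Cp'.
  have hh b := curve_place_leval ff smooth (h b) Cp'.
  have hg b := curve_place_leval ff smooth (lmap iota (g b)) Cp'.
  have := place_uniq plp' hu (placeB plp' (placeM plp' (hh i) (hg i'))
    (placeM plp' (hh i') (hg i))).
  have := hrel p' ((eqC p').2 Cp') i i'; rewrite !mxE => ->; rewrite subrr => e.
  by rewrite e eqxx in u0.
have hval i : leval (h i) p = c * q 0 i.
  by have := congr1 (fun r : 'rV_N.+1 => r 0 i) hc; rewrite !mxE.
have hj0 : leval (h j) p != 0 by rewrite hval qj mulr1.
have hjF := curve_place_leval ff smooth (h j) Cp.
have hFj : hF j != 0 := place_neq0 plp hj0 hjF.
have ratio i : Pp p (ga i / ga j) (q 0 i).
  have -> : ga i / ga j = hF i / hF j.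
    by apply: (mulIf gj); apply: (mulIf hFj); rewrite divfK // mulrAC divfK // [RHS]relF mulrC.
  have -> : q 0 i = leval (h i) p / leval (h j) p.
    by rewrite !hval qj mulr1 mulrC mulKf.
  apply: (placeM plp); first exact: (curve_place_leval ff smooth (h i) Cp).
  exact: (placeV plp).
have [t dv] := proj_place_discrete ff van smooth eqC sc Cq qj.
have sub := proj_place_sub plp ratio.
have back := place_sub_eq plp pl dv sub.
exists p.1, p.2; split=> //; apply: back.
  exact: plane_placeX.
exact: plane_placeY.
Qed.

End AtPoint.
End PointsAtInfinity.

(** * The bijection through centres of places *)

Section Correspondence.
Variables (k : fieldType) (K : closedFieldType) (iota : {rmorphism k -> K}).
Variable delta : int * int -> int * int.
Hypothesis uni : forall b : int * int, coprimez b.1 b.2 -> unimodular (delta b) b.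
Variables (f : laurent k) (N m : nat) (G : 'I_m -> {mpoly k[N.+1]}).
Variable g : 'I_N.+1 -> laurent k.
Variables (f0 : {poly {poly K}}) (n : int * int) (F : fieldType).
Variables (phi : {rmorphism K -> F}) (x y : F).
Let fK := lmap iota f.
Hypothesis ff0 : forall m, fK m = bicoef f0 (shear (1, 0) (0, 1) n m).
Hypotheses (ff : function_field f0 phi x y) (x0 : x != 0) (y0 : y != 0).
Hypothesis van : forall b, ev2 phi x y b = 0 <-> vanishes f0 b.
Hypothesis smooth : smooth_plane f0.
Hypothesis eqC : forall p, torus_curve fK p <-> plane_curve f0 p.
Hypothesis sc : smooth_completion iota f G g.

Let GK i := map_mpoly iota (G i).
Notation C := (proj_zeros GK).
Notation Pq := (proj_place iota g phi x y).
Let ga := gamma iota g phi x y.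
Let co l := coord delta phi l (x, y).

Lemma root_place l r : root_at_infinity delta fK (l, r) ->
  let P := plane_place phi (co l).1 (co l).2 r 0 in
  place phi P /\ exists t, discrete P t.
Proof.
move=> [h /= [H r0 sr]]; have [_ ffl _] := in_P_level uni ff0 ff x0 y0 H.
have [hr dhr] := (simple_rootP _ _).1 sr.
have e : ev2id K r 0 h = 0 by rewrite -restr_horner.
split; first exact: plane_place_place ffl e.
apply: (plane_place_discrete ffl e); left.
by rewrite -restr_horner -deriv_restr.
Qed.

(** Both local rings dominate that of the smooth point (r, 0) of f_l = 0, so all three coincide.
    Residues of the coordinate ratios determine the point up to a scalar, and the normalization of
    coordinates fixes the scalar. *)
Lemma centred_point_unique q q' l r : root_at_infinity delta fK (l, r) -> C q -> C q' ->
  centred_at iota delta f g q l r -> centred_at iota delta f g q' l r -> q = q'.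
Proof.
move=> R Cq Cq'; have [pl [t dv]] := root_place R; case: (R) => h /= [H _ _].
have [j qj] := exists_coord Cq; have [j' qj'] := exists_coord Cq'.
move=> /(centred_atP uni ff0 ff x0 y0 van smooth eqC sc Cq qj r H) [hx hy].
move=> /(centred_atP uni ff0 ff x0 y0 van smooth eqC sc Cq' qj' r H) [hx' hy'].
have pq := proj_place_place ff van smooth eqC sc Cq qj.
have pq' := proj_place_place ff van smooth eqC sc Cq' qj'.
have back := place_sub_eq pq pl dv (fun u v H => plane_place_sub pq hx hy H).
have back' := place_sub_eq pq' pl dv (fun u v H => plane_place_sub pq' hx' hy' H).
have z i := back _ _ (proj_place_ratio iota g phi x y q j i).
have z' i := back' _ _ (proj_place_ratio iota g phi x y q' j' i).
have gj : ga j != 0 := gamma_at_neq0 ff van smooth eqC sc Cq qj.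
have gj' : ga j' != 0 := gamma_at_neq0 ff van smooth eqC sc Cq' qj'.
have eq : q' = q' 0 j *: q.
  apply/rowP => i; rewrite mxE; apply: (place_uniq pl (z' i)).
  have -> : gamma iota g phi x y i / gamma iota g phi x y j' =
      (ga j / ga j') * (ga i / ga j) by rewrite /ga in gj gj' *; field; rewrite gj gj'.
  by apply: (placeM pl); [apply: z'|apply: z].
have e1 : q' 0 j = 1.
  apply: (@proj_point_scale _ _ q); first by case: Cq.
  by rewrite -eq; case: Cq'.
by rewrite eq e1 scale1r.
Qed.

Lemma centred_at_infinity q l r : root_at_infinity delta fK (l, r) -> C q ->
  centred_at iota delta f g q l r -> point_at_infinity iota f G g q.
Proof.
move=> R Cq; case: (R) => h /= [H r0 _]; have [j qj] := exists_coord Cq.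
move=> /(centred_atP uni ff0 ff x0 y0 van smooth eqC sc Cq qj r H) c.
apply: (not_unit_at_infinity ff van smooth eqC sc Cq qj).
have pq := proj_place_place ff van smooth eqC sc Cq qj.
exact: (centred_not_torus uni ff0 ff x0 y0 pq H r0 c).
Qed.

(** Projective space is proper: division by a homogeneous coordinate of least valuation makes all
    coordinates regular, and their residues, not all 0, form a point that satisfies the equations of
    C. *)
Lemma centre_of_place (P : F -> K -> Prop) t : place phi P -> discrete P t ->
  exists (q : 'rV[K]_N.+1) j, [/\ C q, q 0 j = 1 & forall i, P (ga i / ga j) (q 0 i)].
Proof.
move=> pl dv.
have val i : exists e : int, ga i != 0 -> vex P t e (ga i).
  have [_|gi] := eqVneq (ga i) 0; first by exists 0.
  by have [e he] := vexP dv gi; exists e.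
have [v hv] := fun_choice val.
have [i1 gi1] := gamma_neq0 ff smooth eqC sc.
have mem_i1 : i1 \in [seq i <- enum 'I_N.+1 | ga i != 0].
  by rewrite mem_filter mem_enum andbT.
have [i2 + min2] := seq_argmin v mem_i1; rewrite mem_filter => /andP[gi2 _].
have hw i : exists w, P (ga i / ga i2) w.
  have [gi|gi] := eqVneq (ga i) 0.
    by exists 0; rewrite gi mul0r; apply: place0 pl.
  apply: (@vge_placeW _ _ P t); apply: (@vge_le _ _ _ _ pl _ dv _ (v i - v i2)).
    by rewrite subr_ge0 min2 // mem_filter gi mem_enum.
  exact: vex_vge (vexM pl dv (hv i gi) (vexV pl (hv i2 gi2))).
have [w Hw] := fun_choice hw.
have w2 : w i2 != 0.
  have := Hw i2; rewrite divff // => /(place_uniq pl (place1 pl)) <-.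
  exact: oner_neq0.
(* The first nonzero residue, since the representative of a projective point must have 1 as its
   first nonzero entry. *)
case: (@arg_minnP _ i2 (fun i => w i != 0) (fun i => i : nat) w2) => j wj minj.
pose q : 'rV[K]_N.+1 := \row_i (w i / w j).
have gj : ga j != 0.
  by have := place_neq0 pl wj (Hw j); rewrite mulf_eq0 negb_or => /andP[].
have hq i : P (ga i / ga j) (q 0 i).
  rewrite mxE; have -> : ga i / ga j = (ga i / ga i2) / (ga j / ga i2).
    by field; rewrite gj gi2.
  by apply: (placeM pl) (Hw i) _; apply: (placeV pl).
have qj : q 0 j = 1 by rewrite mxE divff.
exists q, j; split=> //; split.
  exists j; split=> // i ij; rewrite mxE.
  have -> : w i = 0; last by rewrite mul0r.
  by apply/eqP/negPn/negP => /minj; rewrite leqNgt ij.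
move=> i; apply: (place_uniq pl (place_mmap pl (GK i) hq)).
have -> : mmap phi (fun i => ga i / ga j) (GK i) = 0; last exact: place0 pl.
have [hG _ _] := sc.1; have [d hd] := hG i.
have := pF_equation ff van smooth eqC sc i.
rewrite (mmap_homog_div phi hd gj) => /eqP.
by rewrite mulf_eq0 expf_eq0 (negbTE gj) andbF => /eqP.
Qed.

Lemma root_has_point l r : root_at_infinity delta fK (l, r) ->
  exists2 q, C q & centred_at iota delta f g q l r.
Proof.
move=> R; have [pl [t dv]] := root_place R; case: (R) => h /= [H r0 sr].
have [q [j [Cq qj hq]]] := centre_of_place pl dv; exists q => //.
apply/(centred_atP uni ff0 ff x0 y0 van smooth eqC sc Cq qj r H).
have pq := proj_place_place ff van smooth eqC sc Cq qj.
have [t' dv'] := proj_place_discrete ff van smooth eqC sc Cq qj.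
have back := place_sub_eq pl pq dv' (proj_place_sub (iota := iota) (g := g) pl hq).
by split; apply: back; [apply: plane_placeX|apply: plane_placeY].
Qed.

Hypothesis nonempty : exists p, plane_curve f0 p.

Lemma point_has_root q : point_at_infinity iota f G g q ->
  exists l r, root_at_infinity delta fK (l, r) /\ centred_at iota delta f g q l r.
Proof.
move=> [Cq ninf]; have [j qj] := exists_coord Cq.
have pq := proj_place_place ff van smooth eqC sc Cq qj.
have [t dv] := proj_place_discrete ff van smooth eqC sc Cq qj.
have logd : ~ (ev2 phi x y (logdX f0) = 0 /\ ev2 phi x y (logdY f0) = 0).
  move=> [/van vX /van vY]; have [p Cp] := nonempty.
  by case: (smooth Cp); rewrite ?vX ?vY // eqxx.
have [|l [r [R c]]] := place_at_infinity uni ff0 ff x0 y0 pq dv logd.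
  move=> [c [d [c0 d0 hx hy]]]; apply: ninf.
  exact: (unit_not_at_infinity ff van smooth eqC sc Cq qj c0 d0 hx hy).
exists l, r; split=> //; case: R => h /= [H _ _].
exact/(centred_atP uni ff0 ff x0 y0 van smooth eqC sc Cq qj r H).
Qed.

Lemma centred_root_unique q l r l' r' : C q ->
  root_at_infinity delta fK (l, r) -> root_at_infinity delta fK (l', r') ->
  centred_at iota delta f g q l r -> centred_at iota delta f g q l' r' ->
  (l, r) = (l', r').
Proof.
move=> Cq R R'; have [j qj] := exists_coord Cq.
case: (R) => h /= [H _ _]; case: (R') => h' /= [H' _ _].
move=> /(centred_atP uni ff0 ff x0 y0 van smooth eqC sc Cq qj r H) c.
move=> /(centred_atP uni ff0 ff x0 y0 van smooth eqC sc Cq qj r' H') c'.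
have pq := proj_place_place ff van smooth eqC sc Cq qj.
have [t dv] := proj_place_discrete ff van smooth eqC sc Cq qj.
exact: (centred_index_unique uni ff0 ff x0 y0 pq dv R R' c c').
Qed.

End Correspondence.

(** * Galois action *)

Section Galois.
Variables (k : fieldType) (K : closedFieldType) (iota : {rmorphism k -> K}).
Variables (delta : int * int -> int * int) (sigma : {rmorphism K -> K}).
Hypothesis bij : bijective sigma.
Hypothesis fixed : forall c, sigma (iota c) = iota c.

Let sp (p : K * K) : K * K := (sigma p.1, sigma p.2).

Definition conj_bipoly (h : {poly {poly K}}) : {poly {poly K}} :=
  map_poly (map_poly sigma) h.

Lemma bicoef_conj h m : bicoef (conj_bipoly h) m = sigma (bicoef h m).
Proof.
by case: m => [[i|i] [j|j]] /=; rewrite ?rmorph0 // !coef_map.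
Qed.

Lemma restr_conj h : restr (conj_bipoly h) = map_poly sigma (restr h).
Proof.
apply/polyP => i; rewrite /restr /conj_bipoly !coef_map /= /horner_eval.
by rewrite !horner_coef0 coef_map.
Qed.

Lemma translate_conj h a :
  translate (conj_bipoly h) (sigma a) = conj_bipoly (translate h a).
Proof.
rewrite /translate /conj_bipoly map_comp_poly; congr (_ \Po _).
by rewrite rmorphD /= map_polyX map_polyC /= map_polyC.
Qed.

Lemma simple_root_conj p r : simple_root p r -> simple_root (map_poly sigma p) (sigma r).
Proof.
move=> /simple_rootP[pr dpr]; apply/simple_rootP.
by rewrite deriv_map !horner_map pr rmorph0 fmorph_eq0.
Qed.

Lemma multiple_root_conj p r :
  multiple_root p r -> multiple_root (map_poly sigma p) (sigma r).
Proof.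
move=> mr; have p0 : p != 0.
  apply/eqP => p0; move: mr; rewrite /multiple_root p0 /mup.
  by case: arg_maxnP => // -[[|i] hi] //=; rewrite size_poly0 in hi.
have [q e] := multiple_rootP mr.
have pr : p.[r] = 0 by rewrite e exprS -!mulrA hornerM hornerXsubC subrr mul0r.
have [||sr|//] := @root_simple_or_multiple _ (map_poly sigma p) (sigma r).
- by rewrite map_poly_eq0.
- by rewrite horner_map pr rmorph0.
case: (@multiple_not_simple _ p r) => //; apply/simple_rootP; split=> //.
by have [_] := (simple_rootP _ _).1 sr; rewrite deriv_map horner_map fmorph_eq0.
Qed.

Lemma edge_normal_conj (c c' : int * int -> K) b : (forall m, c' m = sigma (c m)) ->
  edge_normal (newton_polygon c) b -> edge_normal (newton_polygon c') b.
Proof.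
move=> e /edge_normalP[cop [m1 [m2 [ne c1 c2 d mi]]]]; apply/edge_normalP.
split=> //; exists m1, m2; split; rewrite ?e ?fmorph_eq0 // => m.
by rewrite e fmorph_eq0; apply: mi.
Qed.

Lemma edge_poly_conj (c c' : int * int -> K) b h : (forall m, c' m = sigma (c m)) ->
  edge_poly delta b c h -> edge_poly delta b c' (conj_bipoly h).
Proof.
move=> e [/biX_ndvd[i hi] /biY_ndvd[j hj] [nX [nY E]]]; split.
- by apply/biX_ndvd; exists i; rewrite bicoef_conj fmorph_eq0.
- by apply/biY_ndvd; exists j; rewrite bicoef_conj fmorph_eq0.
- by exists nX, nY => a d; rewrite e bicoef_conj E.
Qed.

Variable f : laurent k.
Let fK := lmap iota f.

Let fK_fixed m : fK m = sigma (fK m).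
Proof. by rewrite lmapE fixed. Qed.

Lemma in_P_conj l h : in_P delta fK l h ->
  in_P delta fK (gal_index sigma l) (conj_bipoly h).
Proof.
elim=> {l h} [b h en ep|l h a b h' _ IH a0 ma b1 b2 en ep] /=.
  apply: in_P_first; first exact: edge_normal_conj fK_fixed en.
  exact: edge_poly_conj fK_fixed ep.
have e m : bicoef (translate (conj_bipoly h) (sigma a)) m =
    sigma (bicoef (translate h a) m) by rewrite translate_conj bicoef_conj.
apply: in_P_next IH _ _ b1 b2 _ _.
- by rewrite fmorph_eq0.
- by rewrite restr_conj; apply: multiple_root_conj.
- exact: edge_normal_conj e en.
- exact: edge_poly_conj e ep.
Qed.

Lemma root_at_infinity_conj l r : root_at_infinity delta fK (l, r) ->
  root_at_infinity delta fK (gal_index sigma l, sigma r).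
Proof.
move=> [h /= [H r0 sr]]; exists (conj_bipoly h); split=> /=.
- exact: in_P_conj.
- by rewrite fmorph_eq0.
- by rewrite restr_conj; apply: simple_root_conj.
Qed.

Let sp_inj : injective sp.
Proof.
move=> [a b] [c d] [e1 e2]; congr (_, _); first exact: (bij_inj bij).
exact: (bij_inj bij).
Qed.

Let sp_surj p : exists p', p = sp p'.
Proof.
case: bij => tau sK tK; exists (tau p.1, tau p.2).
by rewrite /sp /= !tK -surjective_pairing.
Qed.

Let sp_torus p : in_torus (sp p) <-> in_torus p.
Proof. by rewrite /in_torus /= !fmorph_eq0. Qed.

Let sp_monomial b p : monomial_subst delta b (sp p) = sp (monomial_subst delta b p).
Proof. by rewrite /sp /monomial_subst /= !rmorphM /= !fmorphXz. Qed.

Lemma chart_conj l p P : chart delta (gal_index sigma l) (sp p) (sp P) -> chart delta l p P.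
Proof.
elim: l p P => [b|l IH a b] p P /= [/sp_torus tP].
  by rewrite sp_monomial => /sp_inj e.
move=> [Q [cQ eQ]]; split=> //; have [Q' eQ'] := sp_surj Q; subst Q.
exists Q'; split; first exact: IH.
by apply: sp_inj; rewrite -sp_monomial -eQ /sp /= rmorphB.
Qed.

Lemma leval_conj (h : laurent k) p :
  leval (lmap iota h) (sp p) = sigma (leval (lmap iota h) p).
Proof.
rewrite !leval_lmap rmorph_sum; apply: eq_bigr => u _.
by rewrite !rmorphM /= !fmorphXz fixed.
Qed.

Lemma torus_curve_conj p : torus_curve fK (sp p) -> torus_curve fK p.
Proof.
move=> [/sp_torus tp]; rewrite leval_conj => /eqP.
by rewrite fmorph_eq0 => /eqP.
Qed.

Variables (N m : nat) (G : 'I_m -> {mpoly k[N.+1]}) (g : 'I_N.+1 -> laurent k).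

Lemma map_eval_conj p : map_eval iota g (sp p) = map_mx sigma (map_eval iota g p).
Proof. by apply/rowP => i; rewrite !mxE leval_conj. Qed.

Lemma peval_conj (Q : {mpoly K[N.+1]}) v :
  peval (map_mpoly sigma Q) (map_mx sigma v) = sigma (peval Q v).
Proof.
rewrite /peval; elim/mpoly_closed_ind: Q => [c|i|a b Ha Hb|a b Ha Hb].
- by rewrite map_mpolyC !mevalC.
- by rewrite map_mpolyX !mevalXU mxE.
- by rewrite rmorphD !mevalD Ha Hb rmorphD.
- by rewrite rmorphM !mevalM Ha Hb rmorphM.
Qed.

Lemma proj_zeros_conj q : proj_zeros (fun i => map_mpoly iota (G i)) q ->
  proj_zeros (fun i => map_mpoly iota (G i)) (map_mx sigma q).
Proof.
move=> [[i [qi zi]] hq]; split.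
  by exists i; split=> [|j /zi z]; rewrite mxE ?qi ?z ?rmorph1 ?rmorph0.
move=> a; rewrite (_ : map_mpoly iota (G a) = map_mpoly sigma (map_mpoly iota (G a))).
  by rewrite peval_conj hq rmorph0.
by apply/mpolyP => u; rewrite !mcoeff_map_mpoly /= fixed.
Qed.

(** Conjugating the coefficients of the three forms gives witnesses for the conjugate data.
    Surjectivity of [sigma] is what lets every point and chart value be written as a conjugate. *)
Lemma centred_at_conj q l r : centred_at iota delta f g q l r ->
  centred_at iota delta f g (map_mx sigma q) (gal_index sigma l) (sigma r).
Proof.
move=> [d [U [V [H [[hU hV hH] [H0 eU V0] key]]]]].
exists d, (map_mpoly sigma U), (map_mpoly sigma V), (map_mpoly sigma H).
split; first by split; apply: dhomog_map.
  by rewrite !peval_conj fmorph_eq0 eU V0 rmorphM rmorph0.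
move=> p P; have [p' ->] := sp_surj p; have [P' ->] := sp_surj P.
move=> /torus_curve_conj Cp; rewrite map_eval_conj map_mx_eq0 => np /chart_conj cP.
by have [e1 e2] := key p' P' Cp np cP; rewrite !peval_conj e1 e2 !rmorphM.
Qed.

End Galois.

Theorem theorem1p6 (k : fieldType) (K : closedFieldType)
    (iota : {rmorphism k -> K}) (delta : int * int -> int * int)
    (f : laurent k) (N m : nat) (G : 'I_m -> {mpoly k[N.+1]})
    (g : 'I_N.+1 -> laurent k) :
  perfect k ->
  integralRange iota ->
  (forall beta : int * int, coprimez beta.1 beta.2 ->
     (delta beta).1 * beta.2 - (delta beta).2 * beta.1 = 1) ->
  torus_smooth (lmap iota f) ->
  torus_connected (torus_curve (lmap iota f)) ->
  smooth_completion iota f G g ->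
  exists Phi : 'rV[K]_N.+1 -> edge_index K * K,
    [/\ (* Phi is a bijection *)
        [/\ forall q, point_at_infinity iota f G g q ->
              root_at_infinity delta (lmap iota f) (Phi q),
            forall q q', point_at_infinity iota f G g q ->
              point_at_infinity iota f G g q' -> Phi q = Phi q' -> q = q' &
            forall t, root_at_infinity delta (lmap iota f) t ->
              exists2 q, point_at_infinity iota f G g q & Phi q = t],
        (* Phi is Galois equivariant *)
        forall sigma : {rmorphism K -> K}, bijective sigma ->
          (forall c, sigma (iota c) = iota c) ->
          forall q, point_at_infinity iota f G g q ->
            point_at_infinity iota f G g (map_mx sigma q) /\
            Phi (map_mx sigma q) = (gal_index sigma (Phi q).1, sigma (Phi q).2) &
        (* Phi is natural *)
        forall q, point_at_infinity iota f G g q ->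
          centred_at iota delta f g q (Phi q).1 (Phi q).2].
Proof.
move=> _ _ uni smooth connected sc.
have [f0 [n [F [phi [x [y [[ff0 eqC sm] ff van x0 y0]]]]]]] :=
  curve_function_field smooth connected.
have nonempty : exists p, plane_curve f0 p.
  by have [[p Cp] _] := connected; exists p; apply/eqC.
have PhiE q : exists t, point_at_infinity iota f G g q ->
    root_at_infinity delta (lmap iota f) t /\ centred_at iota delta f g q t.1 t.2.
  case: (classic (point_at_infinity iota f G g q)) => [inf|ninf].
    have [l [r [R c]]] := point_has_root uni ff0 ff x0 y0 van sm eqC sc nonempty inf.
    by exists (l, r).
  (* An arbitrary value away from the points at infinity. *)
  by exists (First K (0, 0), 0).
have [Phi spec] := fun_choice PhiE.
have rootPhi q (inf : point_at_infinity iota f G g q) : root_at_infinity delta (lmap iota f) ((Phi q).1, (Phi q).2).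
  by rewrite -surjective_pairing; have [] := spec q inf.
have uniq q l r : root_at_infinity delta (lmap iota f) (l, r) ->
    point_at_infinity iota f G g q -> centred_at iota delta f g q l r -> Phi q = (l, r).
  move=> R inf c; rewrite [Phi q]surjective_pairing.
  apply: (centred_root_unique uni ff0 ff x0 y0 van sm eqC sc inf.1 (rootPhi q inf) R) c.
  by have [] := spec q inf.
exists Phi; split; last by move=> q /spec[].
- split=> [q /spec[] //|q q' inf inf' e|[l r] R].
    apply: (centred_point_unique uni ff0 ff x0 y0 van sm eqC sc (rootPhi q inf) inf.1 inf'.1).
      by have [] := spec q inf.
    by rewrite e; have [] := spec q' inf'.
  have [q Cq c] := root_has_point uni ff0 ff x0 y0 van sm eqC sc R.
  have inf := centred_at_infinity uni ff0 ff x0 y0 van sm eqC sc R Cq c.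
  by exists q => //; apply: uniq.
(* Equivariance is a consequence of uniqueness: the conjugate of [Phi q] is centred at the conjugate
   of [q], and only one pair is. *)
- move=> sigma bij fixed q inf.
  have R := root_at_infinity_conj fixed (rootPhi q inf).
  have c := centred_at_conj bij fixed (spec q inf).2.
  have Cq := proj_zeros_conj fixed inf.1.
  have inf' := centred_at_infinity uni ff0 ff x0 y0 van sm eqC sc R Cq c.
  by split=> //; apply: uniq.
Qed.
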